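(* Let $(X,d)$ be a complete metric space with a doubling measure $\mu$, let $E\subset X$ be a measurable set with $\mu(E)>0$, and let $w$ be a weight on $E$. For $1<p<\infty$, the following statements are equivalent: (i) There exists a weight $W\in A_p(X)$ such that $W=w$ a.e. on $E$. (ii) There exists an $\varepsilon>0$ such that $$\sup_{\substack{B\subset X\\ B\text{ ball}}}\left(\frac{1}{\mu(B)}\int_{B\cap E}w^{1+\varepsilon}\,d\mu\right)\left(\frac{1}{\mu(B)}\int_{B\cap E}\left(\frac{1}{w^{1+\varepsilon}}\right)^{\frac{1}{p-1}}\,d\mu\right)^{p-1}<\infty .$$ For $p=1$, the following statements are equivalent: (i) There exists a weight $W\in A_1(X)$ such that $W=w$ a.e. on $E$. (ii) There exist an $\varepsilon>0$ and a constant $C>0$ such that $$\frac{1}{\mu(B)}\int_{B\cap E}w^{1+\varepsilon}\,d\mu\le C\operatorname*{ess\,inf}_{B\cap E}w^{1+\varepsilon}\qquad\text{for every ball }B\subset X.$$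
   Context: The measure $\mu$ is a nontrivial Borel regular measure on $X$. It is doubling: there is a constant $C_d>1$ with $0<\mu(2B)\le C_d\,\mu(B)<\infty$ for all balls $B\subset X$. A ball is $B=B(x,r)=\{y\in X: d(x,y)<r\}$, taken together with its center $x$ and radius $r$; $cB=B(x,cr)$. For a measurable set $E\subset X$, $f$ is locally integrable on $E$ if it is integrable on every compact subset of $E$. A weight on $E$ is a nonnegative locally integrable function on $E$, assumed positive almost everywhere in $E$. For $1<p<\infty$, $A_p(X)$ is the class of weights $W$ on $X$ with $$\sup_{B\subset X\text{ ball}}\left(\frac{1}{\mu(B)}\int_{B}W\,d\mu\right)\left(\frac{1}{\mu(B)}\int_{B}\left(\frac1W\right)^{\frac{1}{p-1}}d\mu\right)^{p-1}<\infty .$$ $A_1(X)$ is the class of weights $W$ on $X$ for which there is $C>0$ with $\frac{1}{\mu(B)}\int_B W\,d\mu\le C\operatorname*{ess\,inf}_B W$ for every ball $B\subset X$. The essential infimum over a set of measure zero is $+\infty$. *)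

(* Defs.v *)
From HB Require Import structures.
From mathcomp Require Import all_boot all_order all_algebra.
From mathcomp Require Import all_classical all_reals all_analysis.
From mathcomp Require Import ess_sup_inf.

Set Implicit Arguments.
Unset Strict Implicit.
Unset Printing Implicit Defensive.

Import Order.TTheory GRing.Theory Num.Theory.

Local Open Scope classical_set_scope.
Local Open Scope ring_scope.
Local Open Scope ereal_scope.

#[short(type="completeMetricType")]
HB.structure Definition CompleteMetric (R : numDomainType) :=
  { M of Metric R M & Complete M }.

Section Weights.
Context {R : realType} {X : completeMetricType R}.
Variable mu : {outer_measure set X -> \bar R}.

(* As usual for Borel regular measures, mu is an outer measure on all subsets
   of X and "measurable" means Caratheodory measurable. [mu_cara] is mu as a
   measure on that sigma-algebra; [caratheodory_type mu] is convertible to X. *)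
Definition mu_cara : {measure set (caratheodory_type mu) -> \bar R} :=
  [the {measure set (caratheodory_type mu) -> \bar R} of
    (mu : set (caratheodory_type mu) -> \bar R)].

Definition borel_regular :=
  (open : set (set X)) `<=` mu.-caratheodory /\
  forall A : set X, exists B : set X,
    [/\ <<s (open : set (set X)) >> B, A `<=` B & mu B = mu A].

Definition doubling :=
  exists Cd : R, (1 < Cd)%R /\
    forall (x : X) (r : R), (0 < r)%R ->
      [/\ 0 < mu (ball x (2 * r)%R),
          mu (ball x (2 * r)%R) <= Cd%:E * mu (ball x r) &
          Cd%:E * mu (ball x r) < +oo].

(* In a [metricType], [ball x r] is [set y | mdist x y < r] (ballEmdist). *)
Definition balls : set (set X) :=
  [set B | exists (x : X) (r : R), (0 < r)%R /\ B = ball x r].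

(* Integrability on K bounds the integral of `|f| and includes measurability;
   as in the library's [locally_integrable], f is also measurable on E. *)
Definition locally_integrable_on (E : set X) (f : X -> R) :=
  measurable_fun (E : set (caratheodory_type mu)) f /\
  forall K : set X, K `<=` E -> compact K ->
    mu_cara.-integrable K (EFin \o f).

Definition weight_on (E : set X) (w : X -> R) :=
  [/\ forall x, E x -> (0 <= w x)%R,
      locally_integrable_on E w &
      {ae mu_cara, forall x, E x -> (0 < w x)%R}].

(* mu(B)^-1 times the integral over A, where A is B or B `&` E below *)
Definition normalized_integral (B A : set X) (f : X -> R) : \bar R :=
  (fine (mu B))^-1%:E * \int[mu_cara]_(x in A) (f x)%:E.

(* Setting f to +oo off A makes only the points of A count, and gives +oo
   when mu A = 0. *)
Definition ess_inf_on (A : set X) (f : X -> R) : \bar R :=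
  ess_inf mu_cara (patch (fun=> +oo) A (EFin \o f)).

Definition Ap_class (p : R) (W : X -> R) :=
  weight_on [set: X] W /\
  ereal_sup [set normalized_integral B B W *
                 normalized_integral B B
                   (fun x => (1 / W x) `^ (1 / (p - 1)))%R `^ (p - 1)
            | B in balls] < +oo.

Definition A1_class (W : X -> R) :=
  weight_on [set: X] W /\
  exists C : R, (0 < C)%R /\
    forall B, balls B -> normalized_integral B B W <= C%:E * ess_inf_on B W.

End Weights.

(* Main.v *)
Require Import Defs.
From HB Require Import structures.
From mathcomp Require Import all_boot all_order all_algebra.
From mathcomp Require Import all_classical all_reals all_analysis.
From mathcomp Require Import measurable_realfun ess_sup_inf.
From mathcomp Require Import ring lra.

(** Write [M E f] for the uncentred maximal function of [f] restricted to [E].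

    Extension for [p = 1].  Put [g = w `^ (1 + e)].  The hypothesis says that
    [M E g <= K * g] almost everywhere on [E] ([maxfun_ae_le]).  By Coifman and
    Rochberg, [M E g] raised to [(1 + e)^-1 < 1] is an [A_1] weight on the whole
    space, and on [E] it is comparable to [w]; replacing it there by [w] itself
    keeps the [A_1] condition ([A1_extension]).  The exponent [e > 0] is exactly
    what makes the power smaller than 1.

    Extension for [p > 1].  The plan is to factor a power of [w] on [E] into two
    functions of the previous kind.  Half of the exponent [e] is spent on
    lowering the index: [v = w `^ (1 + e / 2)] satisfies the restricted
    condition with an index smaller than [p], and so does its dual weight
    ([Ap_pair_openness]).  The covering lemma and Marcinkiewicz interpolation
    then bound [M E] on the [L^p] space of [v] and on the dual space
    ([strong_type]).  An increasing iteration of both operators has a limit [h]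
    of finite [L^p] norm such that [M E] maps both [h] and [h `^ (p - 1) * v]
    below multiples of themselves ([factorization]).  The other half of [e] extends the powers
    of these two functions with exponent [(1 + e / 2)^-1] to [A_1] weights
    [W2] and [W1], and [W1 * W2 `^ (1 - p)] is the [A_p] weight
    ([A1_product], [Ap_extension]).

    Restriction.  If [W] is in [A_p], then [W] and [W `^ (- (p - 1)^-1)] exceed
    a fixed fraction of their mean outside a small part of each ball
    ([Ap_Ainf]).  This bounds the integral of such a weight over a
    superlevel set by the measure of a lower one ([level_estimate]), so that
    both weights satisfy a reverse Holder inequality ([reverse_holder]); hence [W `^ (1 + e)] is in [A_p] for some
    [e > 0], and restricting the integrals to [E] only decreases them.  The
    case [p = 1] is the same with one weight.  This part uses the density of
    superlevel sets, which rests on the Borel regularity of the measure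
    ([borel_outer_regular]).

    The analysis takes place on a measurable type with a distance function
    whose balls are measurable ([doubling_space]); at the end it is applied to
    the Caratheodory sigma-algebra of the outer measure. *)

Set Implicit Arguments.
Unset Strict Implicit.
Unset Printing Implicit Defensive.

Import Order.TTheory GRing.Theory Num.Theory.

Local Open Scope classical_set_scope.
Local Open Scope ring_scope.
Local Open Scope ereal_scope.

(** * Integrals of nonnegative measurable functions *)

Section Integrals.
Context d (T : measurableType d) (R : realType) (mu : {measure set T -> \bar R}).
Implicit Types (A B : set T) (f g : T -> \bar R).

(** Integrands are total, so that integrals over subsets and restrictions carry
    no measurability conditions of their own. *)
Definition nnmfun f := measurable_fun [set: T] f /\ forall x, 0 <= f x.

Lemma nnmfun_cst (c : \bar R) : 0 <= c -> nnmfun (cst c).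
Proof. by move=> c0; split => //; exact: measurable_cst. Qed.

Lemma nnmfunD f g : nnmfun f -> nnmfun g -> nnmfun (f \+ g).
Proof.
move=> [mf f0] [mg g0]; split; first exact: emeasurable_funD.
by move=> x; rewrite adde_ge0.
Qed.

Lemma nnmfunM f g : nnmfun f -> nnmfun g -> nnmfun (f \* g).
Proof.
move=> [mf f0] [mg g0]; split; first exact: emeasurable_funM.
by move=> x; rewrite mule_ge0.
Qed.

Lemma nnmfun_max f g :
  nnmfun f -> nnmfun g -> nnmfun (fun x => maxe (f x) (g x)).
Proof.
move=> [mf f0] [mg g0]; split; first exact: measurable_maxe.
by move=> x; rewrite le_max f0.
Qed.

Lemma nnmfun_pow f (p : R) : nnmfun f -> nnmfun (fun x => f x `^ p).
Proof.
move=> [mf f0]; split; last by move=> x; exact: poweR_ge0.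
by apply: (measurableT_comp (measurable_poweR p)).
Qed.

Lemma nnmfun_restrict f A : measurable A -> nnmfun f -> nnmfun (f \_ A).
Proof.
move=> mA [mf f0]; split; last by move=> x; exact: erestrict_ge0.
by apply/(measurable_restrictT _ mA); exact: measurable_funTS.
Qed.

Lemma nnmfun_EFin (u : T -> R) : measurable_fun [set: T] u ->
  (forall x, (0 <= u x)%R) -> nnmfun (EFin \o u).
Proof.
move=> mu_ u0; split; first exact/measurable_EFinP.
by move=> x; rewrite lee_fin.
Qed.

Lemma nnint_ge0 A f : nnmfun f -> 0 <= \int[mu]_(x in A) f x.
Proof. by move=> [_ f0]; apply: integral_ge0 => x _; exact: f0. Qed.

Lemma nnint_le A f g : measurable A -> nnmfun f -> nnmfun g ->
  (forall x, A x -> f x <= g x) ->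
  \int[mu]_(x in A) f x <= \int[mu]_(x in A) g x.
Proof.
move=> mA [mf f0] [mg g0] fg; apply: ge0_le_integral => //.
- exact: measurable_funTS.
- exact: measurable_funTS.
Qed.

Lemma nnint_ae_le A f g : measurable A -> nnmfun f -> nnmfun g ->
  {ae mu, forall x, A x -> f x <= g x} ->
  \int[mu]_(x in A) f x <= \int[mu]_(x in A) g x.
Proof.
move=> mA [mf f0] [mg g0] fg; apply: ae_ge0_le_integral => //.
- exact: measurable_funTS.
- exact: measurable_funTS.
Qed.

Lemma nnint_subset A B f : measurable A -> measurable B -> nnmfun f ->
  A `<=` B -> \int[mu]_(x in A) f x <= \int[mu]_(x in B) f x.
Proof.
move=> mA mB [mf f0] AB; apply: ge0_subset_integral => //.
exact: measurable_funTS.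
Qed.

Lemma nnintD A f g : measurable A -> nnmfun f -> nnmfun g ->
  \int[mu]_(x in A) (f x + g x) =
  \int[mu]_(x in A) f x + \int[mu]_(x in A) g x.
Proof.
by move=> mA [mf f0] [mg g0]; apply: ge0_integralD => //; exact: measurable_funTS.
Qed.

Lemma nnintZl A f (c : \bar R) : measurable A -> nnmfun f -> 0 <= c ->
  \int[mu]_(x in A) (c * f x) = c * \int[mu]_(x in A) f x.
Proof.
by move=> mA [mf f0] c0; apply: ge0_integralZl => //; exact: measurable_funTS.
Qed.

Lemma nnint_setU_le A B f : measurable A -> measurable B -> nnmfun f ->
  \int[mu]_(x in A `|` B) f x <= \int[mu]_(x in A) f x + \int[mu]_(x in B) f x.
Proof.
move=> mA mB nf; have -> : A `|` B = A `|` (B `\` A).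
  apply/seteqP; split => x [Ax|Bx]; [by left| |by left|by right; case: Bx].
  by have [Ax|Ax] := pselect (A x); [left|right].
rewrite ge0_integral_setU //.
- apply: leeD2l; apply: nnint_subset => //; first exact: measurableD.
- exact: measurableD.
- exact: measurable_funTS nf.1.
- by move=> x _; exact: nf.2.
- by apply/disj_setPS => x [Ax [_ /(_ Ax)]].
Qed.

Lemma nnint_setU A B f : measurable A -> measurable B -> nnmfun f ->
  A `&` B = set0 ->
  \int[mu]_(x in A `|` B) f x = \int[mu]_(x in A) f x + \int[mu]_(x in B) f x.
Proof.
move=> mA mB nf AB; rewrite ge0_integral_setU //.
- exact: measurable_funTS nf.1.
- by move=> x _; exact: nf.2.
- by apply/disj_setPS; rewrite AB.
Qed.

Lemma nnint_bigcup_le (S : nat -> set T) f (c : \bar R) :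
  (forall n, measurable (S n)) -> nondecreasing_seq S -> nnmfun f ->
  (forall n, \int[mu]_(x in S n) f x <= c) ->
  \int[mu]_(x in \bigcup_n S n) f x <= c.
Proof.
move=> mS nS nf Sc.
have cv := @ge0_nondecreasing_set_cvg_integral _ T R S f mu nS mS
  (fun i => measurable_funTS nf.1) (fun i x _ => nf.2 x).
rewrite -(cvg_lim _ cv) //; apply: lime_le.
  by apply/cvg_ex; eexists; exact: cv.
by apply: nearW.
Qed.

Lemma nnmfun_sup (h : nat -> T -> \bar R) : (forall n, nnmfun (h n)) ->
  nnmfun (fun x => ereal_sup (range (h^~ x))).
Proof.
move=> nh; split; last first.
  by move=> x; apply: (le_trans ((nh 0%N).2 x)); apply: ereal_sup_ubound; exists 0%N.
rewrite (_ : (fun x => _) = (fun x => esups (h^~ x) 0%N)); last first.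
  apply/funext => x; congr ereal_sup; apply/seteqP; split => [_ [n _ <-]|_ [n _ <-]] /=.
    by exists n.
  by exists n.
apply: measurable_fun_esups => n; exact: (nh n).1.
Qed.

Lemma nnint_sup A (h : nat -> T -> \bar R) : measurable A ->
  (forall n, nnmfun (h n)) ->
  (forall x, nondecreasing_seq (h^~ x)) ->
  \int[mu]_(x in A) ereal_sup (range (h^~ x)) =
  ereal_sup (range (fun n => \int[mu]_(x in A) h n x)).
Proof.
move=> mA nh ndh.
have nd : nondecreasing_seq (fun n => \int[mu]_(x in A) h n x).
  by move=> m n mn; apply: nnint_le => // x _; exact: ndh.
have /cvg_lim <- // := @ereal_nondecreasing_cvgn R _ nd.
rewrite -monotone_convergence //.
- apply: eq_integral => x _; apply/esym/cvg_lim => //.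
  exact: ereal_nondecreasing_cvgn.
- by move=> n; apply: measurable_funTS; exact: (nh n).1.
- by move=> n x _; exact: (nh n).2.
Qed.

End Integrals.

(** * Doubling metric measure spaces *)

Section Doubling.
Context d (T : measurableType d) (R : realType) (mu : {measure set T -> \bar R}).
Context (dist : T -> T -> R).
Local Open Scope ring_scope.

Definition dball (x : T) (r : R) : set T := [set y | dist x y < r].

(** Balls are the only sets assumed measurable: the sigma-algebra need not be
    generated by a topology. *)
Record doubling_space (C : R) : Prop := DoublingSpace {
  dist_refl : forall x, dist x x = 0 ;
  dist_symm : forall x y, dist x y = dist y x ;
  dist_tri : forall x y z, dist x z <= dist x y + dist y z ;
  measurable_dball : forall x r, measurable (dball x r) ;
  doubling_ge1 : 1 <= C ;
  dball_gt0 : forall x r, 0 < r -> (0 < mu (dball x r))%E ;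
  dball_lty : forall x r, 0 < r -> (mu (dball x r) < +oo)%E ;
  dball_double : forall x r, 0 < r ->
    (mu (dball x (2 * r)) <= C%:E * mu (dball x r))%E }.

Definition vol x r := fine (mu (dball x r)).

Variable (C : R).
Hypothesis X : doubling_space C.

Let dxx := dist_refl X.
Let dsym := dist_symm X.
Let dtri := dist_tri X.
Let mB := measurable_dball X.

Lemma dist_ge0 x y : 0 <= dist x y.
Proof.
have := dtri x y x; rewrite dxx (dsym y x); lra.
Qed.

Lemma mem_dball x r : 0 < r -> dball x r x.
Proof. by rewrite /dball /= dxx. Qed.

Lemma dball_sub x y r s : dist x y + r <= s -> dball y r `<=` dball x s.
Proof. by move=> h z; rewrite /dball /= => zr; have := dtri x y z; lra. Qed.

Lemma dball_subr x r s : r <= s -> dball x r `<=` dball x s.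
Proof. by move=> rs z; rewrite /dball /= => zr; lra. Qed.

Lemma volE x r : 0 < r -> mu (dball x r) = (vol x r)%:E.
Proof.
move=> r0; rewrite /vol fineK// ge0_fin_numE; first exact: (dball_lty X).
by apply: ltW; exact: (dball_gt0 X).
Qed.

Lemma vol_gt0 x r : 0 < r -> 0 < vol x r.
Proof. by move=> r0; rewrite -lte_fin -volE//; exact: (dball_gt0 X). Qed.

Lemma vol_le x y r s : 0 < r -> 0 < s -> dball x r `<=` dball y s ->
  vol x r <= vol y s.
Proof.
by move=> r0 s0 h; rewrite -lee_fin -!volE//; apply: le_measure; rewrite ?inE.
Qed.

Lemma vol_double x r : 0 < r -> vol x (2 * r) <= C * vol x r.
Proof.
move=> r0; rewrite -lee_fin EFinM -!volE//; first exact: (dball_double X).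
by rewrite mulr_gt0.
Qed.

Lemma C_gt0 : 0 < C.
Proof. by have := doubling_ge1 X; lra. Qed.

Lemma vol_pow x r k : 0 < r -> vol x (2 ^+ k * r) <= C ^+ k * vol x r.
Proof.
move=> r0; elim: k => [|k ih]; first by rewrite !expr0 !mul1r.
rewrite exprS -mulrA; apply: (le_trans (vol_double _ _)).
  by rewrite mulr_gt0// exprn_gt0.
by rewrite exprS -mulrA ler_wpM2l// ltW// C_gt0.
Qed.

Lemma vol_3 x r : 0 < r -> vol x (3 * r) <= C ^+ 2 * vol x r.
Proof.
move=> r0; apply: le_trans (vol_pow x 2 r0).
apply: vol_le; rewrite ?mulr_gt0 ?exprn_gt0//.
by apply: dball_subr; lra.
Qed.

Lemma vol_compare x y r s k : 0 < r -> 0 < s -> dist x y + s <= 2 ^+ k * r ->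
  vol y s <= C ^+ k * vol x r.
Proof.
move=> r0 s0 h; apply: le_trans (vol_pow x k r0).
apply: vol_le => //; first by rewrite mulr_gt0// exprn_gt0.
exact: dball_sub.
Qed.

(** Totally bounded: pairwise distant points of a ball carry disjoint balls of
    volume bounded below, so there are boundedly many of them. *)
Lemma dball_net x0 (rho eps : R) : 0 < rho -> 0 < eps ->
  exists s : seq T, forall y, dball x0 rho y ->
    exists2 z, z \in s & dist z y < eps.
Proof.
move=> rho0 eps0; apply: contrapT => no.
have [k hk] : exists k, 4 * (rho + eps) <= 2 ^+ k * eps.
  exists (Num.bound (4 * (rho + eps) / eps)).
  rewrite -ler_pdivrMr//; apply: le_trans (ltW (archi_boundP _)) _.
    by rewrite divr_ge0; lra.
  rewrite -natrX ler_nat; apply: ltnW; exact: ltn_expl.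
pose U (s : seq T) := [set y | exists2 z, z \in s & dball z (eps / 2) y].
have mU s : measurable (U s).
  elim: s => [|z s ih]; first by rewrite (_ : U _ = set0)//; apply/seteqP; split => y [].
  rewrite (_ : U _ = dball z (eps / 2) `|` U s); first exact: measurableU.
  apply/seteqP; split => y.
    move=> [t]; rewrite inE => /predU1P[->|ts] h; first by left.
    by right; exists t.
  case=> [h|[t ts h]]; first by exists z; rewrite ?mem_head.
  by exists t => //; rewrite inE ts orbT.
(* a lower bound for the volume of the balls of radius [eps / 2] below *)
pose c := vol x0 (rho + eps) / C ^+ k.+1.
have Ck0 : 0 < C ^+ k.+1 by rewrite exprn_gt0// C_gt0.
have c0 : 0 < c by rewrite divr_gt0// vol_gt0//; lra.
have grow m : exists s : seq T, (forall z, z \in s -> dball x0 rho z) /\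
    ((m%:R * c)%:E <= mu (U s))%E.
  elim: m => [|m [s [sx hs]]].
    by exists [::]; split=> //; rewrite mul0r measure_ge0.
  have [y yx ys] : exists2 y, dball x0 rho y & forall z, z \in s -> eps <= dist z y.
    apply: contrapT => no2; apply: no; exists s => y yx; apply: contrapT => no3.
    apply: no2; exists y => // z zs; rewrite leNgt; apply/negP => zy.
    by apply: no3; exists z.
  exists (y :: s); split.
    by move=> z; rewrite inE => /predU1P[->//|]; exact: sx.
  have -> : U (y :: s) = dball y (eps / 2) `|` U s.
    apply/seteqP; split => t.
      move=> [z]; rewrite inE => /predU1P[->|zs] h; first by left.
      by right; exists z.
    case=> [h|[z zs h]]; first by exists y; rewrite ?mem_head.
    by exists z => //; rewrite inE zs orbT.
  rewrite measureU//; last first.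
    apply/seteqP; split => // t [/=]; rewrite /dball /= => ty [z zs].
    rewrite /dball /= => tz; have := ys z zs; have := dtri z t y.
    by rewrite (dsym t y); lra.
  rewrite -natr1 mulrDl mul1r EFinD [leLHS]addeC; apply: leeD => //.
  apply: (@le_trans _ _ (vol y (eps / 2))%:E); last by rewrite -volE//; lra.
  rewrite lee_fin /c ler_pdivrMr// mulrC exprS.
  have e20 : 0 < eps / 2 by lra.
  rewrite -exprS; apply: vol_compare => //; first lra.
  by move: yx; rewrite /dball /= dsym exprS; lra.
have [m hm] : exists m, vol x0 (rho + eps) < m%:R * c.
  exists (Num.bound (vol x0 (rho + eps) / c)).
  rewrite -ltr_pdivrMr//; apply: archi_boundP.
  by rewrite divr_ge0// ?ltW// vol_gt0//; lra.
have [s [sx hs]] := grow m.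
have : (mu (U s) <= mu (dball x0 (rho + eps)))%E.
  apply: le_measure; rewrite ?inE//.
  move=> y [z /sx zx]; rewrite /dball /= => zy; have := dtri x0 z y.
  by move: zx; rewrite /dball /=; lra.
rewrite volE; last lra.
move/(le_trans hs); rewrite lee_fin; lra.
Qed.

(** The union of the nets of the balls around [point] of integer radius, at the
    scales [n.+1^-1], is countable. *)
Lemma separable : exists c : nat -> T, forall x r, 0 < r ->
  exists n, dist (c n) x < r.
Proof.
have net (kn : nat * nat) : exists s : seq T, forall y, dball point kn.1.+1%:R y ->
    exists2 z, z \in s & dist z y < kn.2.+1%:R^-1.
  by apply: dball_net => //; rewrite invr_gt0.
have [s hs] := choice net.
pose c (n : nat) := if @unpickle (nat * nat * nat)%type n is Some (kn, i)
  then nth point (s kn) i else point.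
exists c => x r r0.
pose k := Num.bound (dist point x).
have xk : dball point k.+1%:R x.
  rewrite /dball /=; apply: (lt_trans (archi_boundP (dist_ge0 _ _))).
  by rewrite ltr_nat.
have [n nr] := ltr_add_invr r0; rewrite add0r in nr.
have [z zs zx] := hs (k, n) x xk.
exists (pickle ((k, n), index z (s (k, n)))).
rewrite /c pickleK nth_index//; exact: lt_trans zx nr.
Qed.

(** A ball is kept as a pair of a centre and a radius, which the underlying set
    does not determine. *)
Definition pball (b : T * R) := dball b.1 b.2.
Definition pball3 (b : T * R) := dball b.1 (3 * b.2).
Definition union_pballs (F : set (T * R)) := \bigcup_(b in F) pball b.

(** Lindelof property: every point of the union lies in a ball with centre in a
    countable dense set and radius [j.+1^-1] that is contained in a member of
    the family; one member is chosen for each of these countably many balls. *)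
Lemma lindelof_balls (F : set (T * R)) :
  exists (b : nat -> T * R) (D : set nat), (forall n, D n -> F (b n)) /\
    union_pballs F = \bigcup_(n in D) pball (b n).
Proof.
have [c hc] := separable.
pose small (n : nat) : set T := if @unpickle (nat * nat)%type n is Some (i, j)
  then dball (c i) j.+1%:R^-1 else set0.
pose D : set nat := [set n | exists2 f, F f & small n `<=` pball f].
have hD n : exists f, D n -> F f /\ small n `<=` pball f.
  have [[f Ff hf]|nD] := pselect (D n); first by exists f.
  by exists (point, 0).
have [b hb] := choice hD.
exists b, D; split; first by move=> n /hb[].
apply/seteqP; split => y.
  move=> [f Ff fy]; have e0 : 0 < f.2 - dist f.1 y.
    by move: fy; rewrite /pball /dball /=; lra.
  have e20 : 0 < (f.2 - dist f.1 y) / 2 by rewrite divr_gt0.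
  have [j] := ltr_add_invr e20.
  rewrite add0r => hj.
  have j0 : 0 < j.+1%:R^-1 :> R by rewrite invr_gt0.
  have [i hi] := hc y _ j0.
  exists (pickle (i, j)); last first.
    have [|_ h] := hb (pickle (i, j)); last by apply: h; rewrite /small pickleK.
    exists f => //; rewrite /small pickleK; apply: dball_sub.
    by have := dtri f.1 y (c i); rewrite (dsym y); move: hj hi; set q := (_^-1); lra.
  exists f => //; rewrite /small pickleK; apply: dball_sub.
  by have := dtri f.1 y (c i); rewrite (dsym y); move: hj hi; set q := (_^-1); lra.
by move=> [n /hb[Fb _] nb]; exists (b n).
Qed.

Lemma measurable_balls_union F : measurable (union_pballs F).
Proof.
have [b [D [_ ->]]] := lindelof_balls F.
by apply: bigcup_measurable => n _; exact: mB.
Qed.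

End Doubling.

(** * A covering lemma *)

Section Covering.
Context d (T : measurableType d) (R : realType) (mu : {measure set T -> \bar R}).
Context (dist : T -> T -> R) (C : R).
Hypothesis X : doubling_space mu dist C.
Local Open Scope ring_scope.
Local Notation ball_of := (pball dist).
Local Notation ball3_of := (pball3 dist).
Local Notation balls_union := (union_pballs dist).

Let mB := measurable_dball X.

Lemma largest_ball (b : T * R) (s : seq (T * R)) :
  exists2 c, c \in b :: s & forall b', b' \in b :: s -> b'.2 <= c.2.
Proof.
elim: s b => [|a s ih] b; first by exists b; rewrite ?mem_head// => b'; rewrite inE => /eqP ->.
have [c cs hc] := ih a; have [bc|cb] := leP b.2 c.2.
  exists c; first by rewrite inE cs orbT.
  by move=> b'; rewrite inE => /predU1P[->//|]; exact: hc.
exists b; first exact: mem_head.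
move=> b'; rewrite inE => /predU1P[->//|/hc]; lra.
Qed.

Lemma ball3_of_meet (a b : T * R) : a.2 <= b.2 ->
  ball_of a `&` ball_of b !=set0 -> ball_of a `<=` ball3_of b.
Proof.
move=> ab [z]; rewrite /pball /pball3 /dball /= => -[az bz] y ay.
have := dist_tri X b.1 z y; have := dist_tri X z a.1 y.
by move: ay; rewrite (dist_symm X z a.1) /=; lra.
Qed.

(** Greedy selection: the balls meeting a largest ball [c] lie in its triple,
    and the others are disjoint from [c]. *)
Lemma finite_covering (g h : T -> \bar R) (s : seq (T * R)) :
  nnmfun g -> nnmfun h ->
  (forall b, b \in s -> 0 < b.2) ->
  (forall b, b \in s ->
    (\int[mu]_(x in ball3_of b) g x <= \int[mu]_(x in ball_of b) h x)%E) ->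
  (\int[mu]_(x in balls_union [set` s]) g x <=
   \int[mu]_(x in balls_union [set` s]) h x)%E.
Proof.
move=> ng nh; have [n] := ubnP (size s); elim: n s => // n ih [|b s] sn s0 gh.
  by rewrite (_ : balls_union _ = set0) ?integral_set0//; apply/seteqP; split => y [].
have [c cs hc] := largest_ball b s.
pose p a := `[< ball_of a `&` ball_of c !=set0 >].
pose s2 := [seq a <- b :: s | ~~ p a].
have mU := measurable_balls_union X.
have mc := mB c.1 c.2; have mc3 := mB c.1 (3 * c.2).
have s2s : balls_union [set` s2] `<=` balls_union [set` b :: s].
  by apply: bigcup_subset => a /=; rewrite mem_filter => /andP[].
have cU : ball_of c `<=` balls_union [set` b :: s] by move=> y cy; exists c.
have dis : ball_of c `&` balls_union [set` s2] = set0.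
  apply/seteqP; split => // y [cy [a /=]]; rewrite mem_filter => /andP[+ _] ay.
  by move=> /asboolPn; apply; exists y.
have cov : balls_union [set` b :: s] `<=` ball3_of c `|` balls_union [set` s2].
  move=> y [a /= ain ay]; have [pa|pa] := boolP (p a).
    by left; apply: (ball3_of_meet (hc _ ain)) => //; exact/asboolP.
  by right; exists a => //=; rewrite mem_filter pa.
have mV := measurableU _ _ mc3 (mU [set` s2]).
apply: (le_trans (nnint_subset _ (mU _) mV ng cov)).
apply: (le_trans (nnint_setU_le _ mc3 (mU _) ng)).
apply: (@le_trans _ _ (\int[mu]_(x in ball_of c `|` balls_union [set` s2]) h x)%E).
  rewrite nnint_setU//; apply: leeD; first exact: gh.
  apply: ih => [|a|a]; last 2 first.
  - by rewrite mem_filter => /andP[_]; exact: s0.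
  - by rewrite mem_filter => /andP[_]; exact: gh.
  rewrite ltnS in sn; apply: leq_trans sn; rewrite size_filter.
  rewrite -[X in (_ < X)%N](count_predC (fun a => ~~ p a)).
  rewrite -[X in (X < _)%N]addn0 ltn_add2l -has_count; apply/hasP; exists c => //=.
  rewrite negbK; apply/asboolP; rewrite setIid; exists c.1.
  exact: (mem_dball X c.1 (s0 _ cs)).
apply: nnint_subset => //; first exact: measurableU.
by rewrite subUset.
Qed.

(** Vitali covering in integrated form: a comparison of [g] on tripled balls
    with [h] on the balls themselves passes to the union of the family. *)
Lemma covering (F : set (T * R)) (g h : T -> \bar R) (G H : set T) :
  nnmfun g -> nnmfun h -> measurable G -> measurable H ->
  (forall b, F b -> 0 < b.2) ->
  (forall b, F b ->
    (\int[mu]_(x in ball3_of b `&` G) g x <=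
     \int[mu]_(x in ball_of b `&` H) h x)%E) ->
  (\int[mu]_(x in balls_union F `&` G) g x <=
   \int[mu]_(x in balls_union F `&` H) h x)%E.
Proof.
move=> ng nh mG mH F0 gh; rewrite !integral_mkcondr.
have ngG := nnmfun_restrict mG ng; have nhH := nnmfun_restrict mH nh.
have [b [D [DF FE]]] := lindelof_balls X F.
pose S n := [seq b i | i <- iota 0 n & `[< D i >]].
have SE n : balls_union [set` S n] = \bigcup_(i in [set i | (i < n)%N /\ D i]) ball_of (b i).
  apply/seteqP; split => y.
    move=> [a /= /mapP[i]]; rewrite mem_filter mem_iota add0n => /andP[/asboolP Di /andP[_ ni]] -> ay.
    by exists i.
  move=> [i [ni Di] iy]; exists (b i) => //=; apply/mapP; exists i => //.
  rewrite mem_filter mem_iota add0n ni leq0n (introT (asboolP _) Di) //.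
have -> : balls_union F = \bigcup_n balls_union [set` S n].
  rewrite FE; apply/seteqP; split => y.
    by move=> [i Di iy]; exists i.+1 => //; rewrite SE; exists i.
  by move=> [n _]; rewrite SE => -[i [_ Di] iy]; exists i.
have mU := measurable_balls_union X.
apply: nnint_bigcup_le => //.
  move=> m n mn; apply/subsetPset; rewrite !SE => y [i [im Di] iy]; exists i => //=.
  by split => //; exact: leq_trans mn.
move=> n; apply: (@le_trans _ _ (\int[mu]_(x in balls_union [set` S n]) (h \_ H) x)%E).
  have SF a : a \in S n -> F a.
    by move=> /mapP[i]; rewrite mem_filter => /andP[/asboolP Di _] ->; exact: DF.
  apply: finite_covering => // a /SF Fa; first exact: F0.
  by rewrite -!integral_mkcondr; exact: gh.
apply: nnint_subset => //; first by apply: bigcupT_measurable => k; exact: mU.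
by move=> y yS; exists n.
Qed.

End Covering.

(** * Dyadic levels *)

Section Levels.
Context (R : realType).
Local Open Scope ring_scope.
Implicit Types (a p tau y : R).

Definition level tau k : R := 2 ^+ k * tau.

Lemma level_gt0 tau k : 0 < tau -> 0 < level tau k.
Proof. by move=> t0; rewrite mulr_gt0// exprn_gt0. Qed.

Lemma levelS tau k : level tau k.+1 = 2 * level tau k.
Proof. by rewrite /level exprS mulrA. Qed.

Lemma powR_le a (x y : R) : 0 <= a -> 0 <= x -> x <= y -> x `^ a <= y `^ a.
Proof. by move=> a0 x0 xy; apply: ge0_ler_powR; rewrite ?nnegrE//; exact: le_trans xy. Qed.

Lemma powR2_gt1 a : 0 < a -> 1 < 2 `^ a :> R.
Proof.
move=> a0; have := @gt0_ltr_powR R a a0 1 2; rewrite powR1 !nnegrE => -> //; lra.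
Qed.

Lemma level_powR tau k a : 0 < tau -> level tau k `^ a = tau `^ a * (2 `^ a) ^+ k.
Proof.
move=> t0; rewrite /level powRM ?exprn_ge0 ?(ltW t0)// mulrC; congr (_ * _).
by rewrite -powR_mulrn// powRAC powR_mulrn// powR_ge0.
Qed.

Lemma level_unbounded tau y : 0 < tau -> exists k, y <= level tau k.
Proof.
move=> t0; exists (Num.bound (Num.max y 0 / tau)).
rewrite /level -ler_pdivrMr//; apply: (@le_trans _ _ (Num.max y 0 / tau)).
  by rewrite ler_wpM2r ?invr_ge0 ?(ltW t0)// le_max lexx.
apply: le_trans (ltW (archi_boundP _)) _.
  by rewrite divr_ge0 ?(ltW t0)// le_max lexx orbT.
by rewrite -natrX ler_nat ltnW// ltn_expl.
Qed.

(** A geometric sum is dominated by its last term. *)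
Lemma sum_levels_below a tau n y : 0 < a -> 0 < tau -> 0 <= y ->
  \sum_(k < n) (if level tau k < y then level tau k `^ a else 0) <=
  (2 `^ a - 1)^-1 * (2 * y) `^ a.
Proof.
move=> a0 t0 y0; have K0 : 0 < 2 `^ a - 1 :> R by have := powR2_gt1 a0; lra.
have minge0 k : 0 <= Num.min (2 * y) (level tau k).
  by rewrite le_min (ltW (level_gt0 k t0)) andbT; lra.
apply: (@le_trans _ _ ((2 `^ a - 1)^-1 * Num.min (2 * y) (level tau n) `^ a)); last first.
  by rewrite ler_pM2l ?invr_gt0//; apply: powR_le; rewrite ?(ltW a0)// ge_min lexx.
elim: n => [|n ih].
  by rewrite big_ord0 mulr_ge0// ?powR_ge0// invr_ge0 ltW.
rewrite big_ord_recr /=; have ln0 := level_gt0 n t0.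
have [ny|yn] := ltP (level tau n) y; last first.
  rewrite addr0; apply: (le_trans ih); rewrite ler_pM2l ?invr_gt0//.
  apply: powR_le; rewrite ?(ltW a0)// le_min !ge_min lexx/= levelS.
  by apply/orP; right; lra.
have -> : Num.min (2 * y) (level tau n.+1) = 2 * level tau n.
  by rewrite levelS; apply/min_idPr; lra.
rewrite powRM ?(ltW ln0)//; apply: (@le_trans _ _ ((2 `^ a - 1)^-1 * level tau n `^ a + level tau n `^ a)).
  apply: lerD => //; apply: (le_trans ih); rewrite ler_pM2l ?invr_gt0//.
  by apply: powR_le; rewrite ?(ltW a0)// ge_min lexx orbT.
set L := level tau n `^ a; set q := 2 `^ a in K0 *.
suff -> : (q - 1)^-1 * (q * L) = (q - 1)^-1 * L + L by [].
by field; rewrite gt_eqF.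
Qed.

Lemma geometric_sum_le (q : R) n : 0 <= q -> q < 1 ->
  \sum_(k < n) q ^+ k <= (1 - q)^-1.
Proof.
move=> q0 q1; have h : 0 < 1 - q by lra.
rewrite -[leRHS]mulr1 ler_pdivlMl//.
suff -> : (1 - q) * \sum_(k < n) q ^+ k = 1 - q ^+ n.
  by have := exprn_ge0 n q0; lra.
elim: n => [|n ih]; first by rewrite big_ord0 mulr0 expr0 subrr.
by rewrite big_ord_recr /= mulrDr ih exprS; ring.
Qed.

End Levels.

Section Series.
Context (R : realType).

Lemma nneseries_le (u : nat -> \bar R) (c : \bar R) : (forall n, 0 <= u n) ->
  (forall n, \sum_(k < n) u k <= c) -> \sum_(k <oo) u k <= c.
Proof.
move=> u0 uc; apply: lime_le; first by apply: is_cvg_nneseries => n _ _; exact: u0.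
by apply: nearW => n; rewrite big_mkord.
Qed.

Lemma nneseries_ge_term (u : nat -> \bar R) k : (forall n, 0 <= u n) ->
  u k <= \sum_(k <oo) u k.
Proof.
move=> u0; apply: le_trans (nneseries_lim_ge k.+1 _) => //.
by rewrite big_mkord big_ord_recr /= leeDr// sume_ge0.
Qed.

(** The dyadic form of the layer cake formula: the term of the largest level
    below [y] alone dominates [y `^ p]. *)
Lemma dyadic_layers (p tau : R) (y : \bar R) : (0 < p)%R -> (0 < tau)%R ->
  tau%:E < y ->
  y `^ p <= \sum_(k <oo) (if (level tau k)%:E < y then (level tau k.+1 `^ p)%:E else 0).
Proof.
move=> p0 t0 ty; pose u k := if (level tau k)%:E < y then (level tau k.+1 `^ p)%:E else 0.
change (y `^ p <= \sum_(k <oo) u k).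
have u0 n : 0 <= u n by rewrite /u; case: ifP => // _; rewrite lee_fin powR_ge0.
have main (z : R) : (tau < z)%R -> z%:E <= y -> (z `^ p)%:E <= \sum_(k <oo) u k.
  move=> tz zy; have ex : exists k, (z <= level tau k)%R := level_unbounded z t0.
  pose k := ex_minn ex; have : (z <= level tau k)%R by rewrite /k; case: ex_minnP.
  have : forall j, (z <= level tau j)%R -> (k <= j)%N by rewrite /k; case: ex_minnP.
  move: k => -[|k] kmin zk; first by move: zk; rewrite /level expr0 mul1r leNgt tz.
  apply: le_trans (nneseries_ge_term k u0); rewrite /u.
  have kz : (level tau k < z)%R by rewrite ltNge; apply/negP => /kmin; rewrite ltnn.
  rewrite (lt_le_trans _ zy) ?lte_fin// lee_fin powR_le// ?(ltW p0)//; lra.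
move: {u}(u) u0 main => u u0; move: y ty => [y| |] // ty main.
  by rewrite poweR_EFin; apply: main => //; rewrite lee_fin.
rewrite poweRyr ?gt_eqF// leye_eq; apply/eqP/eqyP => A A0.
have [k hk] := level_unbounded (Num.max (A `^ p^-1) (2 * tau))%R t0.
have Ak : (A `^ p^-1 <= level tau k)%R by apply: le_trans hk; rewrite le_max lexx.
have tk : (2 * tau <= level tau k)%R by apply: le_trans hk; rewrite le_max lexx orbT.
have tlt : (tau < level tau k)%R by lra.
apply: le_trans (main (level tau k) tlt (leey _)).
rewrite lee_fin; apply: le_trans (powR_le (ltW p0) _ Ak); last exact: powR_ge0.
by rewrite -powRrM mulVf ?gt_eqF// powRr1// ltW.
Qed.

End Series.

(** * The maximal function and its weak type estimates *)

Section LayersIntegral.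
Context d (T : measurableType d) (R : realType) (mu : {measure set T -> \bar R}).

Lemma measurable_superlevel (h : T -> \bar R) (y : \bar R) :
  nnmfun h -> measurable [set x | y < h x].
Proof.
by move=> nh; rewrite -[X in measurable X]setTI; exact: emeasurable_fun_o_infty nh.1 _.
Qed.

Lemma integral_dyadic_layers (A : set T) (h : T -> \bar R) (u : T -> R)
    (p tau : R) : measurable A -> nnmfun h -> nnmfun (EFin \o u) -> (0 < p)%R -> (0 < tau)%R ->
  \int[mu]_(x in A `&` [set x | tau%:E < h x]) (h x `^ p * (u x)%:E) <=
  \sum_(k <oo) (level tau k.+1 `^ p)%:E *
     \int[mu]_(x in A `&` [set x | (level tau k)%:E < h x]) (u x)%:E.
Proof.
move=> mA nh nu p0 t0; pose S k := [set x | (level tau k)%:E < h x].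
have mS k : measurable (S k) by exact: measurable_superlevel.
have mS0 := measurable_superlevel tau%:E nh.
rewrite integral_mkcondr.
pose w k x := (level tau k.+1 `^ p)%:E * ((EFin \o u) \_ (S k)) x.
have nuS k : nnmfun ((EFin \o u) \_ (S k)) by exact: nnmfun_restrict.
have nw k : nnmfun (w k).
  by apply: (nnmfunM (nnmfun_cst T _) (nuS k)); rewrite lee_fin powR_ge0.
have w0 k x : 0 <= w k x by exact: (nw k).2.
apply: (@le_trans _ _ (\int[mu]_(x in A) \sum_(k <oo) w k x)).
  apply: ge0_le_integral => //.
  - by move=> x _; apply: erestrict_ge0 => y _; rewrite mule_ge0 ?poweR_ge0//; exact: nu.2.
  - apply: measurable_funTS; apply/(measurable_restrictT _ mS0).
    by apply: measurable_funTS; exact: (nnmfunM (nnmfun_pow p nh) nu).1.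
  - apply: measurable_funTS; apply: ge0_emeasurable_sum => [k x _ _|k _]; first exact: w0.
    exact: (nw k).1.
  move=> x _; rewrite {1}/patch; case: ifPn => [|_]; last first.
    by apply: nneseries_ge0 => k _ _; exact: w0.
  rewrite inE /= => tx; apply: (@le_trans _ _ ((\sum_(k <oo) (if (level tau k)%:E < h x
      then (level tau k.+1 `^ p)%:E else 0)) * (u x)%:E)).
    by apply: lee_wpmul2r; [exact: nu.2|exact: dyadic_layers].
  rewrite muleC -nneseriesZl; last by move=> k _; case: ifP => // _; rewrite lee_fin powR_ge0.
  apply: lee_nneseries => [k _ _|k _].
    by rewrite mule_ge0//; [exact: nu.2|]; case: ifP => // _; rewrite lee_fin powR_ge0.
  rewrite /w /patch; have -> : (x \in S k) = ((level tau k)%:E < h x).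
    by apply/idP/idP; rewrite inE.
  by case: ifP; rewrite ?mule0// muleC.
rewrite integral_nneseries//; last by move=> k; apply: measurable_funTS; exact: (nw k).1.
apply: lee_nneseries => [k _ _|k _]; first exact: nnint_ge0.
by rewrite nnintZl// ?lee_fin ?powR_ge0// -integral_mkcondr.
Qed.

End LayersIntegral.

Section MaximalFunction.
Context d (T : measurableType d) (R : realType) (mu : {measure set T -> \bar R}).
Context (dist : T -> T -> R) (C : R).
Hypothesis X : doubling_space mu dist C.
Local Notation ball_of := (pball dist).
Local Notation ball3_of := (pball3 dist).
Local Notation balls_union := (union_pballs dist).
Local Notation V b := (vol mu dist b.1 b.2).

Let mB := measurable_dball X.

Definition avg (A : set T) (f : T -> \bar R) (b : T * R) : \bar R :=
  (V b)^-1%:E * \int[mu]_(x in ball_of b `&` A) f x.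

(** Uncentred, so that the superlevel sets are unions of balls. *)
Definition maxfun (A : set T) (f : T -> \bar R) (x : T) : \bar R :=
  ereal_sup [set avg A f b | b in [set b | (0 < b.2)%R /\ ball_of b x]].

Variables (A : set T) (mA : measurable A).
Implicit Types (f g : T -> \bar R) (b : T * R).

Lemma mball b : measurable (ball_of b). Proof. exact: mB. Qed.

Lemma V_gt0 b : (0 < b.2)%R -> (0 < V b)%R. Proof. exact: (vol_gt0 X). Qed.

Lemma mu_ball b : (0 < b.2)%R -> mu (ball_of b) = (V b)%:E. Proof. exact: (volE X). Qed.

Lemma mu_ball3 b : (0 < b.2)%R -> mu (ball3_of b) <= (C ^+ 2 * V b)%:E.
Proof.
move=> b0; rewrite /pball3 (volE X); last by rewrite mulr_gt0.
by rewrite lee_fin; exact: vol_3.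
Qed.

Lemma avg_ge0 f b : nnmfun f -> 0 <= avg A f b.
Proof.
move=> nf; rewrite mule_ge0 ?nnint_ge0// lee_fin invr_ge0 fine_ge0//.
Qed.

Lemma lt_avg f b (t : R) : (0 < b.2)%R ->
  (t%:E < avg A f b) = ((t * V b)%:E < \int[mu]_(x in ball_of b `&` A) f x).
Proof. by move=> b0; rewrite lte_pdivlMl ?V_gt0// -EFinM mulrC. Qed.

Lemma avg_le f b (t : R) : (0 < b.2)%R ->
  (avg A f b <= t%:E) = (\int[mu]_(x in ball_of b `&` A) f x <= (t * V b)%:E).
Proof. by move=> b0; rewrite !leNgt lt_avg. Qed.

Lemma avg_maxfun f b x : (0 < b.2)%R -> ball_of b x -> avg A f b <= maxfun A f x.
Proof. by move=> b0 bx; apply: ereal_sup_ubound; exists b. Qed.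

Lemma maxfun_superlevel f (t : \bar R) :
  [set x | t < maxfun A f x] =
  balls_union [set b | (0 < b.2)%R /\ t < avg A f b].
Proof.
apply/seteqP; split => x /=.
  by move=> /ereal_sup_gt[_ [b [b0 bx] <-] tb]; exists b.
by move=> [b [b0 tb] bx]; apply: lt_le_trans tb _; exact: avg_maxfun.
Qed.

Lemma maxfun_ge0 f x : nnmfun f -> 0 <= maxfun A f x.
Proof.
move=> nf; apply: le_trans (avg_ge0 (x, 1%R) nf) _; apply: avg_maxfun => //=.
exact: (mem_dball X).
Qed.

Lemma nnmfun_maxfun f : nnmfun f -> nnmfun (maxfun A f).
Proof.
move=> nf; split; last by move=> x; exact: maxfun_ge0.
apply: (measurability _ (ErealGenOInfty.measurableE R)) => //= _ [_ [y ->] <-].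
rewrite setTI (_ : _ @^-1` _ = [set x | y%:E < maxfun A f x]).
  by rewrite maxfun_superlevel; exact: measurable_balls_union X _.
by apply/seteqP; split => x /=; rewrite in_itv /= andbT.
Qed.

Lemma avg_mono f g b : nnmfun f -> nnmfun g -> (forall x, A x -> f x <= g x) ->
  avg A f b <= avg A g b.
Proof.
move=> nf ng fg; apply: lee_wpmul2l; first by rewrite lee_fin invr_ge0 fine_ge0.
by apply: nnint_le => // [|x [_ Ax]]; [exact: measurableI (mball b) mA|exact: fg].
Qed.

Lemma maxfun_mono f g x : nnmfun f -> nnmfun g ->
  (forall x, A x -> f x <= g x) -> maxfun A f x <= maxfun A g x.
Proof.
move=> nf ng fg; apply: ge_ereal_sup => _ [b [b0 bx] <-].
by apply: le_trans (avg_maxfun g b0 bx); exact: avg_mono.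
Qed.

Lemma maxfun_sup (h : nat -> T -> \bar R) x : (forall n, nnmfun (h n)) ->
  (forall x, nondecreasing_seq (h^~ x)) ->
  maxfun A (fun x => ereal_sup (range (h^~ x))) x <=
  ereal_sup (range (fun n => maxfun A (h n) x)).
Proof.
move=> nh ndh; apply: ge_ereal_sup => _ [b [b0 bx] <-].
rewrite /avg nnint_sup; [|exact: measurableI (mball b) mA|by []|by []].
have Vb := V_gt0 b0; rewrite lee_pdivrMl//; apply: ge_ereal_sup => _ [n _ <-].
rewrite -lee_pdivrMl//; apply: le_trans (avg_maxfun (h n) b0 bx) _.
by apply: ereal_sup_ubound; exists n.
Qed.

(** Every weak type estimate below is the covering lemma for the balls on
    which the average of [f] exceeds [t]. *)
Lemma weak_type f g h (G H : set T) (t : R) :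
  nnmfun g -> nnmfun h -> measurable G -> measurable H ->
  (forall b, (0 < b.2)%R ->
     (t * V b)%:E < \int[mu]_(x in ball_of b `&` A) f x ->
     \int[mu]_(x in ball3_of b `&` G) g x <=
     \int[mu]_(x in ball_of b `&` H) h x) ->
  \int[mu]_(x in [set x | t%:E < maxfun A f x] `&` G) g x <=
  \int[mu]_(x in H) h x.
Proof.
move=> ng nh mG mH gh; rewrite maxfun_superlevel.
apply: (@le_trans _ _ (\int[mu]_(x in balls_union
    [set b | (0 < b.2)%R /\ t%:E < avg A f b] `&` H) h x)).
  apply: (covering X) => //; first by move=> b [].
  by move=> b [b0 tb]; apply: gh => //; rewrite -lt_avg.
apply: nnint_subset => //.
by apply: measurableI => //; exact: measurable_balls_union X _.
Qed.

Lemma weak_type11 f (t : R) : nnmfun f -> (0 < t)%R ->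
  t%:E * mu [set x | t%:E < maxfun A f x] <= (C ^+ 2)%:E * \int[mu]_(x in A) f x.
Proof.
move=> nf t0; have C2 : (0 <= C ^+ 2)%R by rewrite exprn_ge0// ltW// (C_gt0 X).
have nMf := nnmfun_maxfun nf.
rewrite -integral_cst; last exact: measurable_superlevel.
rewrite -[X in \int[mu]_(x in X) _]setIT -nnintZl// ?lee_fin//.
apply: weak_type => //.
- by apply: nnmfun_cst; rewrite lee_fin ltW.
- by apply: (nnmfunM (nnmfun_cst T _) nf); rewrite lee_fin.
move=> b b0 tb; rewrite setIT integral_cst; last exact: mB.
rewrite nnintZl ?lee_fin//; last exact: (measurableI _ _ (mball b) mA).
apply: (@le_trans _ _ ((C ^+ 2)%:E * (t * V b)%:E)); last first.
  by apply: lee_wpmul2l; rewrite ?lee_fin// ltW.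
apply: le_trans (lee_wpmul2l _ (mu_ball3 b0)) _; first by rewrite lee_fin ltW.
by rewrite -!EFinM lee_fin mulrCA.
Qed.

End MaximalFunction.

(** * Powers of maximal functions *)

Section AlmostEverywhere.
Context d (T : measurableType d) (R : realType) (mu : {measure set T -> \bar R}).

Lemma ae_point (A : set T) (P : T -> Prop) : measurable A -> 0 < mu A ->
  {ae mu, forall x, A x -> P x} -> exists2 x, A x & P x.
Proof.
move=> mA A0 [N [mN N0 sN]]; apply: contrapT => no.
have AN : A `<=` N.
  by move=> x Ax; apply: sN => /= h; apply: no; exists x => //; exact: h.
have : mu A <= mu N by apply: le_measure; rewrite ?inE.
by rewrite N0 leNgt A0.
Qed.

Lemma nnint_gt0 (A : set T) (f : T -> \bar R) : measurable A -> nnmfun f ->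
  0 < mu A -> {ae mu, forall x, A x -> 0 < f x} -> 0 < \int[mu]_(x in A) f x.
Proof.
move=> mA nf A0 fpos; rewrite lt_neqAle nnint_ge0// andbT; apply/eqP => I0.
have f0 : ae_eq mu A f (cst 0).
  apply/(ae_eq_integral_abs _ mA); first exact: measurable_funTS nf.1.
  by rewrite [RHS]I0; apply: eq_integral => x _; rewrite gee0_abs//; exact: nf.2.
have [x _] : exists2 x, A x & False; last by [].
apply: ae_point => //; move: f0 fpos; apply: filterS2 => x f0 fpos Ax.
by move: (fpos Ax); rewrite f0// ltxx.
Qed.

End AlmostEverywhere.

Section CoifmanRochberg.
Context d (T : measurableType d) (R : realType) (mu : {measure set T -> \bar R}).
Context (dist : T -> T -> R) (C : R).
Hypothesis X : doubling_space mu dist C.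
Local Notation ball_of := (pball dist).
Local Notation ball3_of := (pball3 dist).
Local Notation V b := (vol mu dist b.1 b.2).
Local Notation M := (maxfun mu dist).
Implicit Types (f g : T -> \bar R) (b : T * R).

Lemma maxfun_split (A B : set T) f x : measurable A -> measurable B -> nnmfun f ->
  M A f x <= M (A `&` B) f x + M (A `\` B) f x.
Proof.
move=> mA mB nf; apply: ge_ereal_sup => _ [b [b0 bx] <-].
apply: (@le_trans _ _ (avg mu dist (A `&` B) f b + avg mu dist (A `\` B) f b)).
  have mb := mball X b; have Vb := V_gt0 X b0.
  rewrite /avg -ge0_muleDr; [|exact: nnint_ge0|exact: nnint_ge0].
  apply: lee_wpmul2l; first by rewrite lee_fin invr_ge0 ltW.
  rewrite -nnint_setU//; [|exact: measurableI mb (measurableI _ _ mA mB)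
    |exact: measurableI mb (measurableD mA mB)|].
    rewrite (_ : _ `|` _ = ball_of b `&` A)//.
    by rewrite -setIUr setUIDK.
  by apply/seteqP; split => // y [[_ [_ By]] [_ [_]]].
by apply: leeD; exact: avg_maxfun.
Qed.

(** A ball that contains a point of [b] and leaves the triple of [b] is larger
    than [b], so its triple contains [b]. *)
Lemma maxfun_far (A : set T) f b y z : measurable A -> nnmfun f ->
  ball_of b y -> ball_of b z ->
  M (A `\` ball3_of b) f z <= (C ^+ 2)%:E * M A f y.
Proof.
move=> mA nf yb zb; apply: ge_ereal_sup => _ [a [a0 az] <-].
have ma := mball X a; have Va := V_gt0 X a0.
have C2 : (0 < C ^+ 2)%R by rewrite exprn_gt0// (C_gt0 X).
have mA' : measurable (A `\` ball3_of b) by apply: measurableD => //; exact: (mball X (b.1, 3 * b.2)%R).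
have [[q [qa [_ qb]]]|no] := pselect (ball_of a `&` (A `\` ball3_of b) !=set0); last first.
  rewrite /avg (_ : _ `&` _ = set0); last by apply/seteqP; split => // q ?; apply: no; exists q.
  by rewrite integral_set0 mule0 mule_ge0 ?lee_fin ?(ltW C2)//; exact: (maxfun_ge0 X).
pose a3 := (a.1, 3 * a.2)%R.
have a30 : (0 < a3.2)%R by rewrite mulr_gt0.
have Va3 := V_gt0 X a30.
have a3y : ball_of a3 y.
  move: qb qa az yb zb; rewrite /pball /pball3 /dball /= => /negP.
  rewrite -leNgt => qb qa az yb zb.
  have := dist_tri X b.1 z q; have := dist_tri X z a.1 q.
  have := dist_tri X a.1 z y; have := dist_tri X z b.1 y.
  rewrite (dist_symm X z a.1) (dist_symm X z b.1); lra.
apply: (@le_trans _ _ ((C ^+ 2)%:E * avg mu dist A f a3)); last first.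
  by apply: lee_wpmul2l; [rewrite lee_fin ltW|exact: avg_maxfun].
rewrite /avg lee_pdivrMl// muleA -EFinM muleA -EFinM.
apply: (@le_trans _ _ (\int[mu]_(x in ball_of a3 `&` A) f x)).
  apply: nnint_subset => //; [exact: measurableI|exact: measurableI (mball X a3) mA|].
  move=> x [ax [Ax _]]; split => //.
  by apply: dball_subr ax; rewrite /=; lra.
apply: lee_pemull; first exact: nnint_ge0.
rewrite lee_fin; rewrite -(@ler_pM2r _ (V a3))// mul1r -!mulrA mulVf ?gt_eqF// mulr1 mulrC.
exact: (vol_3 X).
Qed.

(** Coifman-Rochberg.  The part of [f] outside the triple of [b] has a maximal
    function at most [C ^+ 2 * tau] on [b].  The part inside has integral at
    most [C ^+ 2 * V b * tau], so by the weak type estimate its maximal function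
    exceeds [2 ^+ k * tau] on a fraction of order [2 ^- k] of [b] only, which is
    summable against [2 `^ (k * delta)] since [delta < 1]. *)
Lemma coifman_rochberg (delta : R) : (0 < delta < 1)%R ->
  exists2 K : R, (0 < K)%R & forall (A : set T) f b y (tau : R),
    measurable A -> nnmfun f -> (0 < b.2)%R -> ball_of b y -> (0 < tau)%R ->
    M A f y <= tau%:E ->
    \int[mu]_(x in ball_of b) M A f x `^ delta <= (K * V b * tau `^ delta)%:E.
Proof.
move=> /andP[d0 d1].
pose q : R := (2 `^ delta / 2)%R.
have q0 : (0 <= q)%R by rewrite divr_ge0 ?powR_ge0.
have q1 : (q < 1)%R.
  rewrite ltr_pdivrMr// mul1r -[X in (_ < X)%R]powRr1//.
  by rewrite /powR (_ : 2 == 0 :> R = false)%R ?ltr_expR ?ltr_pM2r ?ln_gt0 ?ltr1n//; apply/negbTE; rewrite pnatr_eq0.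
have C1 := doubling_ge1 X; have C0 := C_gt0 X.
have C2 : (1 <= C ^+ 2)%R by rewrite expr_ge1// ltW.
pose c := ((2 * C ^+ 2) `^ delta)%R.
have c0 : (0 < c)%R by rewrite powR_gt0// mulr_gt0//; lra.
have q1' : (0 < 1 - q)%R by lra.
exists (c * (1 + 2 `^ delta * C ^+ 4 / (1 - q)))%R.
  have : (0 <= 2 `^ delta * C ^+ 4 / (1 - q))%R.
    by apply: divr_ge0; [rewrite mulr_ge0 ?powR_ge0// exprn_ge0// ltW|exact: ltW].
  by move=> h; apply: mulr_gt0 => //; lra.
move=> A f b y tau mA nf b0 yb t0 My.
have mb := mball X b; have Vb := V_gt0 X b0.
have nM := nnmfun_maxfun X A nf.
(* at the levels of [tau'] the part far from [b] accounts for at most half *)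
pose tau' := (2 * C ^+ 2 * tau)%R.
have t'0 : (0 < tau')%R by rewrite mulr_gt0// mulr_gt0//; lra.
have mb3 := mball X (b.1, 3 * b.2)%R.
have mA3 : measurable (A `&` ball3_of b) by exact: measurableI.
have near k : mu (ball_of b `&` [set x | (level tau' k)%:E < M A f x]) <=
    (C ^+ 4 * V b / 2 ^+ k)%:E.
  pose t := level tau k; have tk0 : (0 < t)%R by exact: level_gt0.
  have tau_t : (tau <= t)%R by rewrite /t /level ler_peMl ?(ltW t0)// exprn_ege1// ler1n.
  apply: (@le_trans _ _ (mu [set x | t%:E < M (A `&` ball3_of b) f x])).
    apply: le_measure; rewrite ?inE.
    - by apply: measurableI => //; exact: measurable_superlevel.
    - by apply: measurable_superlevel; exact: (nnmfun_maxfun X _ nf).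
    move=> x [bx /= tx]; rewrite ltNge; apply/negP => h; move: tx; apply/negP.
    rewrite -leNgt; apply: le_trans (maxfun_split x mA mb3 nf) _.
    apply: (@le_trans _ _ (t%:E + (C ^+ 2)%:E * tau%:E)).
      apply: leeD => //; apply: le_trans (maxfun_far mA nf yb bx) _.
      by apply: lee_wpmul2l => //; rewrite lee_fin; lra.
    rewrite -EFinM -EFinD lee_fin (_ : level tau' k = 2 * C ^+ 2 * t)%R; last first.
      by rewrite /level /tau' /t /level; ring.
    have : (C ^+ 2 * tau <= C ^+ 2 * t)%R by rewrite ler_wpM2l//; lra.
    have : (t <= C ^+ 2 * t)%R by rewrite ler_peMl// ltW.
    lra.
  have := weak_type11 X mA3 nf tk0; rewrite -lee_pdivlMl// => /le_trans; apply.
  rewrite muleA -EFinM.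
  apply: (@le_trans _ _ ((t^-1 * C ^+ 2)%:E * (tau * (C ^+ 2 * V b))%:E)).
    apply: lee_wpmul2l; first by rewrite lee_fin mulr_ge0 ?invr_ge0 ?ltW//; lra.
    pose b3 := (b.1, 3 * b.2)%R; have b30 : (0 < b3.2)%R by rewrite mulr_gt0.
    rewrite setIC; apply: (@le_trans _ _ (tau * V b3)%:E).
      have : avg mu dist A f b3 <= tau%:E.
        apply: le_trans My; apply: avg_maxfun => //.
        by apply: dball_subr yb; rewrite /=; lra.
      by rewrite (avg_le X).
    by rewrite lee_fin ler_wpM2l ?(ltW t0)//; exact: (vol_3 X).
  rewrite -EFinM lee_fin /t /level le_eqVlt; apply/orP; left; apply/eqP.
  by field; rewrite ?gt_eqF// expf_neq0.
have split : \int[mu]_(x in ball_of b) M A f x `^ delta <=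
    (tau' `^ delta * V b)%:E +
    \int[mu]_(x in ball_of b `&` [set x | tau'%:E < M A f x]) (M A f x `^ delta * (cst 1%R x)%:E).
  have mS := measurable_superlevel tau'%:E nM.
  rewrite integral_mkcondr EFinM -(mu_ball X b0) -integral_cst// -nnintD//; last 2 first.
  - by apply: nnmfun_cst; rewrite lee_fin powR_ge0.
  - apply: nnmfun_restrict => //; apply: (nnmfunM (nnmfun_pow _ nM)).
    by apply: (nnmfun_EFin); [exact: measurable_cst|].
  apply: nnint_le => //.
  - exact: nnmfun_pow.
  - apply: nnmfunD; first by apply: nnmfun_cst; rewrite lee_fin powR_ge0.
    apply: nnmfun_restrict => //; apply: (nnmfunM (nnmfun_pow _ nM)).
    by apply: (nnmfun_EFin); [exact: measurable_cst|].
  move=> x bx; rewrite /patch; case: ifPn => [_|].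
    by rewrite mule1 leeDr// lee_fin powR_ge0.
  rewrite adde0 notin_setE /= => /negP; rewrite -leNgt -poweR_EFin => h.
  apply: gt0_ler_poweR; rewrite ?(ltW d0)// in_itv /= ?andbT ?leey ?lee_fin ?(ltW t'0)//.
  by rewrite (maxfun_ge0 X).
apply: (le_trans split).
have n1 : nnmfun (EFin \o (cst 1%R : T -> R)) by apply: nnmfun_EFin.
have layers := integral_dyadic_layers mu mb nM n1 d0 t'0.
apply: (@le_trans _ _ ((tau' `^ delta * V b)%:E +
   (tau' `^ delta * (2 `^ delta * C ^+ 4 * V b) / (1 - q))%:E)).
  have B0 : (0 <= tau' `^ delta * (2 `^ delta * C ^+ 4 * V b))%R.
    by rewrite !mulr_ge0 ?powR_ge0 ?exprn_ge0// ltW.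
  apply: leeD2l; apply: (le_trans layers); apply: nneseries_le => [k|n].
    apply: mule_ge0; first by rewrite lee_fin powR_ge0.
    by apply: integral_ge0 => x _; rewrite lee_fin.
  apply: (@le_trans _ _ (\sum_(k < n)
      (tau' `^ delta * (2 `^ delta * C ^+ 4 * V b) * q ^+ k)%:E)).
    apply: lee_sum => k _; have mk : measurable (ball_of b `&` [set x | (level tau' k)%:E < M A f x]).
      by apply: measurableI => //; exact: measurable_superlevel.
    rewrite (integral_cst mu mk 1%:E).
    rewrite mul1e; apply: le_trans (lee_wpmul2l _ (near k)) _.
      by rewrite lee_fin powR_ge0.
    rewrite -EFinM lee_fin le_eqVlt; apply/orP; left; apply/eqP.
    rewrite level_powR// /q exprS expr_div_n; field.
    by rewrite expf_neq0.
  by rewrite sumEFin -mulr_sumr lee_fin ler_wpM2l// geometric_sum_le.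
rewrite -EFinD lee_fin /tau' powRM ?(ltW t0)//; last by lra.
rewrite -/c le_eqVlt; apply/orP; left; apply/eqP; field.
by rewrite gt_eqF.
Qed.

End CoifmanRochberg.

(** * Extending [A_1] weights *)

Section A1Extension.
Context d (T : measurableType d) (R : realType) (mu : {measure set T -> \bar R}).
Context (dist : T -> T -> R) (C : R).
Hypothesis X : doubling_space mu dist C.
Local Notation ball_of := (pball dist).
Local Notation V b := (vol mu dist b.1 b.2).
Local Notation M := (maxfun mu dist).
Implicit Types (f g : T -> \bar R) (b : T * R).

(** [a] is the mean of [W] over [b]; the bound by [c * W] almost everywhere on
    [b] stands for the bound by the essential infimum. *)
Definition A1_weight (W : T -> R) (c : R) : Prop :=
  [/\ measurable_fun [set: T] W, forall x, (0 <= W x)%R &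
    forall b, (0 < b.2)%R -> exists a : R,
      [/\ (0 < a)%R, \int[mu]_(x in ball_of b) (W x)%:E = (a * V b)%:E &
          {ae mu, forall x, ball_of b x -> (a <= c * W x)%R}]].

Lemma bigcup_balls x0 : \bigcup_n ball_of (x0, n.+1%:R%R) = [set: T].
Proof.
apply/seteqP; split => // y _; exists (Num.bound (dist x0 y)) => //.
rewrite /pball /dball /=; apply: (lt_trans (archi_boundP (dist_ge0 X _ _))).
by rewrite ltr_nat.
Qed.

Lemma nondecreasing_balls x0 : nondecreasing_seq (fun n => ball_of (x0, n.+1%:R%R)).
Proof.
by move=> m n mn; apply/subsetPset; apply: dball_subr; rewrite ler_nat ltnS.
Qed.

Lemma ae_balls x0 (P : T -> Prop) :
  (forall n, {ae mu, forall x, ball_of (x0, n.+1%:R%R) x -> P x}) ->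
  {ae mu, forall x, P x}.
Proof.
move=> h; have : {ae mu, forall x, forall n, ball_of (x0, n.+1%:R%R) x -> P x}.
  exact: ae_foralln.
apply: filterS => x hx; have : [set: T] x by [].
by rewrite -(bigcup_balls x0) => -[n _ /hx].
Qed.

Lemma maxfun_gt0 (A : set T) f y : measurable A -> nnmfun f ->
  0 < \int[mu]_(x in A) f x -> 0 < M A f y.
Proof.
move=> mA nf I0; rewrite ltNge; apply/negP => M0; move: I0; apply/negP.
have mbA n : measurable (ball_of (y, n.+1%:R%R) `&` A).
  by apply: measurableI => //; exact: (mball X).
rewrite -leNgt -[A]setTI -(bigcup_balls y) setI_bigcupl.
apply: nnint_bigcup_le => //.
  move=> m n mn; apply/subsetPset; apply: setSI.
  by apply/subsetPset; exact: nondecreasing_balls.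
move=> n; have n0 : (0 < (y, n.+1%:R%R : R).2)%R by rewrite /= ltr0n.
have : avg mu dist A f (y, n.+1%:R%R) <= 0%R%:E.
  by apply: le_trans M0; apply: avg_maxfun => //; exact: (mem_dball X).
by rewrite (avg_le X)// mul0r.
Qed.

(** The extension is [g `^ delta] on [E] and [M E g `^ delta] off [E].  Off [E]
    its mean over a ball is controlled by [coifman_rochberg].  On [E] concavity
    gives [g `^ delta <= tau `^ delta + tau `^ (delta - 1) * g] with
    [tau = M E g y], and the mean of [g] over the part in [E] of a ball
    containing [y] is at most [tau]. *)
Lemma A1_extension (E : set T) g (K delta : R) :
  measurable E -> 0 < mu E -> nnmfun g -> (0 < delta < 1)%R -> (0 < K)%R ->
  {ae mu, forall x, E x -> 0 < g x < +oo} ->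
  {ae mu, forall x, E x -> M E g x <= K%:E * g x} ->
  exists (W : T -> R) (c : R), [/\ (0 < c)%R, A1_weight W c &
    forall x, E x -> W x = (fine (g x) `^ delta)%R].
Proof.
move=> mE E0 ng hdelta K0 gpos gA1.
have [Q Q0 cr] := coifman_rochberg X hdelta.
have /andP[d0 d1] := hdelta.
have nM : nnmfun (M E g) := nnmfun_maxfun X E ng.
have mE' : measurable (~` E) by exact: measurableC.
have Mpos y : 0 < M E g y.
  apply: maxfun_gt0 => //; apply: nnint_gt0 => //.
  by move: gpos; apply: filterS => x h /h /andP[].
have [x0 Ex0 [gx0 Mx0]] : exists2 x0, E x0 & 0 < g x0 < +oo /\ M E g x0 <= K%:E * g x0.
  apply: (ae_point mE E0); move: gpos gA1; apply: filterS2 => x h1 h2 Ex.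
  by split; [exact: h1|exact: h2].
have Mx0fin : M E g x0 < +oo.
  apply: le_lt_trans Mx0 _; move: gx0; case: (g x0) => [r _| |/andP[]]//; last by case/andP.
  by rewrite -EFinM ltry.
have integ b : (0 < b.2)%R -> \int[mu]_(x in ball_of b) M E g x `^ delta < +oo.
  move=> b0; pose b' := (b.1, b.2 + dist b.1 x0 + 1)%R.
  have dge := dist_ge0 X b.1 x0.
  have b'0 : (0 < b'.2)%R by rewrite /=; lra.
  apply: (@le_lt_trans _ _ (\int[mu]_(x in ball_of b') M E g x `^ delta)).
    apply: nnint_subset; [exact: (mball X)|exact: (mball X)|exact: nnmfun_pow|].
    by apply: dball_subr => /=; lra.
  have t0 : (0 < fine (M E g x0))%R by rewrite fine_gt0// Mpos Mx0fin.
  have b'x0 : ball_of b' x0 by rewrite /pball /dball /=; lra.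
  have Mt : M E g x0 <= (fine (M E g x0))%:E by rewrite fineK// ge0_fin_numE// ltW.
  by apply: le_lt_trans (cr E g b' x0 _ mE ng b'0 b'x0 t0 Mt) _; rewrite ltry.
have Mfin : {ae mu, forall x, M E g x < +oo}.
  apply: (@ae_balls x0) => n; set b := (_, _).
  have b0 : (0 < b.2)%R by rewrite /= ltr0n.
  have nMp : nnmfun (fun x => M E g x `^ delta) by exact: nnmfun_pow.
  have : mu.-integrable (ball_of b) (fun x => M E g x `^ delta).
    apply/integrableP; split; first exact: measurable_funTS nMp.1.
    under eq_integral do rewrite gee0_abs ?poweR_ge0//.
    exact: integ.
  move/(integrable_ae (mball X b)); apply: filterS => x hx /hx.
  by rewrite ge0_fin_numE ?poweR_ge0// => /lty_poweRy; apply; rewrite gt_eqF.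
pose G x := (g \_ E) x + (M E g \_ (~` E)) x.
have nG : nnmfun G by apply: nnmfunD; exact: nnmfun_restrict.
have GE x : E x -> G x = g x.
  by move=> Ex; rewrite /G /patch mem_set// memNset ?adde0//; exact.
have GN x : ~ E x -> G x = M E g x.
  by move=> Ex; rewrite /G /patch memNset// mem_set// add0e.
pose W x := (fine (G x) `^ delta)%R.
have W0 x : (0 <= W x)%R by exact: powR_ge0.
have mW : measurable_fun [set: T] W.
  rewrite (_ : W = fine \o (fun x => G x `^ delta)); last first.
    by apply/funext => x /=; rewrite fine_poweR.
  apply: (@measurableT_comp _ _ _ _ _ _ fine) => //; exact: (nnmfun_pow _ nG).1.
have nW := nnmfun_EFin mW W0.
have Gpos : {ae mu, forall x, 0 < G x < +oo}.
  move: gpos Mfin; apply: filterS2 => x h1 h2.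
  by have [Ex|Ex] := pselect (E x); [rewrite GE//; exact: h1|rewrite GN// Mpos].
have GM : {ae mu, forall x, M E g x <= (Num.max K 1)%:E * G x}.
  move: gA1; apply: filterS => x h; have [Ex|Ex] := pselect (E x).
    rewrite GE//; apply: le_trans (h Ex) _; apply: lee_wpmul2r; first exact: ng.2.
    by rewrite lee_fin le_max lexx.
  rewrite GN//; apply: lee_pemull; first exact: ltW.
  by rewrite lee_fin le_max lexx orbT.
have K1 : (0 < Num.max K 1)%R by rewrite lt_max K0.
pose c := ((Q + 2) * Num.max K 1 `^ delta)%R.
exists W, c; split.
- by rewrite mulr_gt0 ?powR_gt0//; lra.
- split => // b b0.
  have Vb := V_gt0 X b0; have mb := mball X b.
  have mubE := mu_ball X b0.
  have bound y : ball_of b y -> M E g y < +oo ->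
      \int[mu]_(x in ball_of b) (W x)%:E <=
      ((Q + 2) * V b * fine (M E g y) `^ delta)%:E.
    move=> yb My; set tau := fine (M E g y).
    have Mtau : M E g y = tau%:E by rewrite fineK// ge0_fin_numE// ltW.
    have t0 : (0 < tau)%R by rewrite fine_gt0// Mpos.
    have I1 := cr E g b y tau mE ng b0 yb t0 (eq_ind_r (fun z => z <= _) (lexx _) Mtau).
    have I2 : \int[mu]_(x in ball_of b `&` E) g x <= (tau * V b)%:E.
      by rewrite -(avg_le X)// -Mtau; exact: avg_maxfun.
    have nMp : nnmfun (fun x => M E g x `^ delta) by exact: nnmfun_pow.
    have ngE : nnmfun (g \_ E) by exact: nnmfun_restrict.
    have l0 : (0 <= tau `^ (delta - 1))%R by exact: powR_ge0.
    have nl : nnmfun (fun x => (tau `^ (delta - 1))%:E * (g \_ E) x).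
      by apply: (nnmfunM (nnmfun_cst T _) ngE); rewrite lee_fin.
    have nt : nnmfun (cst (tau `^ delta)%:E : T -> \bar R).
      by apply: nnmfun_cst; rewrite lee_fin powR_ge0.
    apply: (@le_trans _ _ (\int[mu]_(x in ball_of b)
       (M E g x `^ delta + ((tau `^ (delta - 1))%:E * (g \_ E) x + cst (tau `^ delta)%:E x)))).
      apply: nnint_le => //; first by do 2?apply: nnmfunD => //.
      move=> x bx; rewrite /W; have [Ex|Ex] := pselect (E x); last first.
        rewrite GN//; apply: (@le_trans _ _ (M E g x `^ delta)); last first.
          by rewrite leeDl// adde_ge0 ?nl.2 ?nt.2.
        rewrite -fine_poweR; case: (M E g x `^ delta) (poweR_ge0 (M E g x) delta) => //=.
      rewrite GE//; apply: (@le_trans _ _ ((tau `^ (delta - 1))%:E * (g \_ E) x + cst (tau `^ delta)%:E x)); last first.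
        by rewrite leeDr// poweR_ge0.
      rewrite /patch mem_set//=; case: (g x) (ng.2 x) => [r r0| |]//=; last first.
        rewrite powR0 ?gt_eqF// => _; rewrite adde_ge0 ?lee_fin ?powR_ge0//.
        by rewrite mule_ge0// lee_fin.
      rewrite lee_fin in r0; rewrite -EFinM -EFinD lee_fin.
      have [rt|tr] := leP r tau.
        by apply: ler_wpDl; [rewrite mulr_ge0|apply: powR_le => //; exact: ltW].
      apply: ler_wpDr; first exact: powR_ge0.
      have rp : (0 < r)%R by apply: lt_trans tr.
      rewrite -(@mulr_powRB1 _ r delta)// mulrC ler_wpM2r//.
      rewrite -opprB !powRN lef_pV2 ?posrE ?powR_gt0//.
      by apply: powR_le; rewrite ?(ltW t0) ?(ltW tr)//; lra.
    rewrite nnintD//; last by apply: nnmfunD.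
    rewrite nnintD// nnintZl// integral_cst// -integral_mkcondr.
    have : (tau `^ (delta - 1))%:E * \int[mu]_(x in ball_of b `&` E) g x <= (tau `^ delta * V b)%:E.
      apply: le_trans (lee_wpmul2l _ I2) _; first by rewrite lee_fin.
      rewrite -EFinM lee_fin mulrA [X in (X * _)%R]mulrC mulr_powRB1// ltW//.
    move=> I3; rewrite mubE -EFinM.
    apply: le_trans (leeD I1 (leeD2r _ I3)) _.
    by rewrite -!EFinD lee_fin le_eqVlt; apply/orP; left; apply/eqP; ring.
  have Wpos : 0 < \int[mu]_(x in ball_of b) (W x)%:E.
    apply: (nnint_gt0 mb nW); first by rewrite mubE lte_fin.
    move: Gpos; apply: filterS => x /andP[G0 Goo] _; rewrite lte_fin powR_gt0//.
    by rewrite fine_gt0// G0.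
  have [y yb My] : exists2 y, ball_of b y & M E g y < +oo.
    have mub0 : 0 < mu (ball_of b) by rewrite mubE lte_fin.
    apply: (ae_point mb mub0).
    by move: Mfin; apply: filterS.
  have Wfin : \int[mu]_(x in ball_of b) (W x)%:E = (fine (\int[mu]_(x in ball_of b) (W x)%:E))%:E.
    rewrite fineK// ge0_fin_numE ?(ltW Wpos)//.
    by apply: le_lt_trans (bound y yb My) _; rewrite ltry.
  pose I := fine (\int[mu]_(x in ball_of b) (W x)%:E).
  exists (I / V b)%R; split.
  + by rewrite divr_gt0// -lte_fin -Wfin.
  + by rewrite Wfin divfK// gt_eqF.
  move: Mfin Gpos GM; apply: filterS3 => x Mx /andP[G0 Goo] GMx bx.
  rewrite ler_pdivrMr//; have := bound x bx Mx; rewrite Wfin lee_fin => /le_trans; apply.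
  rewrite mulrAC ler_pM2r// /c -mulrA ler_pM2l; last by lra.
  have G0' : (0 < fine (G x))%R by rewrite fine_gt0// G0.
  rewrite /W -powRM ?(ltW K1) ?(ltW G0')//; apply: powR_le.
  - exact: ltW.
  - by apply: fine_ge0; exact: nM.2.
  rewrite -lee_fin EFinM !fineK//; first by rewrite ge0_fin_numE// ltW.
  by rewrite ge0_fin_numE// nM.2.
- by move=> x Ex; rewrite /W GE.
Qed.

End A1Extension.

(** * Strong type estimates for restricted weights *)

Section StrongType.
Context d (T : measurableType d) (R : realType) (mu : {measure set T -> \bar R}).
Context (dist : T -> T -> R) (C : R).
Hypothesis X : doubling_space mu dist C.
Local Notation ball_of := (pball dist).
Local Notation ball3_of := (pball3 dist).
Local Notation V b := (vol mu dist b.1 b.2).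
Local Notation M := (maxfun mu dist).
Implicit Types (f g : T -> \bar R) (b : T * R).

(** [alpha] and [beta] bound the averages of a weight [u] and of its dual [v]
    for the exponent [p = r + 1].  They are real numbers with [beta] positive
    also when the ball misses [E], so that one can divide by [beta]. *)
Definition Ap_pair (E : set T) (u v : T -> R) (r Q : R) : Prop :=
  forall b, (0 < b.2)%R -> exists alpha beta : R,
    [/\ (0 <= alpha)%R, (0 < beta)%R,
        \int[mu]_(x in ball_of b `&` E) (u x)%:E <= (alpha * V b)%:E,
        \int[mu]_(x in ball_of b `&` E) (v x)%:E <= (beta * V b)%:E &
        (alpha * beta `^ r <= Q)%R].

(** Young's inequality without its sharp constants: one of the two terms alone
    dominates, according to how [y] compares with [(lam * u) `^ (- r^-1)]. *)
Lemma young_powR (y lam u r : R) : (0 <= y)%R -> (0 < lam)%R -> (0 < u)%R ->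
  (0 < r)%R ->
  (y <= lam * (y `^ (r + 1) * u) + lam `^ (- r^-1) * u `^ (- r^-1))%R.
Proof.
move=> y0 l0 u0 r0; rewrite -powRM ?(ltW l0) ?(ltW u0)//.
have lu : (0 < lam * u)%R by rewrite mulr_gt0.
have z0 : (0 < (lam * u) `^ (- r^-1))%R by rewrite powR_gt0.
have [yz|zy] := leP y ((lam * u) `^ (- r^-1))%R.
  apply: (le_trans yz); rewrite lerDr// mulr_ge0 ?(ltW l0)// mulr_ge0 ?powR_ge0// ltW//.
have yp : (0 < y)%R by apply: lt_trans zy.
apply: (@le_trans _ _ (lam * (y `^ (r + 1) * u))%R); last by rewrite lerDl ltW.
rewrite powRD; last by apply/implyP => _; rewrite gt_eqF.
rewrite powRr1 ?(ltW yp)// (_ : lam * _ = (lam * u * y `^ r) * y)%R; last by ring.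
rewrite ler_peMl ?(ltW yp)//.
have : ((lam * u) `^ (- r^-1) `^ r <= y `^ r)%R.
  by apply: powR_le; rewrite ?(ltW r0) ?(ltW z0) ?(ltW zy).
rewrite -powRrM mulNr mulVf ?gt_eqF// powR_inv1 ?(ltW lu)// => h.
by rewrite -(ler_pM2l lu) mulfV ?gt_eqF// in h.
Qed.

Variables (E : set T) (mE : measurable E).
Variables (u : T -> R) (mu_ : measurable_fun [set: T] u).
Hypothesis u0 : forall x, (0 < u x)%R.
Variables (r Q : R) (r0 : (0 < r)%R) (Q0 : (0 < Q)%R).
Hypothesis uAp : Ap_pair E u (fun x => u x `^ (- r^-1))%R r Q.

Let nu : nnmfun (EFin \o u).
Proof. by apply: nnmfun_EFin => // x; exact: ltW. Qed.

Let nv : nnmfun (EFin \o (fun x => u x `^ (- r^-1))%R).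
Proof.
apply: nnmfun_EFin => [|x]; last exact: powR_ge0.
by apply/measurable_EFinP; exact: (nnmfun_pow (- r^-1) nu).1.
Qed.

(** On a ball where the average of [f] exceeds [t], Young's inequality splits
    [f] into [lam * f `^ (r + 1) * u] and a multiple of the dual weight.  The
    parameter [lam] is tuned to the average of the dual weight over the tripled
    ball, so that the second term contributes at most [t / 2]; the first term
    then bounds [t], and the [A_p] condition on the tripled ball turns this into
    a bound for the integral of [u]. *)
Lemma weak_type_q : exists2 K : R, (0 < K)%R & forall f (t : R),
  nnmfun f -> (0 < t)%R ->
  \int[mu]_(x in E `&` [set x | t%:E < M E f x]) (u x)%:E <=
  (K / t `^ (r + 1))%:E * \int[mu]_(x in E) (f x `^ (r + 1) * (u x)%:E).
Proof.
have [c c0 cE] : exists2 c, (0 < c)%R & c = (C ^+ 2)%R.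
  by exists (C ^+ 2)%R => //; rewrite exprn_gt0// (C_gt0 X).
have K0 : (0 < 2 * Q * c * (2 * c) `^ r)%R.
  by apply: mulr_gt0; [rewrite !mulr_gt0|rewrite powR_gt0// mulr_gt0].
exists (2 * Q * c * (2 * c) `^ r)%R => // f t nf t0.
have Wt0 : (0 <= 2 * Q * c * (2 * c) `^ r / t `^ (r + 1))%R.
  by rewrite divr_ge0 ?powR_ge0// ltW.
have nfu : nnmfun (fun x => f x `^ (r + 1) * (u x)%:E).
  by apply: nnmfunM => //; exact: nnmfun_pow.
rewrite -nnintZl ?lee_fin//.
rewrite setIC; apply: (weak_type X) => //.
  by apply: (nnmfunM (nnmfun_cst T _) nfu); rewrite lee_fin.
move=> b b0 tb; pose b3 := (b.1, 3 * b.2)%R.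
have b30 : (0 < b3.2)%R by rewrite mulr_gt0.
have [al [be [al0 be0 ual vbe abQ]]] := uAp b30.
have Vb := V_gt0 X b0; have Vb3 := V_gt0 X b30.
have V3 : (V b3 <= c * V b)%R by rewrite cE; exact: (vol_3 X).
have mb := mball X b; have mbE : measurable (ball_of b `&` E) by exact: measurableI.
(* so that the dual term integrates to at most [t / 2 * V b] *)
pose lam := ((2 * be * c / t) `^ r)%R.
have bct : (0 < 2 * be * c / t)%R by rewrite divr_gt0// !mulr_gt0.
have lam0 : (0 < lam)%R by rewrite powR_gt0.
have lamV : (lam `^ (- r^-1) = t / (2 * be * c))%R.
  by rewrite /lam -powRrM mulrN mulfV ?gt_eqF// powR_inv1 ?(ltW bct)// invf_div.
pose F := \int[mu]_(x in ball_of b `&` E) (f x `^ (r + 1) * (u x)%:E).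
have F0 : 0 <= F by exact: nnint_ge0.
have nl : nnmfun (fun x => lam%:E * (f x `^ (r + 1) * (u x)%:E)).
  by apply: (nnmfunM (nnmfun_cst T _) nfu); rewrite lee_fin ltW.
have nlv : nnmfun (fun x => (lam `^ (- r^-1))%:E * (u x `^ (- r^-1))%:E).
  by apply: (nnmfunM (nnmfun_cst T _) nv); rewrite lee_fin powR_ge0.
have fle : \int[mu]_(x in ball_of b `&` E) f x <=
    lam%:E * F + (t / 2 * V b)%:E.
  apply: (@le_trans _ _ (\int[mu]_(x in ball_of b `&` E)
     (lam%:E * (f x `^ (r + 1) * (u x)%:E) + (lam `^ (- r^-1))%:E * (u x `^ (- r^-1))%:E))).
    apply: nnint_le => //; first exact: nnmfunD.
    move=> x _; case: (f x) (nf.2 x) => [y| |]//; last first.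
      rewrite poweRyr ?gt_eqF ?addr_gt0// mulyr gtr0_sg// mul1e.
      by rewrite mulry gtr0_sg// mul1e addye.
    rewrite lee_fin => y0; rewrite poweR_EFin -!EFinM -EFinD lee_fin.
    exact: young_powR.
  rewrite nnintD// nnintZl//; last by rewrite lee_fin ltW.
  rewrite nnintZl//; last by rewrite lee_fin powR_ge0.
  apply: leeD2l; apply: (@le_trans _ _ ((lam `^ (- r^-1))%:E * (be * V b3)%:E)).
    apply: lee_wpmul2l; first by rewrite lee_fin powR_ge0.
    apply: le_trans vbe; apply: nnint_subset => //.
      by apply: measurableI => //; exact: (mball X).
    by apply: setSI; apply: dball_subr; rewrite /=; lra.
  rewrite lamV -EFinM lee_fin.
  apply: (@le_trans _ _ (t / (2 * be * c) * (be * (c * V b)))%R).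
    by rewrite ler_wpM2l ?divr_ge0 ?ler_wpM2l ?(ltW be0)// ltW// !mulr_gt0.
  rewrite le_eqVlt; apply/orP; left; apply/eqP; field.
  by rewrite !gt_eqF.
have Fbig : (t / 2 * V b / lam)%:E <= F.
  rewrite mulrC EFinM lee_pdivrMl//.
  have [FE|Foo] := boolP (F == +oo); first by rewrite (eqP FE) mulry gtr0_sg// mul1e leey.
  have Ff : F = (fine F)%:E by rewrite fineK// ge0_fin_numE// ltey.
  move: (lt_le_trans tb fle); rewrite Ff -EFinM -EFinD lte_fin lee_fin; lra.
rewrite nnintZl ?lee_fin//.
apply: (@le_trans _ _ ((2 * Q * c * (2 * c) `^ r / t `^ (r + 1))%:E * (t / 2 * V b / lam)%:E)); last first.
  by apply: lee_wpmul2l => //; rewrite lee_fin.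
apply: (le_trans ual); rewrite -EFinM lee_fin.
have ber : (0 < be `^ r)%R by rewrite powR_gt0.
have alQ : (al <= Q / be `^ r)%R by rewrite ler_pdivlMr.
apply: (@le_trans _ _ (Q / be `^ r * (c * V b)))%R.
  by apply: ler_pM => //; rewrite ltW.
have tr : (t `^ (r + 1) = t `^ r * t)%R.
  rewrite powRD; last by apply/implyP => _; rewrite gt_eqF.
  by rewrite powRr1// ltW.
have lamE : (lam = (2 * c) `^ r * be `^ r / t `^ r)%R.
  rewrite /lam (_ : 2 * be * c / t = 2 * c * be * t^-1)%R; last by ring.
  rewrite powRM; [|by rewrite !mulr_ge0// ltW|by rewrite invr_ge0 ltW].
  rewrite powRM ?(ltW be0)//; last by rewrite mulr_ge0// ltW.
  by rewrite -[(t^-1)%R]powR_inv1 ?(ltW t0)// powRAC powR_inv1// powR_ge0.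
have t'0 : (0 < t `^ r)%R by rewrite powR_gt0.
have c'0 : (0 < (2 * c) `^ r)%R by rewrite powR_gt0// mulr_gt0.
rewrite lamE tr le_eqVlt; apply/orP; left; apply/eqP; field.
by rewrite !gt_eqF.
Qed.

Lemma maxfun_truncate f (s : R) x : nnmfun f -> (0 < s)%R ->
  M E f x <= M E (f \_ [set y | s%:E < f y]) x + s%:E.
Proof.
move=> nf s0; have mS := measurable_superlevel s%:E nf.
have nf1 := nnmfun_restrict mS nf.
apply: ge_ereal_sup => _ [b [b0 bx] <-].
apply: (@le_trans _ _ (avg mu dist E (f \_ [set y | s%:E < f y]) b + s%:E)); last first.
  by apply: leeD2r; exact: avg_maxfun.
have Vb := V_gt0 X b0; have mb := mball X b.
have mbE : measurable (ball_of b `&` E) by exact: measurableI.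
have ns : nnmfun (cst s%:E : T -> \bar R) by apply: nnmfun_cst; rewrite lee_fin ltW.
have A0 : 0 <= avg mu dist E (f \_ [set y | s%:E < f y]) b by exact: avg_ge0.
have s0' : 0 <= s%:E by rewrite lee_fin ltW.
rewrite {1}/avg lee_pdivrMl// ge0_muleDr//.
rewrite /avg muleA -EFinM mulfV ?gt_eqF// mul1e.
apply: (@le_trans _ _ (\int[mu]_(y in ball_of b `&` E)
    ((f \_ [set y | s%:E < f y]) y + cst s%:E y))).
  apply: nnint_le => //; first exact: nnmfunD.
  move=> y _; rewrite /patch; case: ifPn; first by rewrite leeDl// lee_fin ltW.
  by rewrite notin_setE /= add0e => /negP; rewrite -leNgt.
rewrite nnintD//; apply: leeD2l; rewrite integral_cst// muleC.
apply: lee_wpmul2r; first by rewrite lee_fin ltW.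
rewrite -(mu_ball X b0); apply: le_measure; rewrite ?inE//.
Qed.

(** Marcinkiewicz interpolation between the weak type estimate at [r + 1] and
    the trivial bound of [M] on bounded functions. *)
Lemma strong_type (p : R) : (r + 1 < p)%R ->
  exists2 K : R, (0 < K)%R & forall f, nnmfun f ->
  \int[mu]_(x in E) (M E f x `^ p * (u x)%:E) <=
  K%:E * \int[mu]_(x in E) (f x `^ p * (u x)%:E).
Proof.
move=> rp; have [Kw Kw0 weak] := weak_type_q.
pose q := (r + 1)%R; have q0 : (0 < q)%R by rewrite addr_gt0.
have p0 : (0 < p)%R by apply: lt_trans rp.
pose a := (p - q)%R; have a0 : (0 < a)%R by rewrite /a /q; lra.
have L0 : (0 < (2 `^ a - 1)^-1 :> R)%R by rewrite invr_gt0 subr_gt0; exact: powR2_gt1.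
pose B := (4 `^ p * Kw)%R; have B0 : (0 < B)%R by rewrite mulr_gt0// powR_gt0.
pose K := (B * ((2 `^ a - 1)^-1 * 2 `^ a))%R.
have K0 : (0 < K)%R by rewrite !mulr_gt0// powR_gt0.
exists K => // f nf; have nM := nnmfun_maxfun X E nf.
have nfp : nnmfun (fun x => f x `^ p * (u x)%:E) by apply: nnmfunM => //; exact: nnmfun_pow.
have nfq : nnmfun (fun x => f x `^ q * (u x)%:E) by apply: nnmfunM => //; exact: nnmfun_pow.
have nMp : nnmfun (fun x => M E f x `^ p * (u x)%:E) by apply: nnmfunM => //; exact: nnmfun_pow.
have main (tau : R) : (0 < tau)%R ->
    \int[mu]_(x in E `&` [set x | tau%:E < M E f x]) (M E f x `^ p * (u x)%:E) <=
    K%:E * \int[mu]_(x in E) (f x `^ p * (u x)%:E).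
  move=> t0; apply: le_trans (integral_dyadic_layers mu mE nM nu p0 t0) _.
  (* only the part of [f] above [s k] can lift [M E f] above [2 * s k] *)
  pose s k := level (tau / 2) k; have s0 k : (0 < s k)%R by apply: level_gt0; lra.
  have levE k : level tau k = (2 * s k)%R by rewrite /s /level; field.
  have levE2 k : level tau k.+1 = (4 * s k)%R by rewrite levelS levE; ring.
  pose S k := [set x | (s k)%:E < f x].
  have mS k : measurable (S k) by exact: measurable_superlevel.
  pose w k x := (B * s k `^ a)%:E * ((fun x => f x `^ q * (u x)%:E) \_ (S k)) x.
  have nwS k := nnmfun_restrict (mS k) nfq.
  have Bs k : (0 <= B * s k `^ a)%R by rewrite mulr_ge0 ?powR_ge0// ltW.
  have nw k : nnmfun (w k) by apply: (nnmfunM (nnmfun_cst T _) (nwS k)); rewrite lee_fin.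
  apply: (@le_trans _ _ (\sum_(k <oo) \int[mu]_(x in E) w k x)).
    apply: lee_nneseries => [k _ _|k _].
      by apply: mule_ge0; [rewrite lee_fin powR_ge0|exact: nnint_ge0].
    have mfS := nnmfun_restrict (mS k) nf.
    have mset : measurable [set x | (s k)%:E < M E (f \_ (S k)) x].
      by apply: measurable_superlevel; exact: (nnmfun_maxfun X E mfS).
    have mset' : measurable [set x | (level tau k)%:E < M E f x] by exact: measurable_superlevel.
    apply: (@le_trans _ _ ((level tau k.+1 `^ p)%:E *
       \int[mu]_(x in E `&` [set x | (s k)%:E < M E (f \_ (S k)) x]) (u x)%:E)).
      apply: lee_wpmul2l; first by rewrite lee_fin powR_ge0.
      apply: nnint_subset => //; [exact: measurableI|exact: measurableI|].
      apply: setIS => x /=; rewrite levE => h.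
      have := lt_le_trans h (@maxfun_truncate f (s k) x nf (s0 k)).
      by rewrite (_ : 2 * s k = s k + s k)%R ?EFinD ?lteD2rE//; ring.
    apply: le_trans (lee_wpmul2l _ (weak _ _ mfS (s0 k))) _; first by rewrite lee_fin powR_ge0.
    rewrite muleA -EFinM nnintZl ?lee_fin//.
    have -> : (level tau k.+1 `^ p * (Kw / s k `^ (r + 1)))%R = (B * s k `^ a)%R.
      rewrite levE2 powRM ?(ltW (s0 k))// /B /a powRB; last first.
        by apply/implyP => _; rewrite gt_eqF.
      by rewrite -/q; field; rewrite gt_eqF// powR_gt0.
    apply: lee_wpmul2l; first by rewrite lee_fin.
    apply: nnint_le => //.
      by apply: nnmfunM => //; exact: nnmfun_pow.
    move=> x _; rewrite /patch; case: ifPn => // _.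
    by rewrite poweR0r ?mul0e// gt_eqF.
  have mw k : measurable_fun E (w k) by apply: measurable_funTS; exact: (nw k).1.
  have w0 k x : E x -> 0 <= w k x by move=> _; exact: (nw k).2.
  rewrite -(integral_nneseries mu mE mw w0).
  rewrite -nnintZl// ?lee_fin ?(ltW K0)//.
  apply: ge0_le_integral => //.
  - by move=> x _; apply: nneseries_ge0 => k _ _; exact: (nw k).2.
  - apply: measurable_funTS; apply: ge0_emeasurable_sum => [k x _ _|k _]; first exact: (nw k).2.
    exact: (nw k).1.
  - apply: measurable_funTS; apply: (nnmfunM (nnmfun_cst T _) nfp).1.
    by rewrite lee_fin ltW.
  move=> x _; apply: nneseries_le => [k|n]; first exact: (nw k).2.
  case fx : (f x) (nf.2 x) => [y| |]// y0; last first.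
    by rewrite [+oo `^ p]poweRyr ?gt_eqF// mulyr gtr0_sg// mul1e mulry gtr0_sg// mul1e leey.
  rewrite lee_fin in y0; rewrite poweR_EFin -!EFinM.
  rewrite (eq_bigr (fun k : 'I_n => (B * (if (s k < y)%R then s k `^ a else 0) * (y `^ q * u x))%:E)); last first.
    move=> k _; rewrite /w /patch.
    have -> : (x \in S k) = (s k < y)%R.
      by apply/idP/idP; rewrite inE /S /= fx lte_fin.
    by case: ifP => _; rewrite ?mule0 ?mulr0 ?mul0r// fx poweR_EFin -!EFinM.
  rewrite sumEFin lee_fin -mulr_suml -mulr_sumr.
  have tau2 : (0 < tau / 2)%R by lra.
  have := sum_levels_below n a0 tau2 y0; rewrite -/s => hs.
  apply: (@le_trans _ _ (B * ((2 `^ a - 1)^-1 * (2 * y) `^ a) * (y `^ q * u x))%R).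
    apply: ler_wpM2r; first by rewrite mulr_ge0 ?powR_ge0// ltW.
    by rewrite ler_wpM2l ?(ltW B0).
  have [y00|yp] := eqVneq y 0%R.
    by rewrite y00 [(0 `^ q)%R]powR0 ?gt_eqF// mul0r mulr0 powR0 ?gt_eqF// mul0r mulr0.
  rewrite powRM// le_eqVlt; apply/orP; left; apply/eqP.
  have -> : (y `^ p = y `^ a * y `^ q)%R.
    by rewrite -powRD ?subrK//; apply/implyP.
  by rewrite /K; ring.
(* the levels start at [tau > 0]: exhaust the set where [M E f] is positive *)
have -> : \int[mu]_(x in E) (M E f x `^ p * (u x)%:E) =
    \int[mu]_(x in \bigcup_n (E `&` [set x | (n.+1%:R^-1)%:E < M E f x])) (M E f x `^ p * (u x)%:E).
  rewrite -setI_bigcupr integral_mkcondr; apply: eq_integral => x _.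
  rewrite /patch; case: ifPn => //; rewrite notin_setE => h.
  suff -> : M E f x = 0 by rewrite poweR0r ?mul0e// gt_eqF.
  apply/eqP; rewrite eq_le (nM.2 x) andbT leNgt; apply/negP => M0; apply: h.
  case Mx : (M E f x) M0 => [m| |]//; last by exists 0%N => //=; rewrite Mx ltry.
  rewrite lte_fin => /ltr_add_invr [k]; rewrite add0r => hk; exists k => //=.
  by rewrite Mx lte_fin.
apply: nnint_bigcup_le => // [n|m n mn|n].
- by apply: measurableI => //; exact: measurable_superlevel.
- apply/subsetPset; apply: setIS => x /=; apply: le_lt_trans.
  by rewrite lee_fin lef_pV2 ?posrE// ler_nat ltnS.
by apply: main; rewrite invr_gt0.
Qed.

End StrongType.

(** * Factorization *)

Section Factorization.
Context d (T : measurableType d) (R : realType) (mu : {measure set T -> \bar R}).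
Context (dist : T -> T -> R) (C : R).
Hypothesis X : doubling_space mu dist C.
Local Notation ball_of := (pball dist).
Local Notation V b := (vol mu dist b.1 b.2).
Local Notation M := (maxfun mu dist).
Implicit Types (f g h : T -> \bar R) (b : T * R).

Lemma poweR_le (a : R) (x y : \bar R) : (0 <= a)%R -> 0 <= x -> x <= y ->
  x `^ a <= y `^ a.
Proof.
move=> a0 x0 xy; apply: gt0_ler_poweR => //; rewrite in_itv /= leey ?x0//.
by rewrite (le_trans x0 xy).
Qed.

Lemma poweRK (a : R) (x : \bar R) : (0 < a)%R -> 0 <= x -> (x `^ a) `^ a^-1 = x.
Proof. by move=> a0 x0; rewrite -poweRrM mulfV ?gt_eqF// poweRe1. Qed.

Lemma poweRVK (a : R) (x : \bar R) : (0 < a)%R -> 0 <= x -> (x `^ a^-1) `^ a = x.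
Proof. by move=> a0 x0; rewrite -poweRrM mulVf ?gt_eqF// poweRe1. Qed.

Lemma poweR_sup_le (y : nat -> \bar R) (s c : R) (z : \bar R) : (0 < s)%R ->
  (0 < c)%R -> (forall n, 0 <= y n) -> (forall n, y n `^ s * c%:E <= z) ->
  ereal_sup (range y) `^ s * c%:E <= z.
Proof.
move=> s0 c0 y0 yz; rewrite muleC -lee_pdivlMl//.
have z0 : 0 <= c^-1%:E * z.
  rewrite lee_pdivlMl// mule0; apply: le_trans (yz 0%N).
  by rewrite mule_ge0 ?poweR_ge0// lee_fin ltW.
rewrite -[leRHS](poweRVK s0 z0); apply: poweR_le; first exact: ltW.
  by apply: le_trans (y0 0%N) _; apply: ereal_sup_ubound; exists 0%N.
apply: ge_ereal_sup => _ [n _ <-]; rewrite -[leLHS](poweRK s0 (y0 n)).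
apply: poweR_le; [by rewrite invr_ge0 ltW|exact: poweR_ge0|].
by rewrite lee_pdivlMl// muleC.
Qed.

Variables (E : set T) (mE : measurable E) (E0 : 0 < mu E).
Variables (v : T -> R) (mv : measurable_fun [set: T] v).
Hypothesis v0 : forall x, (0 < v x)%R.
Variables (s : R) (s0 : (0 < s)%R).
Variables (K1 K2 : R) (K10 : (0 < K1)%R) (K20 : (0 < K2)%R).
Hypothesis S1 : forall f, nnmfun f ->
  \int[mu]_(x in E) (M E f x `^ (s + 1) * (v x)%:E) <=
  K1%:E * \int[mu]_(x in E) (f x `^ (s + 1) * (v x)%:E).
Hypothesis S2 : forall f, nnmfun f ->
  \int[mu]_(x in E) (M E f x `^ (s^-1 + 1) * (v x `^ (- s^-1))%:E) <=
  K2%:E * \int[mu]_(x in E) (f x `^ (s^-1 + 1) * (v x `^ (- s^-1))%:E).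
Variables (h0 : T -> \bar R) (nh0 : nnmfun h0).
Hypothesis h0gt0 : 0 < \int[mu]_(x in E) h0 x.
Hypothesis h0fin : \int[mu]_(x in E) (h0 x `^ (s + 1) * (v x)%:E) < +oo.

Let nv : nnmfun (EFin \o v).
Proof. by apply: nnmfun_EFin => // x; exact: ltW. Qed.

Let mass h x := h x `^ s * (v x)%:E.

Let nmass h : nnmfun h -> nnmfun (mass h).
Proof. by move=> nh; apply: nnmfunM => //; exact: nnmfun_pow. Qed.

(** The maximal operator conjugated so that it acts on the other factor
    [h `^ s * v]; it is bounded on the same space as [M E] ([dual_int]). *)
Let dualM h x := (v x `^ (- s^-1))%:E * M E (mass h) x `^ s^-1.

Let ndualM h : nnmfun h -> nnmfun (dualM h).
Proof.
move=> nh; apply: nnmfunM.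
  by rewrite (_ : (fun x => _) = (fun x => (EFin \o v) x `^ (- s^-1)))//; exact: nnmfun_pow.
by apply: nnmfun_pow; exact: (nnmfun_maxfun X E (nmass nh)).
Qed.

Let dual_int h : nnmfun h ->
  \int[mu]_(x in E) (dualM h x `^ (s + 1) * (v x)%:E) <=
  K2%:E * \int[mu]_(x in E) (h x `^ (s + 1) * (v x)%:E).
Proof.
move=> nh; have nm := nmass nh; have nM := nnmfun_maxfun X E nm.
have e1 : (- s^-1 * (s + 1) + 1 = - s^-1)%R by field; rewrite gt_eqF.
have e2 : (s^-1 * (s + 1) = s^-1 + 1)%R by field; rewrite gt_eqF.
have e3 : (s * (s^-1 + 1) = s + 1)%R by field; rewrite gt_eqF.
have vD x (y z : R) : (v x `^ y * v x `^ z = v x `^ (y + z))%R.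
  by rewrite -powRD//; apply/implyP => _; rewrite gt_eqF.
have -> : \int[mu]_(x in E) (dualM h x `^ (s + 1) * (v x)%:E) =
    \int[mu]_(x in E) (M E (mass h) x `^ (s^-1 + 1) * (v x `^ (- s^-1))%:E).
  apply: eq_integral => x _; rewrite /dualM poweRM ?lee_fin ?powR_ge0 ?poweR_ge0//.
  rewrite poweR_EFin -poweRrM -powRrM e2 muleC muleA -EFinM muleC; congr (_ * _%:E).
  by rewrite -{1}[v x]powRr1 ?(ltW (v0 x))// vD addrC e1.
apply: le_trans (S2 nm) _; apply: lee_wpmul2l; first by rewrite lee_fin ltW.
rewrite le_eqVlt; apply/orP; left; apply/eqP; apply: eq_integral => x _.
rewrite /mass poweRM ?poweR_ge0 ?lee_fin ?(ltW (v0 x))// -poweRrM e3 poweR_EFin.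
rewrite -muleA -EFinM vD (_ : s^-1 + 1 + - s^-1 = 1)%R; last by ring.
by rewrite powRr1// ltW.
Qed.

(** [h] is the limit of the increasing iteration of
    [h := max h0 (k * M E h) (k * dualM h)].  Taking maxima instead of the sum
    of a Rubio de Francia series, the limit is controlled by monotonicity and
    boundedness of the two operators; this covers [s < 1], where [dualM] is not
    sublinear.  The seed [h0] only has to be nontrivial and of finite norm. *)
Lemma factorization : exists (h : T -> \bar R) (K : R),
  [/\ (0 < K)%R, nnmfun h,
      {ae mu, forall x, E x -> 0 < h x < +oo},
      forall x, M E h x <= K%:E * h x &
      forall x, M E (fun x => h x `^ s * (v x)%:E) x <=
                K%:E * (h x `^ s * (v x)%:E)].
Proof.
have p0 : (0 < s + 1)%R by rewrite addr_gt0.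
(* scaled by [k], the two operators together at most halve the norm to the
   power [s + 1], so the iterates stay below twice that of [h0] *)
pose k := ((2 * (K1 + K2))^-1 `^ (s + 1)^-1)%R.
have k0 : (0 < k)%R by rewrite powR_gt0// invr_gt0 mulr_gt0// addr_gt0.
have kp : (k `^ (s + 1) = (2 * (K1 + K2))^-1)%R.
  rewrite /k -powRrM mulVf ?gt_eqF// powRr1// invr_ge0 mulr_ge0// ltW// addr_gt0//.
pose step h x := maxe (h0 x) (maxe (k%:E * M E h x) (k%:E * dualM h x)).
pose hh n := iter n step h0.
have nkM h : nnmfun h -> nnmfun (fun x => k%:E * M E h x).
  move=> nh; apply: (nnmfunM (nnmfun_cst T _) (nnmfun_maxfun X E nh)).
  by rewrite lee_fin ltW.
have nkD h : nnmfun h -> nnmfun (fun x => k%:E * dualM h x).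
  move=> nh; apply: (nnmfunM (nnmfun_cst T _) (ndualM nh)).
  by rewrite lee_fin ltW.
have nstep h : nnmfun h -> nnmfun (step h).
  move=> nh; apply: nnmfun_max => //; apply: nnmfun_max; [exact: nkM|exact: nkD].
have nhh n : nnmfun (hh n) by elim: n => [//|n ih]; exact: nstep.
have step_mono f g : nnmfun f -> nnmfun g -> (forall x, f x <= g x) ->
    forall x, step f x <= step g x.
  move=> nf ng fg x; rewrite /step; apply: le_max2 => //; apply: le_max2.
    apply: lee_wpmul2l; first by rewrite lee_fin ltW.
    by apply: (maxfun_mono X) => // y _; exact: fg.
  apply: lee_wpmul2l; first by rewrite lee_fin ltW.
  apply: lee_wpmul2l; first by rewrite lee_fin powR_ge0.
  apply: poweR_le; first by rewrite invr_ge0 ltW.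
    exact: (maxfun_ge0 X E x (nmass nf)).
  apply: (maxfun_mono X mE _ (nmass nf) (nmass ng)) => y _.
  apply: lee_wpmul2r; first by rewrite lee_fin ltW.
  by apply: poweR_le => //; [exact: ltW|exact: nf.2].
have hhS n x : hh n x <= hh n.+1 x.
  elim: n x => [|n ih] x; first by rewrite /hh /= /step le_max lexx.
  exact: (step_mono _ _ (nhh n) (nhh n.+1) ih).
have ndhh x : nondecreasing_seq (hh^~ x).
  by apply/nondecreasing_seqP => n; exact: hhS.
pose h x := ereal_sup (range (hh^~ x)).
have nh : nnmfun h by exact: nnmfun_sup.
have hhh n x : hh n x <= h x by apply: ereal_sup_ubound; exists n.
pose N f := \int[mu]_(x in E) (f x `^ (s + 1) * (v x)%:E).
have np f : nnmfun f -> nnmfun (fun x => f x `^ (s + 1) * (v x)%:E).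
  by move=> nf; apply: nnmfunM => //; exact: nnmfun_pow.
have kscale f : nnmfun f -> N (fun x => k%:E * f x) = ((2 * (K1 + K2))^-1)%:E * N f.
  move=> nf; rewrite /N -nnintZl//; last 2 first.
  - exact: np.
  - by rewrite lee_fin invr_ge0 mulr_ge0// ltW// addr_gt0.
  apply: eq_integral => x _; rewrite poweRM; [|by rewrite lee_fin ltW|exact: nf.2].
  by rewrite poweR_EFin kp muleA.
have pmax (f g : T -> \bar R) x : nnmfun f -> nnmfun g ->
    maxe (f x) (g x) `^ (s + 1) * (v x)%:E <=
    f x `^ (s + 1) * (v x)%:E + g x `^ (s + 1) * (v x)%:E.
  move=> nf ng; have [fg|gf] := leP (f x) (g x).
    by rewrite leeDr//; exact: (np _ nf).2.
  by rewrite leeDl//; exact: (np _ ng).2.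
have Nmax f g : nnmfun f -> nnmfun g -> N (fun x => maxe (f x) (g x)) <= N f + N g.
  move=> nf ng; rewrite /N -nnintD//; [|exact: np|exact: np].
  apply: nnint_le => //; [by apply: np; exact: nnmfun_max
    |by apply: nnmfunD; exact: np|].
  by move=> x _; exact: pmax.
have Nh0 : N h0 \is a fin_num by rewrite ge0_fin_numE//; apply: nnint_ge0; exact: np.
have Nbound n : N (hh n) <= 2%:E * N h0.
  have N00 : 0 <= N h0 by apply: nnint_ge0; exact: np.
  elim: n => [|n ih]; first by apply: lee_pemull => //; rewrite lee_fin; lra.
  apply: (@le_trans _ _ (N h0 + N h0)); last first.
    by rewrite -[in leLHS](fineK Nh0) -(fineK Nh0) -EFinM -EFinD lee_fin; lra.
  apply: le_trans (Nmax _ _ nh0 _) _.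
    exact: (nnmfun_max (nkM _ (nhh n)) (nkD _ (nhh n))).
  apply: leeD2l; apply: le_trans (Nmax _ _ (nkM _ (nhh n)) (nkD _ (nhh n))) _.
  rewrite (kscale _ (nnmfun_maxfun X E (nhh n))) (kscale _ (ndualM (nhh n))).
  apply: (@le_trans _ _ (((2 * (K1 + K2))^-1)%:E * (K1%:E * (2%:E * N h0)) +
    ((2 * (K1 + K2))^-1)%:E * (K2%:E * (2%:E * N h0)))).
    have kk : 0 <= ((2 * (K1 + K2))^-1)%:E by rewrite lee_fin invr_ge0 mulr_ge0// ltW// addr_gt0.
    apply: leeD; apply: lee_wpmul2l => //.
      by apply: le_trans (S1 (nhh n)) _; apply: lee_wpmul2l => //; rewrite lee_fin ltW.
    by apply: le_trans (dual_int (nhh n)) _; apply: lee_wpmul2l => //; rewrite lee_fin ltW.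
  rewrite -(fineK Nh0) -!EFinM -EFinD lee_fin le_eqVlt; apply/orP; left; apply/eqP.
  by field; rewrite gt_eqF// addr_gt0.
have Nh : N h < +oo.
  apply: (@le_lt_trans _ _ (2%:E * N h0)); last by rewrite -(fineK Nh0) -EFinM ltry.
  apply: (@le_trans _ _ (\int[mu]_(x in E) ereal_sup (range (fun n => hh n x `^ (s + 1) * (v x)%:E)))).
    apply: nnint_le => //; first exact: np.
      by apply: nnmfun_sup => n; exact: np.
    move=> x _; apply: poweR_sup_le => // n; first exact: (nhh n).2.
    by apply: ereal_sup_ubound; exists n.
  rewrite nnint_sup//; last 2 first.
  - by move=> n; exact: np.
  - move=> x m n mn; apply: lee_wpmul2r; first by rewrite lee_fin ltW.
    by apply: poweR_le; [exact: ltW|exact: (nhh m).2|exact: ndhh].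
  by apply: ge_ereal_sup => _ [n _ <-]; exact: Nbound.
have Mh x : k%:E * M E h x <= h x.
  rewrite -lee_pdivlMl//; apply: le_trans (maxfun_sup X mE x nhh ndhh) _.
  apply: ge_ereal_sup => _ [n _ <-]; rewrite lee_pdivlMl//.
  by apply: le_trans (hhh n.+1 x); rewrite /hh /= /step !le_max lexx orbT.
have hpos x : 0 < h x.
  apply: lt_le_trans (Mh x); rewrite mule_gt0 ?lte_fin//.
  apply: lt_le_trans (maxfun_gt0 X _ mE nh0 h0gt0) _.
  by apply: (maxfun_mono X) => // y _; exact: (hhh 0%N).
have ks0 : (0 < k^-1 `^ s)%R by rewrite powR_gt0 ?invr_gt0.
exists h, (k^-1 + k^-1 `^ s)%R; split => //.
- by rewrite addr_gt0// invr_gt0.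
- have : mu.-integrable E (fun x => h x `^ (s + 1) * (v x)%:E).
    apply/integrableP; split; first exact: measurable_funTS (np _ nh).1.
    by under eq_integral do rewrite gee0_abs ?(np _ nh).2//.
  move/(integrable_ae mE); apply: filterS => x hx /hx; rewrite hpos/=.
  case: (h x) => [r| |]//; first by rewrite ltry.
  by rewrite poweRyr ?gt_eqF// mulyr gtr0_sg// mul1e.
- move=> x; apply: (@le_trans _ _ (k^-1%:E * h x)); first by rewrite lee_pdivlMl.
  by apply: lee_wpmul2r; [exact: nh.2|rewrite lee_fin lerDl ltW].
move=> x; have nm := nmass nh.
apply: (@le_trans _ _ ((k^-1 `^ s)%:E * mass h x)); last first.
  by apply: lee_wpmul2r; [exact: nm.2|rewrite lee_fin lerDr invr_ge0 ltW].
have dualle n : dualM (hh n) x <= k^-1%:E * h x.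
  rewrite lee_pdivlMl//; apply: le_trans (hhh n.+1 x).
  by rewrite /hh /= /step !le_max lexx !orbT.
have massle n : M E (mass (hh n)) x <= (k^-1 `^ s)%:E * mass h x.
  have nMn := nnmfun_maxfun X E (nmass (nhh n)).
  have := poweR_le (ltW s0) ((ndualM (nhh n)).2 x) (dualle n).
  rewrite /dualM [in leLHS]poweRM ?lee_fin ?powR_ge0 ?poweR_ge0// poweRVK//; last exact: nMn.2.
  rewrite poweR_EFin -powRrM mulNr mulVf ?gt_eqF// powR_inv1 ?(ltW (v0 x))//.
  rewrite lee_pdivrMl// => /le_trans; apply.
  rewrite poweRM ?lee_fin ?invr_ge0 ?(ltW k0) ?(ltW (hpos x))// poweR_EFin.
  by rewrite /mass muleCA [_%:E * (h x `^ s)]muleC.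
apply: (@le_trans _ _ (M E (fun y => ereal_sup (range (fun n => mass (hh n) y))) x)).
  apply: (maxfun_mono X) => //; first by apply: nnmfun_sup => n; exact: nmass.
  move=> y _; apply: poweR_sup_le => // n; first exact: (nhh n).2.
  by apply: ereal_sup_ubound; exists n.
apply: le_trans (maxfun_sup X mE x _ _) _.
- by move=> n; exact: nmass.
- move=> y m n mn; apply: lee_wpmul2r; first by rewrite lee_fin ltW.
  by apply: poweR_le; [exact: ltW|exact: (nhh m).2|exact: ndhh].
by apply: ge_ereal_sup => _ [n _ <-]; exact: massle.
Qed.

End Factorization.

(** * Extending [A_p] weights *)

Section ApExtension.
Context d (T : measurableType d) (R : realType) (mu : {measure set T -> \bar R}).
Context (dist : T -> T -> R) (C : R).
Hypothesis X : doubling_space mu dist C.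
Local Notation ball_of := (pball dist).
Local Notation V b := (vol mu dist b.1 b.2).
Local Notation M := (maxfun mu dist).
Implicit Types (f g h : T -> \bar R) (b : T * R).

Lemma powRDp (x y z : R) : (0 < x)%R -> (x `^ (y + z) = x `^ y * x `^ z)%R.
Proof. by move=> x0; rewrite powRD//; apply/implyP => _; rewrite gt_eqF. Qed.

(** Jensen's inequality for a concave power, without its sharp constant: a
    concave power lies below [lam `^ theta + lam `^ (theta - 1) * u]. *)
Lemma integral_powR_le (A : set T) (u : T -> R) (theta lam m : R) :
  measurable A -> nnmfun (EFin \o u) -> (0 < theta)%R -> (theta <= 1)%R -> (0 < lam)%R ->
  mu A <= m%:E -> \int[mu]_(x in A) (u x)%:E <= (lam * m)%:E ->
  \int[mu]_(x in A) (u x `^ theta)%:E <= (2 * lam `^ theta * m)%:E.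
Proof.
move=> mA nu t0 t1 l0 Am Iu.
have ut : nnmfun (fun x => (u x `^ theta)%:E).
  by rewrite (_ : (fun x => _) = (fun x => (EFin \o u) x `^ theta))//; exact: nnmfun_pow.
have nl : nnmfun (fun x => (lam `^ (theta - 1))%:E * (u x)%:E).
  by apply: (nnmfunM (nnmfun_cst T _) nu); rewrite lee_fin powR_ge0.
have nc : nnmfun (cst (lam `^ theta)%:E : T -> \bar R).
  by apply: nnmfun_cst; rewrite lee_fin powR_ge0.
apply: (@le_trans _ _ (\int[mu]_(x in A)
    ((lam `^ (theta - 1))%:E * (u x)%:E + cst (lam `^ theta)%:E x))).
  apply: nnint_le => //; first exact: nnmfunD.
  move=> x _; have u0 : (0 <= u x)%R by rewrite -lee_fin; exact: nu.2.
  rewrite -EFinM -EFinD lee_fin; have [ul|lu] := leP (u x) lam.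
    by apply: ler_wpDl; [rewrite mulr_ge0 ?powR_ge0|apply: powR_le => //; exact: ltW].
  apply: ler_wpDr; first exact: powR_ge0.
  have up : (0 < u x)%R by apply: lt_trans lu.
  rewrite -(@mulr_powRB1 _ (u x) theta)// mulrC ler_wpM2r//.
  rewrite -opprB !powRN lef_pV2 ?posrE ?powR_gt0//.
  by apply: powR_le; rewrite ?(ltW l0) ?(ltW lu)//; lra.
rewrite nnintD// nnintZl ?lee_fin ?powR_ge0// integral_cst//.
apply: (@le_trans _ _ ((lam `^ (theta - 1))%:E * (lam * m)%:E + (lam `^ theta)%:E * m%:E)).
  by apply: leeD; apply: lee_wpmul2l => //; rewrite lee_fin powR_ge0.
rewrite -!EFinM -EFinD lee_fin mulrA [X in (X * _ + _)%R]mulrC mulr_powRB1 ?(ltW l0)//.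
by rewrite le_eqVlt; apply/orP; left; apply/eqP; ring.
Qed.

Variables (E : set T) (mE : measurable E) (E0 : 0 < mu E).
Variables (w : T -> R) (mw : measurable_fun [set: T] w).
Hypothesis w0 : forall x, (0 < w x)%R.

Let nw (a : R) : nnmfun (fun x => (w x `^ a)%:E).
Proof.
rewrite (_ : (fun x => _) = (fun x => (EFin \o w) x `^ a))//; apply: nnmfun_pow.
by apply: nnmfun_EFin => // x; exact: ltW.
Qed.

Let mwp (a : R) : measurable_fun [set: T] (fun x => w x `^ a)%R.
Proof. by apply/measurable_EFinP; exact: (nw a).1. Qed.

Let wp0 (a : R) x : (0 < w x `^ a)%R. Proof. exact: powR_gt0. Qed.

Lemma mu_ballI b : (0 < b.2)%R -> mu (ball_of b `&` E) <= (V b)%:E.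
Proof.
move=> b0; rewrite -(mu_ball X b0); have mb := mball X b.
by apply: le_measure; rewrite ?inE//; exact: measurableI.
Qed.

(** Lower the exponent of one weight of the pair from [1 + eps] to [1 + eta],
    using [integral_powR_le], and leave the other alone: [w `^ (1 + eta)] and
    [w `^ (- ((1 + eps) / s))] are dual for the smaller index [s * theta], and
    the symmetric choice lowers the dual index [s^-1]. *)
Lemma Ap_pair_openness (s Q eps eta : R) : (0 < s)%R -> (0 < Q)%R -> (0 < eta < eps)%R ->
  Ap_pair mu dist E (fun x => w x `^ (1 + eps))%R
    (fun x => w x `^ (- ((1 + eps) / s)))%R s Q ->
  let theta := ((1 + eta) / (1 + eps))%R in
  Ap_pair mu dist E (fun x => w x `^ (1 + eta))%R
    (fun x => (w x `^ (1 + eta)) `^ (- (s * theta)^-1))%R (s * theta) (2 * Q `^ theta) /\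
  Ap_pair mu dist E (fun x => (w x `^ (1 + eta)) `^ (- s^-1))%R
    (fun x => ((w x `^ (1 + eta)) `^ (- s^-1)) `^ (- (s^-1 * theta)^-1))%R
    (s^-1 * theta) (2 * Q `^ (theta / s)).
Proof.
move=> s0 Q0 /andP[eta0 ee] wAp theta.
have e1 : (0 < 1 + eps)%R by lra.
have e2 : (0 < 1 + eta)%R by lra.
have th0 : (0 < theta)%R by rewrite divr_gt0.
have th1 : (theta < 1)%R by rewrite ltr_pdivrMr// mul1r; lra.
have E1 : ((1 + eta) * - (s * theta)^-1 = - ((1 + eps) / s))%R.
  by rewrite /theta; field; rewrite !gt_eqF.
have E2 : ((1 + eta) * (- s^-1 * - (s^-1 * theta)^-1) = 1 + eps)%R.
  by rewrite /theta; field; rewrite !gt_eqF.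
have E3 : ((1 + eps) * theta = 1 + eta)%R by rewrite /theta; field; rewrite gt_eqF.
have E4 : (- ((1 + eps) / s) * theta = (1 + eta) * - s^-1)%R.
  by rewrite /theta; field; rewrite !gt_eqF.
split=> b b0; have [al [be [al0 be0 ual vbe abQ]]] := wAp b b0;
  have mb := mball X b; have mbE : measurable (ball_of b `&` E) by exact: measurableI.
- have bs0 : (0 < be `^ s)%R by rewrite powR_gt0.
  have lam0 : (0 < Q / be `^ s)%R by rewrite divr_gt0.
  have alQ : (al <= Q / be `^ s)%R by rewrite ler_pdivlMr.
  exists (2 * (Q / be `^ s) `^ theta)%R, be; split => //.
  + by rewrite mulr_ge0 ?powR_ge0.
  + have Iu : \int[mu]_(x in ball_of b `&` E) (w x `^ (1 + eps))%:E <=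
        (Q / be `^ s * V b)%:E.
      by apply: le_trans ual _; rewrite lee_fin ler_wpM2r// ltW// (V_gt0 X).
    have := integral_powR_le mbE (nw (1 + eps)) th0 (ltW th1) lam0 (mu_ballI b0) Iu.
    by under eq_integral do rewrite -powRrM E3.
  + by under eq_integral do rewrite -powRrM E1.
  rewrite powRM ?(ltW Q0) ?invr_ge0 ?(ltW bs0)//.
  rewrite -[((be `^ s)^-1)%R]powRN -powRrM mulNr -mulrA -mulrA -powRDp//.
  by rewrite addNr powRr0 mulr1.
have bs0 : (0 < be `^ s)%R by rewrite powR_gt0.
have lam0 : (0 < Q / be `^ s)%R by rewrite divr_gt0.
have alQ : (al <= Q / be `^ s)%R by rewrite ler_pdivlMr.
exists (2 * be `^ theta)%R, (Q / be `^ s)%R; split => //.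
- by rewrite mulr_ge0 ?powR_ge0.
- have := integral_powR_le mbE (nw (- ((1 + eps) / s))) th0 (ltW th1) be0 (mu_ballI b0) vbe.
  under eq_integral do rewrite -powRrM E4.
  by under [X in _ -> X <= _]eq_integral do rewrite -powRrM.
- under eq_integral do rewrite -!powRrM E2.
  by apply: le_trans ual _; rewrite lee_fin ler_wpM2r// ltW// (V_gt0 X).
rewrite powRM ?(ltW Q0) ?invr_ge0 ?(ltW bs0)//.
rewrite -[((be `^ s)^-1)%R]powRN -powRrM.
rewrite (_ : - s * (s^-1 * theta) = - theta)%R; last by field; rewrite gt_eqF.
rewrite mulrCA -mulrA mulrA -[(2 * _)%R]mulrC -mulrA -powRDp// subrr powRr0 mulr1.
by rewrite [(s^-1 * theta)%R]mulrC.
Qed.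

Lemma ball_meeting : exists2 b, (0 < b.2)%R & 0 < mu (ball_of b `&` E).
Proof.
have n1 : nnmfun (cst 1 : T -> \bar R) by exact: nnmfun_cst.
have : 0 < M E (cst 1) point.
  by apply: (maxfun_gt0 X) => //; rewrite integral_cst// mul1e.
move=> /ereal_sup_gt[_ [b [b0 _] <-]]; rewrite (lt_avg X)// mul0r.
rewrite integral_cst ?mul1e; last by apply: measurableI => //; exact: (mball X).
by move=> h; exists b.
Qed.

(** On a ball each [A_1] weight is bounded below, almost everywhere, by a
    multiple of its mean, so its negative powers are bounded above by constants;
    what remains under each of the two integrals is the other weight. *)
Lemma A1_product (W1 W2 : T -> R) (c1 c2 s : R) : (0 < s)%R ->
  (0 < c1)%R -> (0 < c2)%R ->
  A1_weight mu dist W1 c1 -> A1_weight mu dist W2 c2 ->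
  let W x := (W1 x * W2 x `^ (- s))%R in
  [/\ measurable_fun [set: T] W, forall x, (0 <= W x)%R,
      {ae mu, forall x, (0 < W x)%R} &
      Ap_pair mu dist [set: T] W (fun x => W x `^ (- s^-1))%R s (c1 * c2 `^ s)].
Proof.
move=> s0 c10 c20 [mW1 W10 h1] [mW2 W20 h2] W.
have nW1 : nnmfun (EFin \o W1) by exact: nnmfun_EFin.
have nW2 : nnmfun (EFin \o W2) by exact: nnmfun_EFin.
have W0 x : (0 <= W x)%R by rewrite mulr_ge0// powR_ge0.
have mpow (u : T -> R) (a : R) : nnmfun (EFin \o u) -> measurable_fun [set: T] (fun x => u x `^ a)%R.
  by move=> nu; apply/measurable_EFinP; exact: (nnmfun_pow a nu).1.
have mW : measurable_fun [set: T] W by apply: measurable_funM => //; exact: mpow.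
have nW : nnmfun (EFin \o W) by exact: nnmfun_EFin.
have nWs : nnmfun (EFin \o (fun x => W x `^ (- s^-1))%R).
  by apply: nnmfun_EFin => [|x]; [exact: mpow|exact: powR_ge0].
have pos b : (0 < b.2)%R -> {ae mu, forall x, ball_of b x -> (0 < W1 x)%R /\ (0 < W2 x)%R}.
  move=> b0; have [a1 [a10 _ l1]] := h1 b b0; have [a2 [a20 _ l2]] := h2 b b0.
  move: l1 l2; apply: filterS2 => x l1 l2 bx; split.
    by rewrite -(pmulr_rgt0 _ c10); apply: lt_le_trans (l1 bx).
  by rewrite -(pmulr_rgt0 _ c20); apply: lt_le_trans (l2 bx).
split => //.
  have : {ae mu, forall x, (0 < W1 x)%R /\ (0 < W2 x)%R}.
    by apply: (ae_balls X (x0 := point)) => n; apply: pos; rewrite /= ltr0n.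
  by apply: filterS => x [W1x W2x]; rewrite mulr_gt0// powR_gt0.
move=> b b0; have [a1 [a10 I1 l1]] := h1 b b0; have [a2 [a20 I2 l2]] := h2 b b0.
have mb := mball X b; rewrite !setIT.
have nk (k : R) (u : T -> R) : (0 <= k)%R -> nnmfun (EFin \o u) -> nnmfun (fun x => k%:E * (u x)%:E).
  by move=> k0 nu; apply: (nnmfunM (nnmfun_cst T _) nu); rewrite lee_fin.
have d1 : (0 < a1 / c1)%R by rewrite divr_gt0.
have d2 : (0 < a2 / c2)%R by rewrite divr_gt0.
exists (a1 * (a2 / c2) `^ (- s))%R, ((a1 / c1) `^ (- s^-1) * a2)%R; split.
- by rewrite mulr_ge0 ?powR_ge0// ltW.
- by rewrite mulr_gt0// powR_gt0.
- have k0 : (0 <= (a2 / c2) `^ (- s))%R by exact: powR_ge0.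
  apply: (@le_trans _ _ (\int[mu]_(x in ball_of b) (((a2 / c2) `^ (- s))%:E * (W1 x)%:E))).
    apply: nnint_ae_le => //; first exact: nk.
    move: l2 (pos b b0); apply: filterS2 => x l2 ps bx; have [W1x W2x] := ps bx.
    rewrite -EFinM lee_fin /W mulrC ler_wpM2r// !powRN lef_pV2 ?posrE ?powR_gt0//.
    by apply: powR_le; [exact: ltW|exact: ltW|rewrite ler_pdivrMr// mulrC; exact: l2].
  rewrite nnintZl// ?lee_fin// I1 -EFinM lee_fin le_eqVlt; apply/orP; left.
  by apply/eqP; ring.
- have k0 : (0 <= (a1 / c1) `^ (- s^-1))%R by exact: powR_ge0.
  apply: (@le_trans _ _ (\int[mu]_(x in ball_of b) (((a1 / c1) `^ (- s^-1))%:E * (W2 x)%:E))).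
    apply: nnint_ae_le => //; first exact: nk.
    move: l1 (pos b b0); apply: filterS2 => x l1 ps bx; have [W1x W2x] := ps bx.
    rewrite -EFinM lee_fin /W powRM ?powR_ge0// -powRrM mulrNN mulfV ?gt_eqF// powRr1//.
    rewrite ler_wpM2r// !powRN lef_pV2 ?posrE ?powR_gt0//.
    apply: powR_le; [by rewrite invr_ge0 ltW|exact: ltW|].
    by rewrite ler_pdivrMr// mulrC; exact: l1.
  by rewrite nnintZl// ?lee_fin// I2 -EFinM lee_fin mulrA.
rewrite [((_ * a2) `^ s)%R]powRM ?powR_ge0 ?(ltW a20)// -powRrM mulNr mulVf ?gt_eqF//.
rewrite powR_inv1 ?(ltW d1)// invf_div powRM ?invr_ge0 ?(ltW c20) ?(ltW a20)//.
have a2s : (0 < a2 `^ s)%R by rewrite powR_gt0.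
rewrite -[(c2^-1)%R]powR_inv1 ?(ltW c20)// -powRrM mulrNN mul1r powRN.
by rewrite le_eqVlt; apply/orP; left; apply/eqP; field; rewrite !gt_eqF.
Qed.

(** [factorization] writes [v = w `^ (1 + eps / 2)] on [E] as the quotient of
    [g = h `^ s * v] by [h `^ s], where [g] and [h] both satisfy the condition
    of [A1_extension].  The power [delta = (1 + eps / 2)^-1] that
    [A1_extension] requires brings [v] back to [w]. *)
Lemma Ap_extension (s Q eps : R) : (0 < s)%R -> (0 < Q)%R -> (0 < eps)%R ->
  Ap_pair mu dist E (fun x => w x `^ (1 + eps))%R
    (fun x => w x `^ (- ((1 + eps) / s)))%R s Q ->
  exists (W : T -> R) (Q' : R),
  [/\ measurable_fun [set: T] W, forall x, (0 <= W x)%R,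
      {ae mu, forall x, (0 < W x)%R},
      {ae mu, forall x, E x -> W x = w x} &
      Ap_pair mu dist [set: T] W (fun x => W x `^ (- s^-1))%R s Q'].
Proof.
move=> s0 Q0 eps0 wAp; pose eta := (eps / 2)%R.
have eta0 : (0 < eta)%R by rewrite divr_gt0.
have etae : (0 < eta < eps)%R by rewrite eta0 /=/eta; lra.
have e1 : (0 < 1 + eps)%R by lra.
have e2 : (0 < 1 + eta)%R by lra.
have [] := Ap_pair_openness s0 Q0 etae wAp.
set theta := ((1 + eta) / (1 + eps))%R => vAp sAp.
have th0 : (0 < theta)%R by rewrite divr_gt0.
have th1 : (theta < 1)%R by rewrite ltr_pdivrMr// mul1r /eta; lra.
pose v x := (w x `^ (1 + eta))%R.
have v0 x : (0 < v x)%R by exact: wp0.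
have mv : measurable_fun [set: T] v by exact: mwp.
have nv : nnmfun (EFin \o v) by exact: nw.
have mvs : measurable_fun [set: T] (fun x => v x `^ (- s^-1))%R.
  by apply/measurable_EFinP; exact: (nnmfun_pow (- s^-1) nv).1.
have sth : (0 < s * theta)%R by rewrite mulr_gt0.
have sVth : (0 < s^-1 * theta)%R by rewrite mulr_gt0// invr_gt0.
have QQ (a : R) : (0 < 2 * Q `^ a)%R by rewrite mulr_gt0// powR_gt0.
have [K1 K10 S1] : exists2 K : R, (0 < K)%R & forall f, nnmfun f ->
    \int[mu]_(x in E) (M E f x `^ (s + 1) * (v x)%:E) <=
    K%:E * \int[mu]_(x in E) (f x `^ (s + 1) * (v x)%:E).
  apply: (strong_type X mE mv v0 sth (QQ _) vAp).
  by rewrite ltrD2r -[ltRHS]mulr1 ltr_pM2l.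
have [K2 K20 S2] : exists2 K : R, (0 < K)%R & forall f, nnmfun f ->
    \int[mu]_(x in E) (M E f x `^ (s^-1 + 1) * (v x `^ (- s^-1))%:E) <=
    K%:E * \int[mu]_(x in E) (f x `^ (s^-1 + 1) * (v x `^ (- s^-1))%:E).
  have vs0 x : (0 < v x `^ (- s^-1))%R by rewrite powR_gt0.
  apply: (strong_type X mE mvs vs0 sVth (QQ _) sAp).
  by rewrite ltrD2r -[ltRHS]mulr1 ltr_pM2l// invr_gt0.
have [b0 b00 b0E] := ball_meeting.
have mb := mball X b0.
pose h0 := (cst 1 : T -> \bar R) \_ (ball_of b0).
have nh0 : nnmfun h0 by apply: nnmfun_restrict => //; exact: nnmfun_cst.
have h0pos : 0 < \int[mu]_(x in E) h0 x.
  rewrite -integral_mkcondr setIC integral_cst ?mul1e//; exact: measurableI.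
have h0fin : \int[mu]_(x in E) (h0 x `^ (s + 1) * (v x)%:E) < +oo.
  have [al [be [_ _ val _ _]]] := vAp b0 b00.
  apply: (@le_lt_trans _ _ (al * V b0)%:E); last by rewrite ltry.
  apply: le_trans val; rewrite setIC integral_mkcondr.
  rewrite le_eqVlt; apply/orP; left; apply/eqP; apply: eq_integral => x _.
  rewrite /h0 /patch; case: ifPn => _; first by rewrite poweR1r mul1e.
  by rewrite poweR0r ?mul0e// gt_eqF// addr_gt0.
have [h [K [K0 nh hfin hM gM]]] :=
  factorization X mE mv v0 s0 K10 K20 S1 S2 nh0 h0pos h0fin.
pose g x := h x `^ s * (v x)%:E.
have ng : nnmfun g by apply: nnmfunM => //; exact: nnmfun_pow.
pose delta := ((1 + eta)^-1)%R.
have d01 : (0 < delta < 1)%R.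
  by rewrite invr_gt0 e2 /= invf_lt1//; lra.
have d0 : (0 < delta)%R by case/andP: d01.
have gfin : {ae mu, forall x, E x -> 0 < g x < +oo}.
  move: hfin; apply: filterS => x hx Ex; move: (hx Ex); rewrite /g.
  case: (h x) => [y| |]//.
    move=> /andP[y0 _]; rewrite poweR_EFin -EFinM ltry andbT lte_fin.
    by rewrite mulr_gt0// powR_gt0.
  by rewrite ltxx andbF.
have [W1 [c1 [c10 A1 W1E]]] : exists (W : T -> R) (c : R), [/\ (0 < c)%R,
    A1_weight mu dist W c & forall x, E x -> W x = (fine (g x) `^ delta)%R].
  by apply: (A1_extension X mE E0 ng d01 K0 gfin); apply: aeW => x _; exact: gM.
have [W2 [c2 [c20 A2 W2E]]] : exists (W : T -> R) (c : R), [/\ (0 < c)%R,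
    A1_weight mu dist W c & forall x, E x -> W x = (fine (h x) `^ delta)%R].
  by apply: (A1_extension X mE E0 nh d01 K0 hfin); apply: aeW => x _; exact: hM.
have [mW W0 Wpos WAp] := A1_product s0 c10 c20 A1 A2.
exists (fun x => W1 x * W2 x `^ (- s))%R, (c1 * c2 `^ s)%R; split => //.
move: hfin; apply: filterS => x hx Ex; rewrite W1E// W2E//; move: (hx Ex); rewrite /g.
case: (h x) => [y| |]//; last by rewrite ltxx andbF.
move=> /andP[]; rewrite lte_fin => y0 _.
rewrite poweR_EFin -EFinM /= powRM ?powR_ge0 ?(ltW (v0 x))// mulrAC.
rewrite -!powRrM -powRDp// (_ : _ + _ = 0)%R; last by ring.
by rewrite powRr0 mul1r mulfV ?gt_eqF// powRr1// ltW.
Qed.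

End ApExtension.

(** * Density and the [A_infty] condition *)

Section ReverseHolder.
Context d (T : measurableType d) (R : realType) (mu : {measure set T -> \bar R}).
Context (dist : T -> T -> R) (C : R).
Hypothesis X : doubling_space mu dist C.
Local Notation ball_of := (pball dist).
Local Notation ball3_of := (pball3 dist).
Local Notation balls_union := (union_pballs dist).
Local Notation V b := (vol mu dist b.1 b.2).
Implicit Types (b : T * R).

Definition dist_open (U : set T) := forall x, U x ->
  exists2 r : R, (0 < r)%R & dball dist x r `<=` U.

(** The factor 2 may be any constant below the 4 in [kap]. *)
Definition outer_regular := forall (N : set T) x0 (r0 : R),
  measurable N -> N `<=` dball dist x0 r0 -> 0 < mu N ->
  exists U : set T, [/\ measurable U, dist_open U, N `<=` U & mu U <= 2%:E * mu N].

Hypothesis oreg : outer_regular.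

(** Chosen so that a set of density at most [kap] in the triple of a ball has at
    most a quarter of the volume of the ball. *)
Let kap := ((4 * C ^+ 2)^-1)%R.

Lemma kap_gt0 : (0 < kap)%R.
Proof. by rewrite /kap invr_gt0 mulr_gt0// exprn_gt0// (C_gt0 X). Qed.

Lemma kapC : (kap * C ^+ 2 = 4^-1)%R.
Proof. by rewrite /kap invfM -mulrA mulVf ?mulr1// expf_neq0// gt_eqF// (C_gt0 X). Qed.

(** A weak form of the Lebesgue density theorem.  Let [N] be the set of points
    of [F] in no small ball of density [kap], and [U] an open set around [N] of
    at most twice its measure.  In the triple of a small ball centred in [N] the
    set [N] has at most a quarter of the volume of the ball, so the covering
    lemma in [U] gives [mu N <= mu U / 4 <= mu N / 2]. *)
Lemma density (F : set T) (rho : R) : measurable F -> (0 < rho)%R ->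
  {ae mu, forall x, F x -> exists b, [/\ (0 < b.2)%R, (b.2 < rho)%R, ball_of b x &
     (kap * V b)%:E <= mu (ball_of b `&` F)]}.
Proof.
move=> mF rho0.
pose dense := [set b | [/\ (0 < b.2)%R, (b.2 < rho)%R &
  (kap * V b)%:E <= mu (ball_of b `&` F)]].
have mD : measurable (balls_union dense) by exact: measurable_balls_union X _.
pose N := F `\` balls_union dense.
have mN : measurable N by exact: measurableD.
apply: (ae_balls X (x0 := point)) => n; pose bn := (point : T, n.+1%:R : R)%R.
have mbn := mball X bn.
exists (N `&` ball_of bn); split; first exact: measurableI.
  have mNb : measurable (N `&` ball_of bn) by exact: measurableI.
  apply/eqP; rewrite -measure_le0 leNgt; apply/negP => N0.
  have [U [mU oU NU muU]] : exists U : set T, [/\ measurable U, dist_open U,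
      N `&` ball_of bn `<=` U & mu U <= 2%:E * mu (N `&` ball_of bn)].
    by apply: (oreg (x0 := bn.1) (r0 := bn.2)) => //; exact: subIsetr.
  have Nfin : mu (N `&` ball_of bn) \is a fin_num.
    rewrite ge0_fin_numE//; apply: (@le_lt_trans _ _ (mu (ball_of bn))).
      by apply: le_measure; rewrite ?inE.
    by rewrite (mu_ball X) ?ltry//= ltr0n.
  pose fam := [set b | [/\ (N `&` ball_of bn) b.1, (0 < b.2)%R, (3 * b.2 < rho)%R &
    ball_of b `<=` U]].
  have cov : N `&` ball_of bn `<=` balls_union fam `&` (N `&` ball_of bn).
    move=> x Nx; split => //; have [r r0 rU] := oU x (NU x Nx).
    pose r' := (Num.min r (rho / 4))%R.
    have r'0 : (0 < r')%R by rewrite lt_min r0 divr_gt0.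
    exists (x, r'); last exact: (mem_dball X).
    split => //=.
      have : (r' <= rho / 4)%R by rewrite ge_min lexx orbT.
      lra.
    by apply: subset_trans rU; apply: dball_subr; rewrite ge_min lexx.
  have n1 : nnmfun (cst 1 : T -> \bar R) by exact: nnmfun_cst.
  have nq : nnmfun (cst (4^-1)%:E : T -> \bar R) by apply: nnmfun_cst; rewrite lee_fin invr_ge0.
  have mfU : measurable (balls_union fam `&` U).
    by apply: measurableI => //; exact: measurable_balls_union X _.
  have mfN : measurable (balls_union fam `&` (N `&` ball_of bn)).
    by apply: measurableI => //; exact: measurable_balls_union X _.
  have hc : \int[mu]_(x in balls_union fam `&` (N `&` ball_of bn)) cst 1 x <=
      \int[mu]_(x in balls_union fam `&` U) cst (4^-1)%:E x.
    apply: (covering X n1 nq mNb mU); first by move=> b [].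
    move=> b [Nb b0 b3 bU].
    have b30 : (0 < (b.1, 3 * b.2)%R.2)%R by rewrite /= mulr_gt0.
    have mb := mball X b; have mb3 := mball X (b.1, 3 * b.2)%R.
    have mb3N : measurable (ball3_of b `&` (N `&` ball_of bn)) := measurableI _ _ mb3 mNb.
    have mb3F : measurable (ball3_of b `&` F) := measurableI _ _ mb3 mF.
    rewrite (_ : ball_of b `&` U = ball_of b); last by apply/setIidPl.
    rewrite !integral_cst// mul1e (mu_ball X b0) -EFinM -kapC.
    apply: (@le_trans _ _ (mu (ball3_of b `&` F))).
      by apply: le_measure; rewrite ?inE//; apply: setIS => x [[]].
    apply: (@le_trans _ _ (kap * V (b.1, 3 * b.2)%R)%:E); last first.
      by rewrite lee_fin -mulrA ler_wpM2l ?(ltW kap_gt0)//; exact: (vol_3 X).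
    rewrite leNgt; apply/negP => hd; case: Nb => -[_ nD] _; apply: nD.
    exists (b.1, 3 * b.2)%R; last exact: (mem_dball X).
    by split => //; exact: ltW.
  have h : mu (N `&` ball_of bn) <= (4^-1)%:E * mu U.
    move: hc; rewrite !integral_cst// mul1e => hc.
    apply: (@le_trans _ _ (mu (balls_union fam `&` (N `&` ball_of bn)))).
      by apply: le_measure; rewrite ?inE.
    apply: (le_trans hc); apply: lee_wpmul2l; first by rewrite lee_fin invr_ge0.
    by apply: le_measure; rewrite ?inE.
  have : mu (N `&` ball_of bn) <= (4^-1)%:E * (2%:E * mu (N `&` ball_of bn)).
    by apply: (le_trans h); apply: lee_wpmul2l => //; rewrite lee_fin invr_ge0.
  have : (0 < fine (mu (N `&` ball_of bn)))%R by rewrite -lte_fin fineK.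
  by rewrite -{2 3}(fineK Nfin) -!EFinM lee_fin; lra.
move=> x /= hx; apply: contrapT => nx; apply: hx => bnx Fx.
apply: contrapT => no; apply: nx; split => //; split => // -[b [b0 br dens] bx].
by apply: no; exists b.
Qed.

Definition ball_mean (W : T -> R) b : R :=
  (fine (\int[mu]_(x in ball_of b) (W x)%:E) / V b)%R.

(** Among the equivalent forms of the [A_infty] condition, the one that says
    how [W] compares with its mean.  The equation asserts that the integral is
    finite, which [ball_mean] alone does not. *)
Definition A_infty (W : T -> R) (c eta : R) : Prop :=
  [/\ measurable_fun [set: T] W, forall x, (0 <= W x)%R &
   forall b, (0 < b.2)%R -> [/\ (0 < ball_mean W b)%R,
     \int[mu]_(x in ball_of b) (W x)%:E = (ball_mean W b * V b)%:E &
     mu (ball_of b `&` [set x | (W x <= c * ball_mean W b)%R]) <= (eta * V b)%:E]].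

Lemma meanE W b (a : R) : (0 < b.2)%R ->
  \int[mu]_(x in ball_of b) (W x)%:E = (a * V b)%:E -> ball_mean W b = a.
Proof.
by move=> b0 I; rewrite /ball_mean I /= mulfK// gt_eqF// (V_gt0 X).
Qed.

Lemma measurable_gt (W : T -> R) (t : R) : measurable_fun [set: T] W ->
  measurable [set x | (t < W x)%R].
Proof.
move=> mW; rewrite (_ : [set x | _] = W @^-1` `]t, +oo[%classic).
  by rewrite -[X in measurable X]setTI; apply: mW.
by apply/seteqP; split => x /=; rewrite in_itv /= andbT.
Qed.

Lemma measurable_le (W : T -> R) (t : R) : measurable_fun [set: T] W ->
  measurable [set x | (W x <= t)%R].
Proof.
move=> mW; rewrite (_ : [set x | _] = ~` [set x | (t < W x)%R]).
  by apply: measurableC; exact: measurable_gt.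
by apply/seteqP; split => x /=; [rewrite leNgt => /negP|move/negP; rewrite -leNgt].
Qed.

Lemma ball_levels (W : T -> R) (t m : R) b : measurable_fun [set: T] W ->
  (0 < b.2)%R -> mu (ball_of b `&` [set x | (W x <= t)%R]) <= m%:E ->
  (V b - m)%:E <= mu (ball_of b `&` [set x | (t < W x)%R]).
Proof.
move=> mW b0; have mb := mball X b.
have mle := measurable_le t mW; have mgt := measurable_gt t mW.
set A := ball_of b `&` [set x | (t < W x)%R].
set B := ball_of b `&` [set x | (W x <= t)%R] => small.
have mA : measurable A by exact: measurableI.
have mB : measurable B by exact: measurableI.
have VAB : (V b)%:E = mu A + mu B.
  rewrite -(mu_ball X b0) -measureU//.
    congr (mu _); apply/seteqP; split => x; last by case=> -[].
    by move=> bx; have [h|h] := leP (W x) t; [right|left].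
  by apply/seteqP; split => // x [[_ /= h1] [_ /= h2]]; move: h1; rewrite ltNge h2.
have Bfin : mu B \is a fin_num.
  by rewrite ge0_fin_numE//; apply: le_lt_trans small _; rewrite ltry.
have Afin : mu A \is a fin_num.
  rewrite ge0_fin_numE//; apply: (@le_lt_trans _ _ (V b)%:E); last by rewrite ltry.
  by rewrite VAB leeDl.
move: VAB small; rewrite -(fineK Afin) -(fineK Bfin) -EFinD => -[VAB].
by rewrite !lee_fin VAB; lra.
Qed.

(** With [eta = (2 * C)^-1] the exceptional part of the doubled ball fills at
    most half of the ball itself, and on the other half [W] exceeds a fraction
    of its mean over the doubled ball. *)
Lemma Ainf_mean_double (W : T -> R) (c : R) b : (0 < c)%R ->
  A_infty W c (2 * C)^-1 -> (0 < b.2)%R ->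
  (ball_mean W (b.1, 2 * b.2) <= 2 / c * ball_mean W b)%R.
Proof.
move=> c0 hW b0; pose b2 := (b.1, 2 * b.2)%R.
have b20 : (0 < b2.2)%R by rewrite mulr_gt0.
have C0 := C_gt0 X; have Vb := V_gt0 X b0.
have [mW W0 h] := hW; have [m20 I2 sm2] := h b2 b20; have [m0 I _] := h b b0.
have mb := mball X b; have mgt := measurable_gt (c * ball_mean W b2) mW.
set A := ball_of b `&` [set x | (c * ball_mean W b2 < W x)%R].
have mA : measurable A by exact: measurableI.
have V2 : (V b2 <= C * V b)%R by exact: (vol_double X).
have mle := measurable_le (c * ball_mean W b2) mW.
have Bhalf : mu (ball_of b `&` [set x | (W x <= c * ball_mean W b2)%R]) <= (V b / 2)%:E.
  apply: le_trans (le_trans _ sm2) _.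
    apply: le_measure; rewrite ?inE.
    - exact: measurableI.
    - by apply: measurableI => //; exact: (mball X).
    by apply: setSI; apply: dball_subr; rewrite /=; lra.
  rewrite lee_fin invfM -mulrA; apply: (@le_trans _ _ (2^-1 * (C^-1 * (C * V b)))%R).
    by rewrite !ler_wpM2l// invr_ge0// ltW.
  by rewrite mulKf ?gt_eqF//; lra.
have Ahalf := ball_levels mW b0 Bhalf.
have Afin : mu A \is a fin_num.
  rewrite ge0_fin_numE//; apply: (@le_lt_trans _ _ (V b)%:E); last by rewrite ltry.
  by rewrite -(mu_ball X b0); apply: le_measure; rewrite ?inE//; exact: subIsetl.
rewrite -/A -(fineK Afin) lee_fin in Ahalf.
have nW := nnmfun_EFin mW W0.
have : (c * ball_mean W b2 * fine (mu A))%:E <= (ball_mean W b * V b)%:E.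
  rewrite -I EFinM fineK// -integral_cst//.
  apply: (@le_trans _ _ (\int[mu]_(x in A) (W x)%:E)).
    apply: nnint_le => //; first by apply: nnmfun_cst; rewrite lee_fin mulr_ge0// ltW.
    by move=> x [_ /= hx]; rewrite lee_fin ltW.
  by apply: nnint_subset => //; exact: subIsetl.
rewrite lee_fin => hh.
have : (c * ball_mean W b2 * (V b - V b / 2) <= ball_mean W b * V b)%R.
  by apply: le_trans hh; rewrite ler_wpM2l// mulr_ge0// ltW.
rewrite (_ : _ * (_ - _) = c * ball_mean W b2 / 2 * V b)%R; last by field.
rewrite ler_pM2r// => h2.
rewrite mulrAC ler_pdivlMr// mulrC; lra.
Qed.

End ReverseHolder.

(** * Outer regularity *)

Section OuterRegularity.
Context d (T : measurableType d) (R : realType) (mu : {measure set T -> \bar R}).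
Context (dist : T -> T -> R) (C : R).
Hypothesis X : doubling_space mu dist C.
Local Notation dopen := (dist_open dist).

Lemma measurable_dist_open (U : set T) : dopen U -> measurable U.
Proof.
move=> oU; rewrite (_ : U = union_pballs dist [set b | (0 < b.2)%R /\ pball dist b `<=` U]).
  exact: measurable_balls_union X _.
apply/seteqP; split => [x /oU[r r0 rU]|x [b [_ bU] /bU//]].
by exists (x, r) => //; exact: (mem_dball X).
Qed.

Lemma dist_open_bigcup (U : nat -> set T) : (forall n, dopen (U n)) ->
  dopen (\bigcup_n U n).
Proof.
move=> oU x [n _ /oU[r r0 rU]]; exists r => // y /rU Uy.
by exists n.
Qed.

Lemma dist_openI (U W : set T) : dopen U -> dopen W -> dopen (U `&` W).
Proof.
move=> oU oW x [/oU[r r0 rU] /oW[s s0 sW]]; exists (Num.min r s)%R.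
  by rewrite lt_min r0.
move=> y; rewrite /dball /= lt_min => /andP[yr ys].
by split; [exact: rU|exact: sW].
Qed.

Lemma dist_open_dball x r : dopen (dball dist x r).
Proof.
move=> y; rewrite /dball /= => yr; exists (r - dist x y)%R; first by rewrite subr_gt0.
by apply: (dball_sub X); lra.
Qed.

Variables (O : set T) (mO : measurable O) (Ofin : mu O < +oo).

(** The approximation is measured inside [O], whose finite measure gives
    continuity from above. *)
Definition open_approx (A : set T) := forall e : R, (0 < e)%R ->
  exists U : set T, [/\ dopen U, A `<=` U & mu (O `&` (U `\` A)) <= e%:E].

Lemma open_approx_open (A : set T) : dopen A -> open_approx A.
Proof.
by move=> oA e e0; exists A; split => //; rewrite setDv setI0 measure0 lee_fin ltW.
Qed.

Lemma open_approx_decreasing (A : set T) (G : nat -> set T) (e : R) :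
  measurable A -> (forall n, dopen (G n)) -> nonincreasing_seq G ->
  mu (O `&` (\bigcap_n G n `\` A)) < e%:E ->
  exists n, mu (O `&` (G n `\` A)) <= e%:E.
Proof.
move=> mA oG ndG small; apply: contrapT => no.
have mG n : measurable (G n) by exact: measurable_dist_open.
pose F n := O `&` (G n `\` A).
have mF n : measurable (F n) by apply: measurableI => //; exact: measurableD.
have FE : \bigcap_n F n = O `&` (\bigcap_n G n `\` A).
  apply/seteqP; split => x.
    move=> h; have [Ox [_ nA]] := h 0%N I; split => //; split => // n _.
    by have [_ []] := h n I.
  by move=> [Ox [Gx nA]] n _; split => //; split => //; exact: Gx.
have mFF : measurable (\bigcap_n F n) by exact: bigcap_measurable.
have F0 : mu (F 0%N) < +oo.
  by apply: le_lt_trans Ofin; apply: le_measure; rewrite ?inE//; exact: subIsetl.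
have ndF : nonincreasing_seq F.
  move=> m n mn; apply/subsetPset; apply: setIS; apply: setSD.
  by apply/subsetPset; exact: ndG.
have cv := nonincreasing_cvg_mu F0 mF mFF ndF.
have : e%:E <= mu (\bigcap_n F n).
  rewrite -(cvg_lim _ cv) //; apply: lime_ge.
    by apply/cvg_ex; eexists; exact: cv.
  apply: nearW => n /=; rewrite leNgt; apply/negP => h; apply: no; exists n.
  exact: ltW.
by rewrite FE leNgt small.
Qed.

(** A closed set is the intersection of its open neighbourhoods
    [{x | dist x (~` A) < n.+1^-1}]. *)
Lemma open_approx_closed (A : set T) : dopen A -> open_approx (~` A).
Proof.
move=> oA e e0; have mA : measurable (~` A).
  by apply: measurableC; exact: measurable_dist_open.
pose G n := [set x | exists2 y, (~` A) y & (dist y x < n.+1%:R^-1)%R].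
have oG n : dopen (G n).
  move=> x [y Ay yx]; have [r r0 rh] := dist_open_dball (x := y) (r := n.+1%:R^-1) yx.
  by exists r => // z /rh zy; exists y.
have ndG : nonincreasing_seq G.
  move=> m n mn; apply/subsetPset => x [y Ay yx]; exists y => //.
  by apply: (lt_le_trans yx); rewrite lef_pV2 ?posrE// ler_nat ltnS.
have [|n hn] := @open_approx_decreasing (~` A) G e mA oG ndG.
  rewrite (_ : _ `&` _ = set0) ?measure0 ?lte_fin//.
  apply/seteqP; split => // x [_ [Gx /contrapT /oA[r r0 rA]]].
  have [n] := ltr_add_invr r0; rewrite add0r => nr.
  have [y Ay yx] := Gx n I; apply: Ay; apply: rA.
  by rewrite /dball /= (dist_symm X); exact: lt_trans nr.
exists (G n); split => // x Ax; exists x => //.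
by rewrite (dist_refl X) invr_gt0.
Qed.

Lemma open_approx_cover (A U : nat -> set T) (e : R) : (0 < e)%R ->
  (forall n, measurable (A n)) -> (forall n, measurable (U n)) ->
  (forall n, mu (O `&` (U n `\` A n)) <= (e / (2 ^ n.+1)%:R)%:E) ->
  forall B, measurable B -> B `<=` \bigcup_n (O `&` (U n `\` A n)) -> mu B <= e%:E.
Proof.
move=> e0 mA mU h B mB BU.
apply: (@le_trans _ _ (\sum_(n <oo) (e / (2 ^ n.+1)%:R)%:E)); last first.
  by apply: epsilon_trick0; exact: ltW.
have mF n : measurable (O `&` (U n `\` A n)) by apply: measurableI => //; exact: measurableD.
have := measure_sigma_subadditive mu mF mB BU => /le_trans; apply.
by apply: lee_nneseries => [n _ _|n _].
Qed.

Lemma open_approx_bigcup (A : nat -> set T) : (forall n, measurable (A n)) ->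
  (forall n, open_approx (A n)) -> open_approx (\bigcup_n A n).
Proof.
move=> mA hA e e0; have ex n : exists U : set T, [/\ dopen U, A n `<=` U &
    mu (O `&` (U `\` A n)) <= (e / (2 ^ n.+1)%:R)%:E].
  by apply: hA; rewrite divr_gt0// ltr0n expn_gt0.
have [U hU] := choice ex.
have oU n : dopen (U n) by case: (hU n).
have mU n : measurable (U n) by exact: measurable_dist_open.
exists (\bigcup_n U n); split; first exact: dist_open_bigcup.
  by move=> x [n _ Ax]; exists n => //; have [_ + _] := hU n; exact.
apply: (open_approx_cover e0 mA mU); first by move=> n; have [] := hU n.
  apply: measurableI => //; apply: measurableD; exact: bigcupT_measurable.
move=> x [Ox [[n _ Ux] nA]]; exists n => //; split => //; split => // Ax.
by apply: nA; exists n.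
Qed.

(** The intersection of open sets around the [A n] is close to that of the
    [A n] but need not be open; its finite stages are open, and one of them is
    close enough by continuity from above. *)
Lemma open_approx_bigcap (A : nat -> set T) : (forall n, measurable (A n)) ->
  (forall n, open_approx (A n)) -> open_approx (\bigcap_n A n).
Proof.
move=> mA hA e e0; have e20 : (0 < e / 2)%R by rewrite divr_gt0.
have ex n : exists U : set T, [/\ dopen U, A n `<=` U &
    mu (O `&` (U `\` A n)) <= (e / 2 / (2 ^ n.+1)%:R)%:E].
  by apply: hA; rewrite divr_gt0// ltr0n expn_gt0.
have [U hU] := choice ex.
have oU n : dopen (U n) by case: (hU n).
have mU n : measurable (U n) by exact: measurable_dist_open.
pose G n := \bigcap_(i in [set i | (i <= n)%N]) U i.
have mcap : measurable (\bigcap_n A n) by exact: bigcap_measurable.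
have oG n : dopen (G n).
  elim: n => [|n ih].
    rewrite /G (_ : bigcap _ _ = U 0%N)//; apply/seteqP; split => x; first exact.
    by move=> Ux i /=; rewrite leqn0 => /eqP ->.
  rewrite /G (_ : bigcap _ _ = G n `&` U n.+1); first exact: dist_openI.
  apply/seteqP; split => x.
    by move=> h; split => [i /= ni|]; apply: h => //=; exact: leqW.
  move=> [h1 h2] i /=; rewrite leq_eqVlt => /predU1P[->//|]; rewrite ltnS; exact: h1.
have ndG : nonincreasing_seq G.
  move=> m n mn; apply/subsetPset => x h i /= im; apply: h => /=.
  exact: leq_trans mn.
have [|n hn] := @open_approx_decreasing (\bigcap_n A n) G e mcap oG ndG.
  apply: (@le_lt_trans _ _ (e / 2)%:E); last by rewrite lte_fin; lra.
  apply: (open_approx_cover e20 mA mU); first by move=> n; have [] := hU n.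
    apply: measurableI => //; apply: measurableD => //.
    by apply: bigcap_measurable => // n _; exact: measurable_dist_open.
  move=> x [Ox [Gx nA]]; apply: contrapT => no; apply: nA => n _.
  apply: contrapT => nAx; apply: no; exists n => //; split => //; split => //.
  by apply: (Gx n) => /=.
exists (G n); split => // x Ax i _; have [_ + _] := hU i; apply.
exact: Ax.
Qed.

(** The sets that are approximable together with their complements form a
    sigma-algebra. *)
Lemma open_approx_generated (A : set T) : <<s (dist_open dist) >> A ->
  measurable A /\ open_approx A.
Proof.
move=> sA; suff : [/\ measurable A, open_approx A & open_approx (~` A)] by case.
pose G : set (set T) := [set A | [/\ measurable A, open_approx A & open_approx (~` A)]].
have : <<s (dist_open dist) >> `<=` G.
  apply: smallest_sub => [|U oU]; last first.
    by split; [exact: measurable_dist_open|exact: open_approx_open|exact: open_approx_closed].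
  split.
  - have o0 : dopen set0 by move=> x [].
    by split => //; [exact: open_approx_open|exact: open_approx_closed].
  - move=> B [mB B1 B2]; rewrite setTD; split => //; first exact: measurableC.
    by rewrite setCK.
  - move=> F hF; have mF n : measurable (F n) by case: (hF n).
    split; first exact: bigcupT_measurable.
      by apply: open_approx_bigcup => // n; case: (hF n).
    rewrite setC_bigcup; apply: open_approx_bigcap => n; last by case: (hF n).
    exact: measurableC.
by apply.
Qed.

End OuterRegularity.

Section OuterRegular.
Context d (T : measurableType d) (R : realType) (mu : {measure set T -> \bar R}).
Context (dist : T -> T -> R) (C : R).
Hypothesis X : doubling_space mu dist C.

Lemma borel_outer_regular :
  (forall N : set T, measurable N -> exists B : set T,
    [/\ <<s (dist_open dist) >> B, N `<=` B & mu B = mu N]) ->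
  outer_regular mu dist.
Proof.
move=> reg N x0 r0 mN NO N0; have [B [sB NB BN]] := reg N mN.
have rpos : (0 < r0)%R.
  rewrite ltNge; apply/negP => rle; have : N = set0.
    apply/seteqP; split => // x /NO; rewrite /dball /= => xr.
    by have := dist_ge0 X x0 x; lra.
  by move=> N00; move: N0; rewrite N00 measure0 ltxx.
set O := dball dist x0 r0 in NO.
have mO : measurable O by exact: (measurable_dball X).
have Ofin : mu O < +oo by exact: (dball_lty X).
have [mB apB] := open_approx_generated X mO Ofin sB.
have Nfin : mu N \is a fin_num.
  rewrite ge0_fin_numE//; apply: le_lt_trans Ofin; apply: le_measure; rewrite ?inE//.
have fN0 : (0 < fine (mu N))%R by rewrite -lte_fin fineK.
have [U [oU BU small]] := apB _ fN0.
have mU := measurable_dist_open X oU.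
exists (O `&` U); split.
- exact: measurableI.
- by apply: dist_openI => //; exact: (dist_open_dball X).
- by move=> x Nx; split; [exact: NO|apply: BU; exact: NB].
rewrite fineK// in small.
apply: (@le_trans _ _ (mu ((O `&` (U `\` B)) `|` B))).
  apply: le_measure; rewrite ?inE//.
  - exact: measurableI.
  - by apply: measurableU => //; apply: measurableI => //; exact: measurableD.
  move=> x [Ox Ux]; have [Bx|nB] := pselect (B x); first by right.
  by left.
apply: (@le_trans _ _ (mu (O `&` (U `\` B)) + mu B)).
  by apply: measureU2 => //; apply: measurableI => //; exact: measurableD.
rewrite BN; apply: le_trans (leeD2r _ small) _.
by rewrite -(fineK Nfin) -EFinM -EFinD lee_fin; lra.
Qed.

End OuterRegular.

(** * The Calderon-Zygmund step *)

Section ReverseHolderMain.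
Context d (T : measurableType d) (R : realType) (mu : {measure set T -> \bar R}).
Context (dist : T -> T -> R) (C : R).
Hypothesis X : doubling_space mu dist C.
Hypothesis oreg : outer_regular mu dist.
Local Notation ball_of := (pball dist).
Local Notation ball3_of := (pball3 dist).
Local Notation balls_union := (union_pballs dist).
Local Notation V b := (vol mu dist b.1 b.2).
Local Notation mean := (ball_mean mu dist).
Local Notation Ainf := (A_infty mu dist).
Implicit Types (b : T * R).

Let kap := ((4 * C ^+ 2)^-1)%R.
Let k0 : (0 < kap)%R. Proof. exact: (kap_gt0 X). Qed.

(** A ball of radius comparable to that of [b] that meets [b] lies in the double
    of [b]: the mean over it is bounded by the mean over [b]. *)
Lemma mean_small (W : T -> R) (c : R) b e x : (0 < c)%R ->
  Ainf W c (2 * C)^-1 -> (0 < b.2)%R -> (0 < e.2)%R ->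
  ball_of b x -> ball_of e x -> (b.2 <= 6 * e.2)%R -> (e.2 <= b.2 / 2)%R ->
  \int[mu]_(x in ball_of e) (W x)%:E <= (C ^+ 5 * (2 / c) * mean W b * V e)%:E.
Proof.
move=> c0 hW b0 e0 bx ex b6 eb; have [mW W0 h] := hW.
have nW := nnmfun_EFin mW W0.
pose b2 := (b.1, 2 * b.2)%R; have b20 : (0 < b2.2)%R by rewrite mulr_gt0.
have [_ I2 _] := h b2 b20; have [m0 _ _] := h b b0.
have C0 := C_gt0 X.
have dxe : (dist b.1 e.1 < b.2 + e.2)%R.
  have := dist_tri X b.1 x e.1; rewrite (dist_symm X x).
  by move: bx ex; rewrite /pball /dball /=; lra.
apply: (@le_trans _ _ (\int[mu]_(x in ball_of b2) (W x)%:E)).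
  apply: nnint_subset => //; [exact: (mball X)|exact: (mball X)|].
  by apply: (dball_sub X); rewrite /=; lra.
rewrite I2 lee_fin; have m2 := Ainf_mean_double X c0 hW b0.
have m20 : (0 <= mean W b2)%R by apply: ltW; have [] := h b2 b20.
apply: (@le_trans _ _ (mean W b2 * (C ^+ 5 * V e))%R).
  apply: ler_wpM2l => //; apply: (vol_compare X) => //.
  by rewrite (dist_symm X) /= (_ : 2 ^+ 5 = 32)%R; [lra|ring].
apply: (@le_trans _ _ (2 / c * mean W b * (C ^+ 5 * V e))%R).
  apply: ler_wpM2r => //; apply: mulr_ge0; first by rewrite exprn_ge0// ltW.
  exact: ltW (V_gt0 X e0).
by rewrite le_eqVlt; apply/orP; left; apply/eqP; ring.
Qed.

(** The Calderon-Zygmund step.  Almost every point of [{W > t}] lies in a small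
    ball on which the mean of [W] is at least [kap * t]; enlarging it until
    that fails gives balls to which the covering lemma applies, and on them [W]
    exceeds a multiple of [t] on half of the measure. *)
Lemma level_estimate (W : T -> R) (c t : R) b : (0 < c)%R ->
  Ainf W c (2 * C)^-1 -> (0 < b.2)%R ->
  (C ^+ 5 * (2 / c) / kap * mean W b < t)%R ->
  \int[mu]_(x in ball_of b `&` [set x | (t < W x)%R]) (W x)%:E <=
  (t / 2)%:E * mu (ball_of (b.1, 2 * b.2)%R `&` [set x | (c * kap * t < W x)%R]).
Proof.
move=> c0 hW b0 tbig; have [mW W0 h] := hW; have nW := nnmfun_EFin mW W0.
have C0 := C_gt0 X; have C1 := doubling_ge1 X.
have [m0 _ _] := h b b0.
have t0 : (0 < t)%R.
  apply: le_lt_trans tbig; rewrite mulr_ge0 ?(ltW m0)// divr_ge0 ?(ltW k0)//.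
  by rewrite mulr_ge0 ?exprn_ge0 ?divr_ge0 ?ltW.
have mb := mball X b; have mb2 := mball X (b.1, 2 * b.2)%R.
have mgt := measurable_gt t mW; have mgt' := measurable_gt (c * kap * t) mW.
set H := ball_of (b.1, 2 * b.2)%R `&` _.
have mH : measurable H by exact: measurableI.
pose fam := [set e | [/\ (0 < e.2)%R, (e.2 < b.2 / 6)%R, ball_of e `&` ball_of b !=set0,
  (kap * t * V e)%:E <= \int[mu]_(x in ball_of e) (W x)%:E &
  \int[mu]_(x in ball3_of e) (W x)%:E <= (kap * t * V (e.1, 3 * e.2)%R)%:E]].
have mU : measurable (balls_union fam) by exact: measurable_balls_union X _.
have r6 : (0 < b.2 / 6)%R by rewrite divr_gt0.
have cov : {ae mu, forall x, (ball_of b `&` [set x | (t < W x)%R]) x -> balls_union fam x}.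
  move: (density X oreg mgt r6); apply: filterS => x hx [bx /= tx].
  have [e [e0 er ex edens]] := hx tx.
  pose e_ j := (e.1, 3 ^+ j * e.2)%R.
  have e_0 j : (0 < (e_ j).2)%R by rewrite mulr_gt0// exprn_gt0.
  have e_x j : ball_of (e_ j) x.
    by apply: dball_subr ex; rewrite /= ler_peMl ?(ltW e0)// exprn_ege1// ler1n.
  pose P j := (kap * t * V (e_ j))%:E <= \int[mu]_(x in ball_of (e_ j)) (W x)%:E.
  have P0 : P 0%N.
    rewrite /P /e_ expr0 mul1r -surjective_pairing.
    have me := mball X e; have meW : measurable (ball_of e `&` [set x | (t < W x)%R]).
      by exact: measurableI.
    apply: (@le_trans _ _ (\int[mu]_(x in ball_of e `&` [set x | (t < W x)%R]) (W x)%:E)).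
      apply: (@le_trans _ _ (\int[mu]_(x in ball_of e `&` [set x | (t < W x)%R]) cst t%:E x)).
        rewrite integral_cst// mulrAC mulrC EFinM; apply: lee_wpmul2l => //.
        by rewrite lee_fin ltW.
      apply: nnint_le => //; first by apply: nnmfun_cst; rewrite lee_fin ltW.
      by move=> y [_ /= ty]; rewrite lee_fin ltW.
    by apply: nnint_subset => //; exact: subIsetl.
  have big : exists j, (b.2 / 6 <= (e_ j).2)%R.
    exists (Num.bound (b.2 / 6 / e.2)); rewrite /= -ler_pdivrMr//.
    apply: le_trans (ltW (archi_boundP _)) _; first by rewrite divr_ge0// ltW.
    by rewrite -natrX ler_nat ltnW// ltn_expl.
  (* once the radius reaches [b.2 / 6] the mean is too small, by [mean_small] *)
  have [J0 [J0P J0min]] : exists J0, (b.2 / 6 <= (e_ J0).2)%R /\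
      forall j, (b.2 / 6 <= (e_ j).2)%R -> (J0 <= j)%N.
    by exists (ex_minn big); case: ex_minnP.
  have nPJ0 : ~ P J0.
    move=> PJ; have Jle : ((e_ J0).2 <= b.2 / 2)%R.
      case: J0 J0P J0min {PJ} => [|J] JP Jmin; first by move: JP er; rewrite /= expr0 mul1r; lra.
      have : ((e_ J).2 < b.2 / 6)%R by rewrite ltNge; apply/negP => /Jmin; rewrite ltnn.
      by rewrite /= exprS -mulrA; lra.
    have J6 : (b.2 <= 6 * (e_ J0).2)%R by move: J0P; lra.
    have small := mean_small c0 hW b0 (e_0 J0) bx (e_x J0) J6 Jle.
    have := le_trans PJ small; rewrite lee_fin leNgt => /negP; apply.
    rewrite ltr_pM2r ?(V_gt0 X)//; move: tbig.
    by rewrite mulrAC ltr_pdivrMr// [(t * _)%R]mulrC.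
  (* the stopping radius: the first triple on which the mean falls below
     [kap * t]; it comes before [J0] *)
  have failing : exists j, ~~ `[< P j >] by exists J0; apply/asboolPn.
  have [J [JP Jmin]] : exists J, ~ P J /\ forall j, ~ P j -> (J <= j)%N.
    exists (ex_minn failing); case: ex_minnP => m /asboolPn mP mmin.
    by split => // j /asboolPn; exact: mmin.
  case: J JP Jmin => [|J] JP Jmin; first by case: JP.
  have PJ : P J by apply: contrapT => /Jmin; rewrite ltnn.
  have eJ : ((e_ J).2 < b.2 / 6)%R.
    rewrite ltNge; apply/negP => /J0min J0J.
    by have := leq_trans (Jmin _ nPJ0) J0J; rewrite ltnn.
  exists (e_ J); last exact: e_x.
  split => //; first by exists x.
  move/negP: JP; rewrite -ltNge => /ltW.
  by rewrite /pball3 /P /e_ exprS /= mulrA.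
have nh : nnmfun (cst (t / 2)%:E : T -> \bar R).
  by apply: nnmfun_cst; rewrite lee_fin ltW// divr_gt0.
have mbt : measurable (ball_of b `&` [set x | (t < W x)%R]) by exact: measurableI.
apply: (@le_trans _ _ (\int[mu]_(x in balls_union fam `&` setT) (W x)%:E)).
  rewrite setIT integral_mkcond [leRHS]integral_mkcond.
  apply: nnint_ae_le => //; [exact: nnmfun_restrict|exact: nnmfun_restrict|].
  move: cov; apply: filterS => x hx _; rewrite {1}/patch; case: ifPn => [|_].
    by rewrite inE => /hx ux; rewrite /patch mem_set.
  by apply: erestrict_ge0 => y _; rewrite lee_fin.
apply: (@le_trans _ _ (\int[mu]_(x in balls_union fam `&` H) cst (t / 2)%:E x)); last first.
  rewrite integral_cst; last by exact: measurableI.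
  apply: lee_wpmul2l; first by rewrite lee_fin ltW// divr_gt0.
  by apply: le_measure; rewrite ?inE//; exact: measurableI.
apply: (covering X nW nh measurableT mH); first by move=> e [].
move=> e [e0 er [x [ex bx]] elow ehigh]; rewrite setIT.
have me := mball X e; have Ve := V_gt0 X e0.
have meH : measurable (ball_of e `&` H) by exact: measurableI.
have [me0 Ie esmall] := h e e0.
have half : (V e / 2)%:E <= mu (ball_of e `&` H).
  have esm : mu (ball_of e `&` [set x | (W x <= c * mean W e)%R]) <= (V e / 2)%:E.
    apply: (le_trans esmall); rewrite lee_fin mulrC ler_wpM2l ?(ltW Ve)//.
    by rewrite lef_pV2 ?posrE//; lra.
  have mge := measurable_gt (c * mean W e) mW.
  apply: le_trans (_ : (V e - V e / 2)%:E <= _); first by rewrite lee_fin; lra.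
  apply: (le_trans (ball_levels X mW e0 esm)).
  apply: le_measure; rewrite ?inE//; first exact: measurableI.
  move=> y [ey /= Wy]; split => //; split.
    move: ey ex bx; rewrite /pball /dball /= => ey ex bx.
    have := dist_tri X b.1 x y; have := dist_tri X x e.1 y.
    by rewrite (dist_symm X x e.1); lra.
  apply: le_lt_trans Wy; rewrite -mulrA ler_wpM2l ?(ltW c0)//.
  by move: elow; rewrite Ie lee_fin ler_pM2r.
rewrite integral_cst//; apply: (le_trans ehigh).
apply: (@le_trans _ _ ((t / 2)%:E * (V e / 2)%:E)); last first.
  by apply: lee_wpmul2l => //; rewrite lee_fin ltW// divr_gt0.
rewrite -EFinM lee_fin; apply: (@le_trans _ _ (kap * t * (C ^+ 2 * V e))%R).
  by apply: ler_wpM2l; [rewrite mulr_ge0 ?ltW|exact: (vol_3 X)].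
rewrite (_ : kap * t * (C ^+ 2 * V e) = kap * C ^+ 2 * t * V e)%R; last by ring.
by rewrite (kapC X) le_eqVlt; apply/orP; left; apply/eqP; field.
Qed.

End ReverseHolderMain.

(** * Reverse Holder inequality *)

Section SelfImprovement.
Context d (T : measurableType d) (R : realType) (mu : {measure set T -> \bar R}).
Context (dist : T -> T -> R) (C : R).
Hypothesis X : doubling_space mu dist C.
Hypothesis oreg : outer_regular mu dist.
Local Notation ball_of := (pball dist).
Local Notation V b := (vol mu dist b.1 b.2).
Local Notation mean := (ball_mean mu dist).
Local Notation Ainf := (A_infty mu dist).
Implicit Types (b : T * R).

(** The increments of [level tau k `^ e] between consecutive levels are
    [(2 `^ e - 1) * level tau k `^ e]. *)
Lemma levels_telescope (v tau e : R) n : (0 <= v)%R -> (0 < tau)%R -> (0 < e)%R ->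
  (v <= level tau n)%R ->
  (v `^ e <= tau `^ e + \sum_(k < n) (2 `^ e - 1) *
     (if level tau k < v then level tau k `^ e else 0))%R.
Proof.
move=> v0 t0 e0 vn.
suff h m : ((Num.min v (level tau m)) `^ e <= tau `^ e + \sum_(k < m) (2 `^ e - 1) *
     (if level tau k < v then level tau k `^ e else 0))%R.
  by have := h n; rewrite (min_idPl vn).
elim: m => [|m ih].
  rewrite big_ord0 addr0 {1}/level expr0 mul1r; apply: powR_le; first exact: ltW.
    by rewrite le_min v0 ltW.
  by rewrite ge_min lexx orbT.
rewrite big_ord_recr /= addrA; have lm := level_gt0 m t0.
have [mv|vm] := ltP (level tau m) v.
  rewrite (min_idPr (ltW mv)) in ih.
  apply: (@le_trans _ _ (level tau m.+1 `^ e))%R.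
    apply: powR_le; [exact: ltW| |by rewrite ge_min lexx orbT].
    by rewrite le_min v0 ltW// level_gt0.
  rewrite levelS powRM ?(ltW lm)//; lra.
rewrite mulr0 addr0; apply: le_trans ih; apply: powR_le; first exact: ltW.
  by rewrite le_min v0 ltW// level_gt0.
by rewrite (min_idPl vm) ge_min lexx.
Qed.

(** In [W `^ (1 + e) = W `^ e * W], expand [W `^ e] over the dyadic levels above
    a multiple of the mean.  Each level contributes the integral of [W] over a
    superlevel set, which [level_estimate] bounds by the measure of a lower
    superlevel set in the doubled ball; summing these measures gives back
    [W `^ (1 + e)].  The gain is the factor [2 `^ e - 1] of the increments,
    small when [e] is.  The bound [N] keeps the expansion finite; no constant
    depends on it. *)
Lemma gehring_step (c : R) : (0 < c)%R -> (c <= 1)%R ->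
  exists K D : R, [/\ (1 <= K)%R, (0 < D)%R & forall (W : T -> R) (N : R) b (e : R),
    Ainf W c (2 * C)^-1 -> (forall x, (W x <= N)%R) -> (0 < b.2)%R ->
    (0 < e)%R -> (e <= 1)%R ->
    \int[mu]_(x in ball_of b) (W x `^ (1 + e))%:E <=
    (K * mean W b `^ (1 + e) * V b)%:E + ((2 `^ e - 1) * D)%:E *
      \int[mu]_(x in ball_of (b.1, 2 * b.2)%R) (W x `^ (1 + e))%:E].
Proof.
move=> c0 c1; have C0 := C_gt0 X; have C1 := doubling_ge1 X.
pose kap := ((4 * C ^+ 2)^-1)%R; have k0 : (0 < kap)%R by exact: (kap_gt0 X).
have k1 : (kap <= 1)%R.
  rewrite invf_le1; last by rewrite -invr_gt0.
  by have := exprn_ege1 2 C1; lra.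
pose K := (C ^+ 5 * (2 / c) / kap + 1)%R.
have K1 : (1 <= K)%R.
  rewrite lerDr divr_ge0 ?(ltW k0)//; apply: mulr_ge0; first by rewrite exprn_ge0// ltW.
  by rewrite divr_ge0// ltW.
have ck0 : (0 < c * kap)%R by rewrite mulr_gt0.
have ck1 : (c * kap <= 1)%R by rewrite mulr_ile1// ltW.
exists K, (2 / (c * kap) ^+ 2)%R; split => //; first by rewrite divr_gt0// exprn_gt0.
move=> W N b e hW WN b0 e0 e1; have [mW W0 h] := hW; have [m0 I _] := h b b0.
have nW := nnmfun_EFin mW W0.
have ep0 : (0 < 1 + e)%R by lra.
have nWe : nnmfun (fun x => (W x `^ (1 + e))%:E).
  by rewrite (_ : (fun x => _) = (fun x => (EFin \o W) x `^ (1 + e)))//; exact: nnmfun_pow.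
have mb := mball X b; pose b2 := (b.1, 2 * b.2)%R; have mb2 := mball X b2.
pose a := mean W b; pose tau := (K * a)%R.
have t0 : (0 < tau)%R by rewrite mulr_gt0//; lra.
have [n nN] := level_unbounded N t0.
pose q := (2 `^ e - 1)%R; have q0 : (0 < q)%R by rewrite subr_gt0; exact: powR2_gt1.
pose S k := [set x | (level tau k < W x)%R].
have mS k : measurable (S k) by exact: measurable_gt.
have lv0 k : (0 < level tau k)%R by exact: level_gt0.
have ql k : (0 <= q * level tau k `^ e)%R by rewrite mulr_ge0 ?powR_ge0// ltW.
have nWS k : nnmfun ((EFin \o W) \_ (S k)) by exact: nnmfun_restrict.
have nterm k : nnmfun (fun x => (q * level tau k `^ e)%:E * ((EFin \o W) \_ (S k)) x).
  by apply: (nnmfunM (nnmfun_cst T _) (nWS k)); rewrite lee_fin.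
have nsum (f : nat -> T -> \bar R) m : (forall k, nnmfun (f k)) ->
    nnmfun (fun x => \sum_(k < m) f k x).
  move=> nf; split; last by move=> x; apply: sume_ge0 => k _; exact: (nf k).2.
  by apply: emeasurable_sum => k; exact: (nf k).1.
have intsum (f : nat -> T -> \bar R) m (A : set T) : measurable A -> (forall k, nnmfun (f k)) ->
    \int[mu]_(x in A) (\sum_(k < m) f k x) = \sum_(k < m) \int[mu]_(x in A) f k x.
  move=> mA nf; have mf (k : 'I_m) : measurable_fun A (f k).
    by apply: measurable_funTS; exact: (nf k).1.
  have f0 (k : 'I_m) x : A x -> 0 <= f k x by move=> _; exact: (nf k).2.
  exact: (ge0_integral_sum mu mA mf f0).
have ntau : nnmfun (fun x => (tau `^ e)%:E * (W x)%:E).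
  by apply: (nnmfunM (nnmfun_cst T _) nW); rewrite lee_fin powR_ge0.
apply: (@le_trans _ _ (\int[mu]_(x in ball_of b) ((tau `^ e)%:E * (W x)%:E +
   \sum_(k < n) (q * level tau k `^ e)%:E * ((EFin \o W) \_ (S k)) x))).
  apply: nnint_le => //; first by apply: nnmfunD => //; exact: (nsum _ n nterm).
  move=> x _; rewrite (eq_bigr (fun k : 'I_n => (q *
      (if level tau k < W x then level tau k `^ e else 0) * W x)%:E)%R); last first.
    move=> k _; rewrite /patch; have -> : (x \in S k) = (level tau k < W x)%R.
      by apply/idP/idP; rewrite inE.
    by case: ifP => _; rewrite ?mule0 ?mulr0 ?mul0r// -EFinM.
  rewrite sumEFin -EFinM -EFinD lee_fin -mulr_suml -mulrDl.
  have := levels_telescope (W0 x) t0 e0 (le_trans (WN x) nN).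
  move=> /(ler_wpM2r (W0 x)); apply: le_trans.
  have [W00|Wx] := eqVneq (W x) 0%R; first by rewrite W00 mulr0 powR0// gt_eqF.
  by rewrite addrC powRD ?powRr1//; apply/implyP.
rewrite nnintD//; last exact: (nsum _ n nterm).
rewrite (intsum _ n _ mb nterm) nnintZl// ?lee_fin ?powR_ge0// I -/a.
apply: leeD.
  rewrite -EFinM lee_fin mulrA ler_pM2r ?(V_gt0 X)// /tau powRM ?(ltW m0)//; last by lra.
  rewrite -mulrA; apply: ler_pM; rewrite ?powR_ge0//.
  - by rewrite mulr_ge0 ?powR_ge0// ltW.
  - by apply: ler1_powR.
  by rewrite addrC powRD ?powRr1 ?(ltW m0)//; apply/implyP => _; rewrite gt_eqF.
pose H k := [set x | (c * kap * level tau k < W x)%R].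
have mH k : measurable (H k) by exact: measurable_gt.
have nH k : nnmfun ((cst 1 : T -> \bar R) \_ (H k)).
  by apply: nnmfun_restrict => //; exact: nnmfun_cst.
have nH' k : nnmfun (fun x => (q / 2 * level tau k `^ (1 + e))%:E * ((cst 1 : T -> \bar R) \_ (H k)) x).
  by apply: (nnmfunM (nnmfun_cst T _) (nH k)); rewrite lee_fin mulr_ge0 ?powR_ge0// divr_ge0// ltW.
apply: (@le_trans _ _ (\int[mu]_(x in ball_of b2) (\sum_(k < n)
    (q / 2 * level tau k `^ (1 + e))%:E * ((cst 1 : T -> \bar R) \_ (H k)) x))).
  rewrite (intsum _ n _ mb2 nH').
  apply: lee_sum => k _; rewrite !nnintZl ?lee_fin//; last first.
    by rewrite mulr_ge0 ?powR_ge0// divr_ge0// ltW.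
  rewrite -integral_mkcondr -[X in _ <= _ * X]integral_mkcondr integral_cst; last exact: measurableI.
  rewrite mul1e.
  have tk : (C ^+ 5 * (2 / c) / kap * mean W b < level tau k)%R.
    apply: (@lt_le_trans _ _ tau); first by rewrite /tau ltr_pM2r// /K ltrDl.
    by rewrite /level ler_peMl ?(ltW t0)// exprn_ege1// ler1n.
  apply: le_trans (lee_wpmul2l _ (level_estimate X oreg c0 hW b0 tk)) _.
    by rewrite lee_fin.
  rewrite muleA -EFinM; apply: lee_wpmul2r => //.
  rewrite lee_fin addrC powRD; last by apply/implyP => _; rewrite gt_eqF.
  by rewrite powRr1 ?(ltW (lv0 k))// le_eqVlt; apply/orP; left; apply/eqP; field.
rewrite -nnintZl//; last by rewrite lee_fin mulr_ge0 ?divr_ge0// ?ltW// exprn_gt0.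
apply: nnint_le => //; first exact: (nsum _ n nH').
  apply: (nnmfunM (nnmfun_cst T _) nWe).
  by rewrite lee_fin mulr_ge0 ?divr_ge0// ?ltW// exprn_gt0.
move=> x _; pose tau' := (c * kap * tau)%R; have t'0 : (0 < tau')%R by rewrite mulr_gt0.
have lE k : (c * kap * level tau k = level tau' k)%R by rewrite /level /tau'; ring.
rewrite (eq_bigr (fun k : 'I_n => (q / 2 * (c * kap) `^ (- (1 + e)) *
    (if level tau' k < W x then level tau' k `^ (1 + e) else 0))%:E)%R); last first.
  move=> k _; rewrite /patch; have -> : (x \in H k) = (level tau' k < W x)%R.
    by rewrite -lE; apply/idP/idP; rewrite inE.
  case: ifP => _; rewrite ?mule0 ?mulr0// mule1 -lE.
  rewrite [((c * kap * _) `^ _)%R]powRM ?(ltW ck0) ?(ltW (lv0 k))//.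
  congr (_%:E); rewrite powRN; field.
  by rewrite gt_eqF// powR_gt0.
rewrite sumEFin -mulr_sumr -EFinM lee_fin.
have := sum_levels_below n ep0 t'0 (W0 x).
move=> /(ler_wpM2l (_ : 0 <= q / 2 * (c * kap) `^ (- (1 + e)))%R) hs.
apply: le_trans (hs _) _; first by rewrite mulr_ge0 ?powR_ge0// divr_ge0// ltW.
rewrite [((2 * W x) `^ _)%R]powRM// !mulrA; apply: ler_wpM2r; first exact: powR_ge0.
rewrite -/q -!mulrA; apply: ler_wpM2l; first exact: ltW.
have h1 : ((c * kap) `^ (- (1 + e)) <= (c * kap)^-1 ^+ 2)%R.
  rewrite powRN exprVn lef_pV2 ?posrE ?powR_gt0 ?exprn_gt0//.
  rewrite -powR_mulrn ?(ltW ck0)//; apply: ger_powR; rewrite ?ck0//.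
  by rewrite (_ : 2%:R = 1 + 1)%R ?lerD2l.
have h2 : ((2 `^ (1 + e) - 1)^-1 <= 1 :> R)%R.
  rewrite invf_le1 ?subr_gt0 ?powR2_gt1//.
  have : (2 `^ 1 <= 2 `^ (1 + e) :> R)%R by apply: ler_powR; rewrite ?ler1n// lerDl ltW.
  by rewrite powRr1//; lra.
have h3 : (2 `^ (1 + e) <= 4 :> R)%R.
  have -> : (4 = 2 `^ (1 + 1) :> R)%R.
    by rewrite powRD ?powRr1//; [ring|apply/implyP => _; rewrite pnatr_eq0].
  by apply: ler_powR; rewrite ?ler1n// lerD2l.
have z1 : (0 <= (c * kap) `^ (- (1 + e)))%R by exact: powR_ge0.
have z2 : (0 <= (2 `^ (1 + e) - 1)^-1 :> R)%R by rewrite invr_ge0 subr_ge0 ltW// powR2_gt1.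
have z3 : (0 <= 2 `^ (1 + e) :> R)%R by exact: powR_ge0.
have h23 : ((2 `^ (1 + e) - 1)^-1 * 2 `^ (1 + e) <= 1 * 4 :> R)%R by apply: ler_pM.
have := ler_pM z1 (mulr_ge0 z2 z3) h1 h23; rewrite exprVn; lra.
Qed.

End SelfImprovement.

Section ReverseHolderFinal.
Context d (T : measurableType d) (R : realType) (mu : {measure set T -> \bar R}).
Context (dist : T -> T -> R) (C : R).
Hypothesis X : doubling_space mu dist C.
Hypothesis oreg : outer_regular mu dist.
Local Notation ball_of := (pball dist).
Local Notation V b := (vol mu dist b.1 b.2).
Local Notation mean := (ball_mean mu dist).
Local Notation Ainf := (A_infty mu dist).
Implicit Types (b : T * R).

Lemma small_exponent (delta : R) : (0 < delta)%R ->
  exists e0 : R, [/\ (0 < e0)%R, (e0 <= 1)%R &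
    forall e, (0 < e)%R -> (e <= e0)%R -> (2 `^ e - 1 <= delta)%R].
Proof.
move=> d0; have ln20 : (0 < ln 2 :> R)%R by rewrite ln_gt0// ltr1n.
have lnd : (0 < ln (1 + delta))%R by rewrite ln_gt0// ltrDl.
exists (Num.min 1 (ln (1 + delta) / ln 2))%R; split.
- by rewrite lt_min ltr01 divr_gt0.
- by rewrite ge_min lexx.
move=> e e0 ele; rewrite lerBlDl.
have e1 : (e <= ln (1 + delta) / ln 2)%R by apply: (le_trans ele); rewrite ge_min lexx orbT.
rewrite /powR pnatr_eq0 /= -[leRHS]lnK; last by rewrite posrE; lra.
by rewrite ler_expR -ler_pdivlMr.
Qed.

(** Starting from the trivial constant of a bounded weight, [gehring_step]
    improves any constant [S] to [K1 + S / 2], because the doubled ball has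
    comparable mean and volume; hence the weight satisfies the inequality with
    [2 * K1 + 1], whatever its bounds. *)
Lemma bounded_reverse_holder (c : R) : (0 < c)%R -> (c <= 1)%R ->
  exists e0 K : R, [/\ (0 < e0)%R, (e0 <= 1)%R, (0 < K)%R &
    forall (W : T -> R) (lo N e : R) b, Ainf W c (2 * C)^-1 -> (0 < lo)%R ->
    (forall x, (lo <= W x)%R) -> (forall x, (W x <= N)%R) -> (0 < e)%R ->
    (e <= e0)%R -> (0 < b.2)%R ->
    \int[mu]_(x in ball_of b) (W x `^ (1 + e))%:E <=
    (K * mean W b `^ (1 + e) * V b)%:E].
Proof.
move=> c0 c1; have C0 := C_gt0 X; have C1 := doubling_ge1 X.
have [K1 [D [K11 D0 step]]] := gehring_step X oreg c0 c1.
have c2 : (1 <= 2 / c)%R by rewrite ler_pdivlMr// mul1r; lra.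
have c20 : (0 < 2 / c)%R by rewrite divr_gt0.
(* the cost of passing from the doubled ball back to the ball *)
pose A := (D * (2 / c) ^+ 2 * C)%R; have A0 : (0 < A)%R by apply: mulr_gt0 => //; apply: mulr_gt0 => //; rewrite exprn_gt0.
have dA : (0 < (2 * A)^-1)%R by rewrite invr_gt0 mulr_gt0.
have [e0 [e00 e01 small]] := small_exponent dA.
exists e0, (2 * K1 + 1)%R; split => //; first by lra.
move=> W lo N e b hW lo0 loW WN ep ee b0; have [mW W0 h] := hW.
have nW := nnmfun_EFin mW W0.
have e1 : (0 < 1 + e)%R by lra.
have q0 : (0 <= 2 `^ e - 1 :> R)%R by rewrite subr_ge0 ltW// powR2_gt1.
pose P S := forall b, (0 < b.2)%R -> \int[mu]_(x in ball_of b) (W x `^ (1 + e))%:E <=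
    (S * mean W b `^ (1 + e) * V b)%:E.
have N0 : (0 < N)%R by apply: lt_le_trans lo0 (le_trans (loW point) (WN point)).
have nWe : nnmfun (fun x => (W x `^ (1 + e))%:E).
  by rewrite (_ : (fun x => _) = (fun x => (EFin \o W) x `^ (1 + e)))//; exact: nnmfun_pow.
have improve S : (0 <= S)%R -> P S -> P (K1 + S / 2)%R.
  move=> S0 PS a a0; pose a2 := (a.1, 2 * a.2)%R.
  have a20 : (0 < a2.2)%R by rewrite mulr_gt0.
  have Va := V_gt0 X a0; have [m0 _ _] := h a a0; have [m20 _ _] := h a2 a20.
  apply: le_trans (step W N a e hW WN a0 ep (le_trans ee e01)) _.
  apply: le_trans (leeD2l _ (lee_wpmul2l _ (PS a2 a20))) _.
    by rewrite lee_fin mulr_ge0// ltW.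
  rewrite -EFinM -EFinD lee_fin.
  have m2 : (mean W a2 `^ (1 + e) <= (2 / c) ^+ 2 * mean W a `^ (1 + e))%R.
    apply: (@le_trans _ _ ((2 / c * mean W a) `^ (1 + e)))%R.
      by apply: powR_le; [exact: ltW|exact: ltW|exact: (Ainf_mean_double X c0 hW a0)].
    rewrite powRM ?(ltW m0) ?(ltW c20)//; apply: ler_wpM2r; first exact: powR_ge0.
    rewrite -powR_mulrn ?(ltW c20)//; apply: ler_powR => //.
    by rewrite (_ : 2%:R = 1 + 1)%R// lerD2l (le_trans ee).
  have V2 : (V a2 <= C * V a)%R by exact: (vol_double X).
  set Z := (mean W a `^ (1 + e))%R in m2 *.
  have Z0 : (0 <= Z)%R by exact: powR_ge0.
  have mV : (mean W a2 `^ (1 + e) * V a2 <= (2 / c) ^+ 2 * Z * (C * V a))%R.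
    by apply: ler_pM => //; [exact: powR_ge0|rewrite ltW// (V_gt0 X)].
  have : ((2 `^ e - 1) * D * (S * mean W a2 `^ (1 + e) * V a2) <=
      (2 * A)^-1 * D * (S * ((2 / c) ^+ 2 * Z * (C * V a))))%R.
    apply: ler_pM; rewrite ?mulr_ge0 ?powR_ge0 ?(ltW D0) ?(ltW (V_gt0 X a20))//.
      by rewrite ler_pM2r//; exact: small.
    by rewrite -[X in (X <= _)%R]mulrA ler_wpM2l.
  move=> /(lerD (lexx (K1 * Z * V a))%R) /le_trans; apply.
  rewrite le_eqVlt; apply/orP; left; apply/eqP; rewrite /A; field.
  by rewrite !gt_eqF.
have N_lo : (0 < N / lo)%R by rewrite divr_gt0.
pose S0 := ((N / lo) `^ (1 + e))%R; have S00 : (0 < S0)%R by rewrite powR_gt0.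
have PS0 : P S0.
  move=> a a0; have Va := V_gt0 X a0; have ma := mball X a; have [m0 I _] := h a a0.
  have lom : (lo <= mean W a)%R.
    rewrite -(ler_pM2r Va) -lee_fin -I EFinM -(mu_ball X a0) -integral_cst//.
    apply: nnint_le => //; first by apply: nnmfun_cst; rewrite lee_fin ltW.
    by move=> x _; rewrite lee_fin.
  apply: (@le_trans _ _ (\int[mu]_(x in ball_of a) cst (N `^ (1 + e))%:E x)).
    apply: nnint_le => //; first by apply: nnmfun_cst; rewrite lee_fin powR_ge0.
    by move=> x _; rewrite lee_fin; apply: powR_le => //; exact: ltW.
  rewrite integral_cst// (mu_ball X a0) -EFinM lee_fin ler_pM2r//.
  rewrite /S0 -powRM ?(ltW N_lo) ?(ltW m0)//; apply: powR_le; [exact: ltW|exact: ltW|].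
  rewrite -mulrA ler_peMr ?(ltW N0)// mulrC ler_pdivlMr// mul1r//.
have PSm m : P (2 * K1 + S0 / 2 ^+ m)%R.
  elim: m => [|m ih].
    move=> a a0; apply: le_trans (PS0 a a0) _; rewrite lee_fin expr0 divr1.
    rewrite ler_wpM2r ?(ltW (V_gt0 X a0))// ler_wpM2r ?powR_ge0// lerDr mulr_ge0//; lra.
  have -> : (2 * K1 + S0 / 2 ^+ m.+1 = K1 + (2 * K1 + S0 / 2 ^+ m) / 2)%R.
    by rewrite exprS; field; rewrite expf_neq0.
  apply: improve ih; apply: addr_ge0; first by rewrite mulr_ge0//; lra.
  by rewrite divr_ge0 ?exprn_ge0 ?ltW.
have [m hm] := level_unbounded S0 ltr01.
apply: le_trans (PSm m b b0) _; rewrite lee_fin.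
rewrite ler_wpM2r ?(ltW (V_gt0 X b0))// ler_wpM2r ?powR_ge0// lerD2l.
by rewrite ler_pdivrMr ?exprn_gt0// mul1r; move: hm; rewrite /level mulr1.
Qed.

(** The mean of the truncation is at most [N] and at most [mean W b + lo], hence
    at most twice the larger of [mean W b] and [lo].  Where the truncation falls
    below [c / 2] of its mean, [W] therefore falls below [c] of its own mean. *)
Lemma Ainf_truncate (W : T -> R) (c eta lo N : R) : (0 < c)%R -> (c <= 1)%R ->
  Ainf W c eta -> (0 < lo)%R -> (lo <= N)%R ->
  Ainf (fun x => Num.min (Num.max (W x) lo) N)%R (c / 2) eta.
Proof.
move=> c0 c1 [mW W0 h] lo0 loN.
set U := fun x => _; have mU : measurable_fun [set: T] U.
  by apply: measurable_minr => //; apply: measurable_maxr.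
have loU x : (lo <= U x)%R by rewrite le_min loN le_max lexx orbT.
have UN x : (U x <= N)%R by rewrite ge_min lexx orbT.
have U0 x : (0 <= U x)%R by apply: le_trans (loU x); exact: ltW.
have nU := nnmfun_EFin mU U0; have nW := nnmfun_EFin mW W0.
have N0 : (0 < N)%R by exact: lt_le_trans loN.
split=> // b b0; have [m0 I small] := h b b0.
have Vb := V_gt0 X b0; have mb := mball X b; have muE := mu_ball X b0.
have IN : \int[mu]_(x in ball_of b) (U x)%:E <= (N * V b)%:E.
  rewrite EFinM -muE -integral_cst//; apply: nnint_le => //.
    by apply: nnmfun_cst; rewrite lee_fin ltW.
  by move=> x _; rewrite lee_fin.
have IW : \int[mu]_(x in ball_of b) (U x)%:E <= ((mean W b + lo) * V b)%:E.
  rewrite mulrDl EFinD -I [(lo * _)%:E]EFinM -muE -integral_cst// -nnintD//; last first.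
    by apply: nnmfun_cst; rewrite lee_fin ltW.
  apply: nnint_le => //; first by apply: nnmfunD => //; apply: nnmfun_cst; rewrite lee_fin ltW.
  move=> x _; rewrite -EFinD lee_fin /U ge_min; apply/orP; left.
  by rewrite ge_max lerDl lerDr W0 (ltW lo0).
have Ilo : (lo * V b)%:E <= \int[mu]_(x in ball_of b) (U x)%:E.
  rewrite EFinM -muE -integral_cst//; apply: nnint_le => //.
    by apply: nnmfun_cst; rewrite lee_fin ltW.
  by move=> x _; rewrite lee_fin.
have IU : \int[mu]_(x in ball_of b) (U x)%:E = (mean U b * V b)%:E.
  rewrite /ball_mean divfK ?gt_eqF// fineK// ge0_fin_numE ?nnint_ge0//.
  by apply: le_lt_trans IN _; rewrite ltry.
rewrite IU !lee_fin !ler_pM2r// in IN IW Ilo.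
split => //; first exact: lt_le_trans Ilo.
apply: le_trans small; apply: le_measure; rewrite ?inE.
- by apply: measurableI => //; exact: measurable_le.
- by apply: measurableI => //; exact: measurable_le.
apply: setIS => x /= Ux; rewrite leNgt; apply/negP => Wx; move: Ux; apply/negP.
rewrite -ltNge /U lt_min; apply/andP; split; last first.
  by apply: le_lt_trans (ler_wpM2l _ IN) _; [lra|rewrite gtr_pMl//; lra].
rewrite lt_max; have [loW|Wlo] := leP lo (mean W b).
  apply/orP; left; apply: le_lt_trans Wx; rewrite -mulrA ler_pM2l//; lra.
apply/orP; right; apply: (@le_lt_trans _ _ (2^-1 * mean U b))%R; last by lra.
by rewrite ler_wpM2r//; lra.
Qed.

(** The constants for bounded weights do not depend on the bounds, so the lower
    truncation level may be the mean over the ball in question, which at most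
    doubles the mean, while the upper one tends to infinity. *)
Lemma reverse_holder (W : T -> R) (c : R) : (0 < c)%R -> (c <= 1)%R ->
  Ainf W c (2 * C)^-1 ->
  exists e0 K : R, [/\ (0 < e0)%R, (e0 <= 1)%R, (0 < K)%R &
    forall (e : R) b, (0 < e)%R -> (e <= e0)%R -> (0 < b.2)%R ->
    \int[mu]_(x in ball_of b) (W x `^ (1 + e))%:E <=
    (K * mean W b `^ (1 + e) * V b)%:E].
Proof.
move=> c0 c1 hW; have [mW W0 h] := hW; have nW := nnmfun_EFin mW W0.
have c20 : (0 < c / 2)%R by rewrite divr_gt0.
have c21 : (c / 2 <= 1)%R by lra.
have [e0 [K [e00 e01 K0 rh]]] := bounded_reverse_holder c20 c21.
exists e0, (K * 4)%R; split => //; first by rewrite mulr_gt0.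
move=> e b ep ee b0; have [m0 I _] := h b b0.
have Vb := V_gt0 X b0; have mb := mball X b.
have e1 : (0 < 1 + e)%R by lra.
set a := mean W b in m0 I *.
pose U n x := (Num.min (Num.max (W x) a) (a + n%:R))%R.
have aN n : (a <= a + n%:R)%R by rewrite lerDl ler0n.
have AU n : Ainf (U n) (c / 2) (2 * C)^-1 by exact: Ainf_truncate.
have aU n x : (a <= U n x)%R by rewrite le_min aN le_max lexx orbT.
have U0 n x : (0 <= U n x)%R by apply: le_trans (aU n x); exact: ltW.
have mU n : measurable_fun [set: T] (U n) by case: (AU n).
have nU n : nnmfun (EFin \o U n) by exact: nnmfun_EFin.
have npow (u : T -> R) : nnmfun (EFin \o u) -> nnmfun (fun x => (u x `^ (1 + e))%:E).
  by move=> nu; rewrite (_ : (fun x => _) = (fun x => (EFin \o u) x `^ (1 + e)))//; exact: nnmfun_pow.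
have mean2 n : (mean (U n) b <= 2 * a)%R.
  have [_ _ /(_ b b0)[_ IU _]] := AU n.
  rewrite -(ler_pM2r Vb) -lee_fin -IU (_ : 2 * a * V b = a * V b + a * V b)%R; last by ring.
  have na : nnmfun (cst a%:E : T -> \bar R) by apply: nnmfun_cst; rewrite lee_fin ltW.
  rewrite EFinD -{1}I EFinM -(mu_ball X b0) -integral_cst// -nnintD//.
  apply: nnint_le => //; [exact: nU|exact: (nnmfunD nW na)|].
  move=> x _; rewrite -EFinD lee_fin /U ge_min; apply/orP; left.
  by rewrite ge_max lerDl lerDr W0 (ltW m0).
apply: (@le_trans _ _ (\int[mu]_(x in ball_of b)
    ereal_sup (range (fun n => (U n x `^ (1 + e))%:E)))).
  apply: nnint_le => //; first exact: npow.
    by apply: nnmfun_sup => n; exact: npow.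
  move=> x _; apply: (@le_trans _ _ (U (Num.bound (W x)) x `^ (1 + e))%:E); last first.
    by apply: ereal_sup_ubound; exists (Num.bound (W x)).
  rewrite lee_fin; apply: powR_le => //; first exact: ltW.
  rewrite le_min le_max lexx /=; apply: (le_trans (ltW (archi_boundP (W0 x)))).
  by rewrite lerDr ltW.
rewrite nnint_sup//; last 2 first.
- by move=> n; exact: npow.
- move=> x m n mn; rewrite lee_fin; apply: powR_le => //; first exact: ltW.
  by rewrite le_min ge_min lexx /= ge_min lerD2l ler_nat mn orbT.
apply: ge_ereal_sup => _ [n _ <-].
apply: le_trans (rh (U n) a (a + n%:R)%R e b (AU n) m0 (aU n) _ ep ee b0) _.
  by move=> x; rewrite ge_min lexx orbT.
rewrite lee_fin ler_pM2r// -mulrA ler_pM2l//.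
have [_ _ /(_ b b0)[mn0 _ _]] := AU n.
apply: (@le_trans _ _ ((2 * a) `^ (1 + e)))%R.
  by apply: powR_le; [exact: ltW|exact: ltW|].
rewrite powRM ?(ltW m0)//; apply: ler_wpM2r; first exact: powR_ge0.
have -> : (4 = 2 `^ (1 + 1) :> R)%R.
  by rewrite powRD ?powRr1//; [ring|apply/implyP => _; rewrite pnatr_eq0].
by apply: ler_powR; rewrite ?ler1n// lerD2l; exact: le_trans e01.
Qed.

(** Where [u] is at most a small fraction of its mean, [u `^ (- s^-1)] is large
    compared with its own mean, by the [A_p] bound; that set is therefore
    small. *)
Lemma Ap_Ainf (u : T -> R) (s Q eta : R) : (0 < s)%R -> (0 < Q)%R -> (0 < eta)%R ->
  measurable_fun [set: T] u -> (forall x, (0 < u x)%R) ->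
  (forall b, (0 < b.2)%R -> exists al be : R, [/\ (0 < al)%R, (0 < be)%R,
    \int[mu]_(x in ball_of b) (u x)%:E = (al * V b)%:E,
    \int[mu]_(x in ball_of b) (u x `^ (- s^-1))%:E = (be * V b)%:E &
    (al * be `^ s <= Q)%R]) ->
  exists c : R, [/\ (0 < c)%R, (c <= 1)%R & Ainf u c eta].
Proof.
move=> s0 Q0 eta0 mu_ u0 uAp.
have nu : nnmfun (EFin \o u) by apply: nnmfun_EFin => // x; exact: ltW.
have nv : nnmfun (fun x => (u x `^ (- s^-1))%:E).
  by rewrite (_ : (fun x => _) = (fun x => (EFin \o u) x `^ (- s^-1)))//; exact: nnmfun_pow.
pose c := (Num.min 1 (eta `^ s / Q))%R.
have c0 : (0 < c)%R by rewrite lt_min ltr01 divr_gt0// powR_gt0.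
exists c; split => //; first by rewrite ge_min lexx.
split => [//|x|b b0]; first exact: ltW.
have [al [be [al0 be0 Iu Iv abQ]]] := uAp b b0.
have ME := meanE X b0 Iu; rewrite ME; split => //.
have Vb := V_gt0 X b0; have mb := mball X b.
set F := ball_of b `&` _; have mF : measurable F.
  by apply: measurableI => //; exact: measurable_le.
have ca0 : (0 < c * al)%R by rewrite mulr_gt0.
have big : ((c * al) `^ (- s^-1))%:E * mu F <= (be * V b)%:E.
  rewrite -integral_cst// -Iv.
  apply: (@le_trans _ _ (\int[mu]_(x in F) (u x `^ (- s^-1))%:E)).
    apply: nnint_le => //; first by apply: nnmfun_cst; rewrite lee_fin powR_ge0.
    move=> x [_ /= ux]; rewrite lee_fin !powRN lef_pV2 ?posrE ?powR_gt0//.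
    by apply: powR_le => //; [rewrite invr_ge0 ltW|exact: ltW].
  by apply: nnint_subset => //; exact: subIsetl.
have Ffin : mu F \is a fin_num.
  rewrite ge0_fin_numE//; apply: (@le_lt_trans _ _ (V b)%:E); last by rewrite ltry.
  by rewrite -(mu_ball X b0); apply: le_measure; rewrite ?inE//; exact: subIsetl.
move: big; rewrite -(fineK Ffin) -EFinM !lee_fin powRN mulrC ler_pdivrMr ?powR_gt0//.
move=> /le_trans; apply; rewrite mulrAC ler_pM2r//.
have cQ : (c * Q <= eta `^ s)%R.
  by rewrite -ler_pdivlMr// ge_min lexx orbT.
have : ((be `^ s * (c * al)) `^ s^-1 <= (eta `^ s) `^ s^-1)%R.
  apply: powR_le; first by rewrite invr_ge0 ltW.
    by rewrite mulr_ge0 ?powR_ge0// ltW.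
  by apply: le_trans cQ; rewrite mulrCA ler_pM2l// mulrC.
rewrite powRM ?powR_ge0 ?(ltW ca0)// -!powRrM mulfV ?gt_eqF// !powRr1 ?(ltW be0) ?(ltW eta0)//.
Qed.

End ReverseHolderFinal.

(** * Self-improvement of weights *)

Section SelfImprovementOfWeights.
Context d (T : measurableType d) (R : realType) (mu : {measure set T -> \bar R}).
Context (dist : T -> T -> R) (C : R).
Hypothesis X : doubling_space mu dist C.
Local Notation ball_of := (pball dist).
Local Notation V b := (vol mu dist b.1 b.2).
Local Notation M := (maxfun mu dist).
Implicit Types (b : T * R).

Lemma nnmfun_powR (u : T -> R) (a : R) : measurable_fun [set: T] u ->
  (forall x, (0 <= u x)%R) -> nnmfun (fun x => (u x `^ a)%:E).
Proof.
move=> mu_ u0; rewrite (_ : (fun x => _) = (fun x => (EFin \o u) x `^ a))//.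
by apply: nnmfun_pow; exact: nnmfun_EFin.
Qed.

Lemma Ap_pair_restrict (E : set T) (u v : T -> R) (s Q : R) : measurable E ->
  nnmfun (EFin \o u) -> nnmfun (EFin \o v) ->
  Ap_pair mu dist [set: T] u v s Q -> Ap_pair mu dist E u v s Q.
Proof.
move=> mE nu nv h b b0; have [al [be [al0 be0 hu hv abQ]]] := h b b0.
have mb := mball X b; have mbE : measurable (ball_of b `&` E) by exact: measurableI.
exists al, be; split => //.
  by apply: le_trans hu; apply: nnint_subset => //; [rewrite setIT|exact: setIS].
by apply: le_trans hv; apply: nnint_subset => //; [rewrite setIT|exact: setIS].
Qed.

Lemma product_finite (x y : \bar R) (s Q : R) : (0 < s)%R -> 0 < x -> 0 < y ->
  x * y `^ s <= Q%:E -> exists al be : R,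
  [/\ (0 < al)%R, (0 < be)%R, x = al%:E, y = be%:E & (al * be `^ s <= Q)%R].
Proof.
move=> s0; case: x => [al| |]//; case: y => [be| |]//.
- by rewrite !lte_fin poweR_EFin -EFinM lee_fin => al0 be0 h; exists al, be.
- by rewrite lte_fin => al0 _; rewrite poweRyr ?gt_eqF// mulry gtr0_sg// mul1e leye_eq.
- by move=> _ be0; rewrite gt0_mulye ?poweR_gt0// leye_eq.
- by move=> _ _; rewrite poweRyr ?gt_eqF// mulyy leye_eq.
Qed.

(** Positive functions have positive averages over a set of positive measure,
    and neither average can be infinite while the other is positive. *)
Lemma Ap_bound_finite (E : set T) (u v : T -> R) (s Q : R) b : (0 < s)%R ->
  measurable E ->
  nnmfun (EFin \o u) -> nnmfun (EFin \o v) ->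
  (forall x, (0 < u x)%R) -> (forall x, (0 < v x)%R) ->
  (0 < b.2)%R -> 0 < mu (ball_of b `&` E) ->
  (V b)^-1%:E * \int[mu]_(x in ball_of b `&` E) (u x)%:E *
    ((V b)^-1%:E * \int[mu]_(x in ball_of b `&` E) (v x)%:E) `^ s <= Q%:E ->
  exists al be : R, [/\ (0 < al)%R, (0 < be)%R,
    \int[mu]_(x in ball_of b `&` E) (u x)%:E = (al * V b)%:E,
    \int[mu]_(x in ball_of b `&` E) (v x)%:E = (be * V b)%:E &
    (al * be `^ s <= Q)%R].
Proof.
move=> s0 mE nu nv u0 v0 b0 bE0 hQ; have Vb := V_gt0 X b0.
have mb := mball X b; have mbE : measurable (ball_of b `&` E) by exact: measurableI.
have pos (w : T -> R) : nnmfun (EFin \o w) -> (forall x, (0 < w x)%R) ->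
    0 < (V b)^-1%:E * \int[mu]_(x in ball_of b `&` E) (w x)%:E.
  move=> nw w0; rewrite mule_gt0 ?lte_fin ?invr_gt0//.
  by apply: (nnint_gt0 mbE nw bE0); apply: aeW => x _ /=; rewrite lte_fin.
have pu := pos u nu u0; have pv := pos v nv v0.
have back (I : \bar R) (a : R) : (V b)^-1%:E * I = a%:E -> I = (a * V b)%:E.
  move=> h; rewrite EFinM -h muleAC -EFinM mulVf ?gt_eqF// mul1e.
  by [].
have [al [be [al0 be0 xE yE abQ]]] := product_finite s0 pu pv hQ.
by exists al, be; split => //; exact: back.
Qed.

Lemma Ap_bound_pair (E : set T) (u v : T -> R) (s Q : R) : (0 < s)%R ->
  (0 < Q)%R -> measurable E ->
  nnmfun (EFin \o u) -> nnmfun (EFin \o v) ->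
  (forall x, (0 < u x)%R) -> (forall x, (0 < v x)%R) ->
  (forall b, (0 < b.2)%R ->
  (V b)^-1%:E * \int[mu]_(x in ball_of b `&` E) (u x)%:E *
    ((V b)^-1%:E * \int[mu]_(x in ball_of b `&` E) (v x)%:E) `^ s <= Q%:E) ->
  Ap_pair mu dist E u v s Q.
Proof.
move=> s0 Q0 mE nu nv u0 v0 h b b0; have Vb := V_gt0 X b0.
have mb := mball X b; have mbE : measurable (ball_of b `&` E) by exact: measurableI.
have [bE0|] := ltP 0 (mu (ball_of b `&` E)).
  have [al [be [al0 be0 -> -> abQ]]] :=
    Ap_bound_finite s0 mE nu nv u0 v0 b0 bE0 (h b b0).
  by exists al, be; split => //; exact: ltW.
rewrite measure_le0 => /eqP bE0.
have zero (w : T -> R) : nnmfun (EFin \o w) -> \int[mu]_(x in ball_of b `&` E) (w x)%:E = 0.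
  move=> [mw w0]; rewrite -(integral_abs_eq0 mbE (measurable_funTS mw) bE0).
  by apply: eq_integral => x _; rewrite gee0_abs//; exact: w0.
exists 0%R, 1%R; rewrite !zero// mul0r; split => //.
- by rewrite lee_fin mul1r ltW.
- by rewrite mul0r ltW.
Qed.

Lemma Ap_pair_bound (E : set T) (u v : T -> R) (s Q : R) b : (0 < s)%R ->
  nnmfun (EFin \o u) -> nnmfun (EFin \o v) ->
  Ap_pair mu dist E u v s Q -> (0 < b.2)%R ->
  (V b)^-1%:E * \int[mu]_(x in ball_of b `&` E) (u x)%:E *
    ((V b)^-1%:E * \int[mu]_(x in ball_of b `&` E) (v x)%:E) `^ s <= Q%:E.
Proof.
move=> s0 nu nv h b0; have [al [be [al0 be0 hu hv abQ]]] := h b b0.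
have Vb := V_gt0 X b0.
have le (I : \bar R) (a : R) : I <= (a * V b)%:E -> (V b)^-1%:E * I <= a%:E.
  by move=> hI; rewrite lee_pdivrMl// -EFinM mulrC.
apply: (@le_trans _ _ (al%:E * be%:E `^ s)); last by rewrite poweR_EFin -EFinM lee_fin.
have Vge : 0 <= (V b)^-1%:E by rewrite lee_fin invr_ge0 ltW.
apply: lee_pmul.
- by rewrite mule_ge0// nnint_ge0.
- exact: poweR_ge0.
- exact: le.
by apply: poweR_le; [exact: ltW|rewrite mule_ge0// nnint_ge0|exact: le].
Qed.

Hypothesis oreg : outer_regular mu dist.

(** [W `^ (- s^-1)] satisfies the dual condition, with [s^-1] in place of [s];
    the reverse Holder inequalities for both weights, with a common exponent,
    are multiplied. *)
Lemma Ap_self_improvement (W : T -> R) (s Q : R) : (0 < s)%R -> (0 < Q)%R ->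
  measurable_fun [set: T] W -> (forall x, (0 < W x)%R) ->
  (forall b, (0 < b.2)%R ->
  (V b)^-1%:E * \int[mu]_(x in ball_of b) (W x)%:E *
    ((V b)^-1%:E * \int[mu]_(x in ball_of b) (W x `^ (- s^-1))%:E) `^ s <= Q%:E) ->
  exists e Q' : R, (0 < e)%R /\
  Ap_pair mu dist [set: T] (fun x => W x `^ (1 + e))%R
    (fun x => W x `^ (- ((1 + e) / s)))%R s Q'.
Proof.
move=> s0 Q0 mW W0 hQ; have C0 := C_gt0 X.
have eta0 : (0 < (2 * C)^-1)%R by rewrite invr_gt0 mulr_gt0.
have W0' x : (0 <= W x)%R by exact: ltW.
have nW : nnmfun (EFin \o W) by exact: nnmfun_EFin.
pose S x := (W x `^ (- s^-1))%R.
have S0 x : (0 < S x)%R by rewrite powR_gt0.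
have nS : nnmfun (EFin \o S) by exact: nnmfun_powR.
have mS : measurable_fun [set: T] S by apply/measurable_EFinP; exact: nS.1.
have dat b : (0 < b.2)%R -> exists al be : R, [/\ (0 < al)%R, (0 < be)%R,
    \int[mu]_(x in ball_of b) (W x)%:E = (al * V b)%:E,
    \int[mu]_(x in ball_of b) (S x)%:E = (be * V b)%:E & (al * be `^ s <= Q)%R].
  move=> b0; have := @Ap_bound_finite [set: T] W S s Q b s0 measurableT nW nS W0 S0 b0.
  rewrite !setIT; apply; last exact: hQ.
  by rewrite (mu_ball X b0) lte_fin (V_gt0 X).
have [c1 [c10 c11 A1]] := Ap_Ainf X s0 Q0 eta0 mW W0 dat.
have sV0 : (0 < s^-1)%R by rewrite invr_gt0.
have SK x : (S x `^ (- s^-1^-1) = W x)%R.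
  by rewrite /S -powRrM mulrNN invrK mulVf ?gt_eqF// powRr1.
have [c2 [c20 c21 A2]] : exists c : R, [/\ (0 < c)%R, (c <= 1)%R & A_infty mu dist S c (2 * C)^-1].
  apply: (@Ap_Ainf _ _ _ mu dist C X S s^-1 (Q `^ s^-1)) => //; first by rewrite powR_gt0.
  move=> b b0; have [al [be [al0 be0 Iu Iv abQ]]] := dat b b0.
  exists be, al; split => //.
    by under eq_integral do rewrite SK.
  rewrite -[X in (X * _)%R](@powRr1 _ be) ?(ltW be0)// -{1}(@mulfV _ s) ?gt_eqF//.
  rewrite powRrM -powRM ?powR_ge0 ?(ltW al0)//; apply: powR_le; first by rewrite ltW.
    by rewrite mulr_ge0 ?powR_ge0// ltW.
  by rewrite mulrC.
have [e1 [K1 [e10 e11 K10 rh1]]] := reverse_holder X oreg c10 c11 A1.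
have [e2 [K2 [e20 e21 K20 rh2]]] := reverse_holder X oreg c20 c21 A2.
pose e := Num.min e1 e2; have e0 : (0 < e)%R by rewrite lt_min e10.
have ee1 : (e <= e1)%R by rewrite ge_min lexx.
have ee2 : (e <= e2)%R by rewrite ge_min lexx orbT.
exists e, (K1 * K2 `^ s * Q `^ (1 + e))%R; split => //.
move=> b b0; have [al [be [al0 be0 Iu Iv abQ]]] := dat b b0.
have h1 := rh1 e b e0 ee1 b0; have h2 := rh2 e b e0 ee2 b0.
rewrite (meanE X b0 Iu) in h1; rewrite (meanE X b0 Iv) in h2.
exists (K1 * al `^ (1 + e))%R, (K2 * be `^ (1 + e))%R; rewrite !setIT; split => //.
- by rewrite mulr_ge0 ?powR_ge0// ltW.
- by rewrite mulr_gt0// powR_gt0.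
- move: h2; rewrite /S; under eq_integral do rewrite -powRrM.
  by rewrite mulNr [(s^-1 * _)%R]mulrC.
rewrite powRM ?(ltW K20) ?powR_ge0// powRAC.
rewrite (_ : _ * _ = K1 * K2 `^ s * (al `^ (1 + e) * (be `^ s) `^ (1 + e)))%R; last by ring.
rewrite -powRM ?powR_ge0 ?(ltW al0)//; apply: ler_wpM2l.
  by rewrite mulr_ge0 ?powR_ge0// ltW.
apply: powR_le => //; first by lra.
by rewrite mulr_ge0 ?powR_ge0// ltW.
Qed.

(** In the [A_infty] condition for an [A_1] weight the exceptional set is
    null. *)
Lemma A1_self_improvement (W : T -> R) (c : R) : (0 < c)%R ->
  A1_weight mu dist W c ->
  exists e c' : R, [/\ (0 < e)%R, (0 < c')%R & forall b, (0 < b.2)%R ->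
    exists a : R, \int[mu]_(x in ball_of b) (W x `^ (1 + e))%:E <= (a * V b)%:E /\
    {ae mu, forall x, ball_of b x -> (a <= c' * W x `^ (1 + e))%R}].
Proof.
move=> c0 [mW W0 h]; have C0 := C_gt0 X.
pose k := (Num.min 1 (2 * c)^-1)%R.
have k0 : (0 < k)%R by rewrite lt_min ltr01 invr_gt0 mulr_gt0.
have k1 : (k <= 1)%R by rewrite ge_min lexx.
have kc : (c * k <= 2^-1)%R.
  have : (k <= (2 * c)^-1)%R by rewrite ge_min lexx orbT.
  by move=> /(ler_wpM2l (ltW c0)) /le_trans; apply; rewrite invfM mulrCA mulfV ?gt_eqF// mulr1.
have A : A_infty mu dist W k (2 * C)^-1.
  split => // b b0; have [a [a0 I ha]] := h b b0.
  rewrite (meanE X b0 I); split => //.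
  have mF : measurable (ball_of b `&` [set x | (W x <= k * a)%R]).
    by apply: measurableI; [exact: (mball X)|exact: measurable_le].
  suff -> : mu (ball_of b `&` [set x | (W x <= k * a)%R]) = 0.
    by rewrite lee_fin mulr_ge0 ?invr_ge0 ?mulr_ge0 ?ltW// (V_gt0 X).
  apply/(negligibleP mu mF); move: ha; apply: negligibleS => x /= [bx Wx] hx.
  have := hx bx; apply/negP; rewrite -ltNge.
  apply: (@le_lt_trans _ _ (2^-1 * a))%R; last by lra.
  apply: (@le_trans _ _ (c * (k * a)))%R; first by rewrite ler_pM2l.
  by rewrite mulrA ler_pM2r.
have [e [K [e0 e1 K0 rh]]] := reverse_holder X oreg k0 k1 A.
exists e, (K * c `^ (1 + e))%R; split => //; first by rewrite mulr_gt0// powR_gt0.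
move=> b b0; have [a [a0 I ha]] := h b b0.
exists (K * a `^ (1 + e))%R; split.
  by have := rh e b e0 (lexx e) b0; rewrite (meanE X b0 I).
move: ha; apply: filterS => x hx bx; rewrite -mulrA ler_pM2l//.
rewrite -powRM ?(ltW c0)//; apply: powR_le; [lra|exact: ltW|exact: hx].
Qed.

(** Countably many balls control the maximal function, so that null sets that
    depend on the ball can be collected. *)
Lemma maxfun_ae_le (E : set T) (g : T -> \bar R) (K : R) : measurable E ->
  nnmfun g -> (0 <= K)%R ->
  (forall b, (0 < b.2)%R -> {ae mu, forall x, ball_of b x -> E x -> avg mu dist E g b <= K%:E * g x}) ->
  {ae mu, forall x, E x -> M E g x <= (C ^+ 2 * K)%:E * g x}.
Proof.
move=> mE ng K0 h; have [ctr hctr] := separable X.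
have C20 : (0 <= C ^+ 2)%R by rewrite exprn_ge0// ltW// (C_gt0 X).
pose bb (n : nat) : T * R := if @unpickle (nat * rat)%type n is Some (i, q)
  then (ctr i, ratr q) else (point, 1%R).
have ae n : {ae mu, forall x, (0 < (bb n).2)%R -> ball_of (bb n) x -> E x ->
    avg mu dist E g (bb n) <= K%:E * g x}.
  have [b0|b0] := ltP 0%R (bb n).2.
    by have := h (bb n) b0; apply: filterS => x hx _.
  by apply: aeW => x.
have := ae_foralln ae; apply: filterS => x hx Ex.
apply: ge_ereal_sup => _ [b [b0 bx] <-].
have [i hi] := hctr b.1 b.2 b0.
have b23 : (2 * b.2 < 3 * b.2)%R by lra.
have [q] := rat_in_itvoo b23.
rewrite in_itv /= => /andP[q2 q3].
pose n := pickle (i, q); have bn : bb n = (ctr i, ratr q) by rewrite /bb /n pickleK.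
have n0 : (0 < (bb n).2)%R by rewrite bn /=; apply: lt_trans q2; rewrite mulr_gt0.
have sub : ball_of b `<=` ball_of (bb n).
  by rewrite bn; apply: (dball_sub X) => /=; lra.
have Vn : (V (bb n) <= C ^+ 2 * V b)%R.
  apply: (vol_compare X) => //; rewrite bn /= (dist_symm X).
  by rewrite (_ : 2 ^+ 2 = 4)%R; [lra|ring].
have Vb := V_gt0 X b0; have Vn0 := V_gt0 X n0.
have mb := mball X b; have mbn := mball X (bb n).
apply: (@le_trans _ _ ((C ^+ 2)%:E * avg mu dist E g (bb n))); last first.
  rewrite [(_ * K)%:E]EFinM -[leRHS]muleA; apply: lee_wpmul2l; first by rewrite lee_fin.
  by apply: hx => //; exact: sub.
rewrite /avg lee_pdivrMl// muleA -EFinM muleA -EFinM.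
apply: (@le_trans _ _ (\int[mu]_(x in ball_of (bb n) `&` E) g x)).
  by apply: nnint_subset => //; [exact: measurableI|exact: measurableI|exact: setSI].
apply: lee_pemull; first exact: nnint_ge0.
by rewrite lee_fin ler_pdivlMr// mul1r mulrC.
Qed.

End SelfImprovementOfWeights.

(** * Caratheodory measurable sets and the two weight classes *)

Section Bridge.
Context (R : realType) (X : completeMetricType R).
Variable mu : {outer_measure set X -> \bar R}.
Hypothesis mu_regular : borel_regular mu.
Hypothesis mu_doubling : doubling mu.

Let T := caratheodory_type mu.
Let m : {measure set T -> \bar R} := mu_cara mu.
Let dist : T -> T -> R := fun x y => @mdist R X x y.

Lemma dball_ball (x : X) (r : R) : dball dist x r = ball x r.
Proof. by rewrite ballEmdist. Qed.

Lemma open_dist_open (U : set X) : open U <-> dist_open dist U.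
Proof.
rewrite openE; split.
  move=> oU x /oU; rewrite /interior /= -nbhs_ballE => -[r /= r0 rU].
  by exists r => // y; rewrite dball_ball => /rU.
move=> oU x /oU[r r0 rU]; rewrite /interior /= -nbhs_ballE.
by exists r => //= y; rewrite -dball_ball => /rU.
Qed.

Lemma open_ball_metric (x : X) (r : R) : open (ball x r).
Proof.
apply/open_dist_open => y; rewrite -dball_ball /dball /= => yr.
exists (r - dist x y)%R; first by rewrite subr_gt0.
move=> z; rewrite /dball /= => zr.
by have := @metric_triangle R X x y z; move: zr; rewrite /dist; lra.
Qed.

Lemma doubling_space_cara : exists C : R, doubling_space m dist C.
Proof.
have [Cd [C1 hC]] := mu_doubling; exists Cd; split.
- by move=> x; exact: mdistxx.
- by move=> x y; exact: metric_sym.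
- by move=> x y z; exact: metric_triangle.
- by move=> x r; rewrite dball_ball; apply: mu_regular.1; exact: open_ball_metric.
- exact: ltW.
- move=> x r r0; have r20 : (0 < r / 2)%R by rewrite divr_gt0.
  have [h _ _] := hC x (r / 2)%R r20.
  by rewrite dball_ball; move: h; rewrite mulrC divfK.
- move=> x r r0; have [_ _ h] := hC x r r0; rewrite dball_ball.
  apply: le_lt_trans h; apply: lee_pemull; first exact: outer_measure_ge0.
  by rewrite lee_fin ltW.
- by move=> x r r0; rewrite !dball_ball; have [_ h _] := hC x r r0.
Qed.

(** Borel regularity enters here. *)
Lemma outer_regular_cara (C : R) : doubling_space m dist C -> outer_regular m dist.
Proof.
move=> Xd; apply: (borel_outer_regular Xd) => N mN.
have [B [sB NB BN]] := mu_regular.2 N; exists B; split => //.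
suff -> : dist_open dist = (open : set (set X)) by [].
by apply/seteqP; split => U /open_dist_open.
Qed.

Lemma compact_in_ball (K : set X) : compact K ->
  measurable (K : set T) /\ exists x : X, exists2 r : R, (0 < r)%R & K `<=` ball x r.
Proof.
move=> cK; split.
  rewrite -(setCK K); apply: (@measurableC _ T); apply: mu_regular.1.
  by apply: closed_openC; apply: compact_closed cK; exact: metric_hausdorff.
exists (point : X); have [C Xd] := doubling_space_cara.
move: cK; rewrite compact_cover => cK.
have [] := cK nat setT (fun n => ball (point : X) n.+1%:R).
- by move=> n _; exact: open_ball_metric.
- move=> x _; have : [set: T] x by [].
  rewrite -(bigcup_balls Xd (point : X)) => -[n _]; rewrite /pball /= dball_ball => xn.
  by exists n.
move=> D _ KD; pose D' : seq nat := finmap.enum_fset D.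
(* a radius larger than those of the finite subcover *)
exists (\sum_(i <- D') i.+1%:R + 1)%R.
  by rewrite ltr_wpDl// sumr_ge0.
move=> x /KD[i /= iD xi]; apply: le_ball xi.
apply: (@le_trans _ _ (\sum_(i <- D') i.+1%:R)%R); last by rewrite lerDl.
rewrite (big_rem i)//= lerDl sumr_ge0//.
Qed.

Lemma weight_onT (W : X -> R) : measurable_fun [set: T] W ->
  (forall x, (0 <= W x)%R) -> {ae m, forall x : T, (0 < W x)%R} ->
  (forall b : T * R, (0 < b.2)%R -> \int[m]_(x in pball dist b) (W x)%:E < +oo) ->
  weight_on mu [set: X] W.
Proof.
move=> mW W0 Wpos Wfin; split => //; last first.
  by move: Wpos; apply: filterS => x Wx _.
split => // K _ /compact_in_ball[mK [x [r r0 Kr]]].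
have nW : nnmfun (EFin \o (W : T -> R)) by exact: nnmfun_EFin.
have [C Xd] := doubling_space_cara.
apply/integrableP; split; first exact: measurable_funTS nW.1.
under eq_integral do rewrite gee0_abs ?lee_fin//.
apply: le_lt_trans (Wfin (x, r) r0).
apply: (@nnint_subset _ T R m) => //; first exact: (mball Xd).
by rewrite /pball /= dball_ball.
Qed.

(** Positivity and measurability everywhere make all real powers of the weight
    well behaved on the whole space; the integrals over subsets of [E] are
    those of [w]. *)
Lemma positive_version (E : set T) (w : T -> R) : measurable E ->
  measurable_fun E w -> {ae m, forall x, E x -> (0 < w x)%R} ->
  exists u : T -> R, [/\ measurable_fun [set: T] u, forall x, (0 < u x)%R &
    {ae m, forall x, E x -> w x = u x}].
Proof.
move=> mE mw wpos.
pose f : T -> \bar R := (EFin \o w) \_ E.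
have mf : measurable_fun [set: T] f.
  by apply/(measurable_restrictT _ mE); exact/measurable_EFinP.
have mff : measurable_fun [set: T] (fine \o f) by exact: measurableT_comp.
exists (fun x => if (0 < fine (f x))%R then fine (f x) else 1%R); split.
- apply: measurable_fun_ifT => //; exact: measurable_fun_ltr.
- by move=> x; case: ifP.
- move: wpos; apply: filterS => x wx Ex.
  by rewrite /f /patch mem_set//= wx.
Qed.

Lemma normalized_integralE (b : T * R) (A : set X) (f : X -> R) :
  normalized_integral mu (ball (b.1 : X) b.2) A f =
  (vol m dist b.1 b.2)^-1%:E * \int[m]_(x in A) (f x)%:E.
Proof. by rewrite /normalized_integral -dball_ball. Qed.

Lemma sup_balls_bounded (F : set X -> \bar R) :
  ereal_sup [set F B | B in @balls R X] < +oo ->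
  exists2 Q : R, (0 < Q)%R & forall b : T * R, (0 < b.2)%R -> F (pball dist b) <= Q%:E.
Proof.
set z := ereal_sup _ => zoo.
have Fz (b : T * R) : (0 < b.2)%R -> F (pball dist b) <= z.
  move=> b0; apply: ereal_sup_ubound; exists (pball dist b) => //.
  by exists b.1, b.2; split => //; rewrite -dball_ball.
move: zoo Fz; case: z => [q| |]// _ Fz.
  exists (Num.max q 1)%R; first by rewrite lt_max ltr01 orbT.
  by move=> b /Fz /le_trans; apply; rewrite lee_fin le_max lexx.
by exists 1%R => // b /Fz /le_trans; apply; rewrite leNye.
Qed.

Lemma balls_bounded_sup (F : set X -> \bar R) (Q : R) :
  (forall b : T * R, (0 < b.2)%R -> F (pball dist b) <= Q%:E) ->
  ereal_sup [set F B | B in @balls R X] < +oo.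
Proof.
move=> h; apply: (@le_lt_trans _ _ Q%:E); last by rewrite ltry.
apply: ge_ereal_sup => _ [B [x [r [r0 ->]]] <-].
by have := h (x, r) r0; rewrite /pball /= dball_ball.
Qed.

Lemma dual_powR (y a : R) : (0 <= y)%R -> ((1 / y) `^ (1 / a) = y `^ (- a^-1))%R.
Proof. by move=> y0; rewrite !div1r -powR_inv1// -powRrM mulN1r. Qed.

Lemma measurable_fun_powR (A : set T) (f : T -> R) (a : R) :
  measurable_fun A f -> measurable_fun A (fun x => f x `^ a)%R.
Proof. by move=> mf; exact: (measurableT_comp (measurable_powR a)). Qed.

Lemma ae_integral_powR (A E : set T) (w u : T -> R) (a : R) : measurable A ->
  A `<=` E -> measurable E -> measurable_fun E w -> measurable_fun [set: T] u ->
  {ae m, forall x, E x -> w x = u x} ->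
  \int[m]_(x in A) (w x `^ a)%:E = \int[m]_(x in A) (u x `^ a)%:E.
Proof.
move=> mA AE mE mw mu_ wu; apply: (@ae_eq_integral _ T R m A) => //.
- by apply/measurable_EFinP; apply: measurable_fun_powR; exact: (measurable_funS mE AE mw).
- by apply/measurable_EFinP; apply: measurable_fun_powR; exact: measurable_funTS.
- by move: wu; apply: filterS => x h Ax; rewrite h//; exact: AE.
Qed.

Variables (E : set X) (mE : mu.-cara.-measurable E) (E_gt0 : 0 < mu E).
Variables (w : X -> R) (w_weight : weight_on mu E w).

Let mw : measurable_fun (E : set T) (w : T -> R).
Proof. by case: w_weight => _ []. Qed.

Let wpos : {ae m, forall x : T, E x -> (0 < w x)%R}.
Proof. by case: w_weight. Qed.

Lemma Ap_restriction_holds (p : R) : (1 < p)%R ->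
  (exists W : X -> R, Ap_class mu p W /\
     {ae mu_cara mu, forall x, E x -> W x = w x}) ->
  exists e : R, (0 < e)%R /\
     ereal_sup [set normalized_integral mu B (B `&` E)
                      (fun x => w x `^ (1 + e))%R *
                    normalized_integral mu B (B `&` E)
                      (fun x => (1 / w x `^ (1 + e)) `^ (1 / (p - 1)))%R
                      `^ (p - 1)
               | B in @balls R X] < +oo.
Proof.
move=> p1 [W [[[W0 [mW _] Wpos] supW] WE]].
have {}WE : {ae m, forall x : T, E x -> W x = w x} := WE.
have s0 : (0 < p - 1)%R by rewrite subr_gt0.
have [C Xd] := doubling_space_cara; have oreg := outer_regular_cara Xd.
have mTT : measurable [set: T] by [].
have [u [mu_ u0 Wu]] := positive_version mTT mW Wpos.
have u0' x : (0 <= u x)%R by exact: ltW.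
have [Q Q0 hQ] := sup_balls_bounded supW.
have hu (b : T * R) : (0 < b.2)%R ->
    (vol m dist b.1 b.2)^-1%:E * \int[m]_(x in pball dist b) (u x)%:E *
    ((vol m dist b.1 b.2)^-1%:E * \int[m]_(x in pball dist b) (u x `^ (- (p - 1)^-1))%:E)
      `^ (p - 1) <= Q%:E.
  move=> b0; have mb := mball Xd b; have := hQ b b0; rewrite /normalized_integral.
  have -> : \int[m]_(x in pball dist b) (W x)%:E = \int[m]_(x in pball dist b) (u x)%:E.
    have := ae_integral_powR 1 mb (@subsetT _ _) mTT mW mu_ Wu.
    under eq_integral do rewrite powRr1 ?W0//.
    by under [X in _ = X -> _]eq_integral do rewrite powRr1//.
  have -> : \int[m]_(x in pball dist b) ((1 / W x) `^ (1 / (p - 1)))%:E =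
      \int[m]_(x in pball dist b) (u x `^ (- (p - 1)^-1))%:E.
    under eq_integral do rewrite dual_powR ?W0//.
    exact: (ae_integral_powR _ mb (@subsetT _ _) mTT mW mu_ Wu).
  by [].
have [e [Q' [e0 hp]]] := Ap_self_improvement Xd oreg s0 Q0 mu_ u0 hu.
exists e; split; first exact: e0.
apply: (@balls_bounded_sup (fun B => normalized_integral mu B (B `&` E)
    (fun x => w x `^ (1 + e))%R * normalized_integral mu B (B `&` E)
    (fun x => (1 / w x `^ (1 + e)) `^ (1 / (p - 1)))%R `^ (p - 1)) Q') => b b0.
have n1 : nnmfun (EFin \o (fun x => u x `^ (1 + e))%R) by exact: nnmfun_powR.
have n2 : nnmfun (EFin \o (fun x => u x `^ (- ((1 + e) / (p - 1))))%R) by exact: nnmfun_powR.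
have := Ap_pair_bound Xd s0 n1 n2 (Ap_pair_restrict Xd mE n1 n2 hp) b0.
have wu : {ae m, forall x : T, E x -> w x = u x}.
  by move: WE Wu; apply: filterS2 => x h1 h2 Ex; rewrite -h1// h2.
have mbE : measurable (pball dist b `&` (E : set T)).
  by apply: measurableI => //; exact: (mball Xd).
rewrite /normalized_integral.
have -> : \int[m]_(x in pball dist b `&` E) ((1 / w x `^ (1 + e)) `^ (1 / (p - 1)))%:E =
    \int[m]_(x in pball dist b `&` E) (u x `^ (- ((1 + e) / (p - 1))))%:E.
  under eq_integral do rewrite dual_powR ?powR_ge0// -powRrM mulrN.
  by apply: (ae_integral_powR _ mbE _ mE mw mu_ wu) => x [].
have -> : \int[m]_(x in pball dist b `&` E) (w x `^ (1 + e))%:E =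
    \int[m]_(x in pball dist b `&` E) (u x `^ (1 + e))%:E.
  by apply: (ae_integral_powR _ mbE _ mE mw mu_ wu) => x [].
by [].
Qed.

Lemma Ap_extension_exists (p : R) : (1 < p)%R ->
  (exists e : R, (0 < e)%R /\
     ereal_sup [set normalized_integral mu B (B `&` E)
                      (fun x => w x `^ (1 + e))%R *
                    normalized_integral mu B (B `&` E)
                      (fun x => (1 / w x `^ (1 + e)) `^ (1 / (p - 1)))%R
                      `^ (p - 1)
               | B in @balls R X] < +oo) ->
  exists W : X -> R, Ap_class mu p W /\
     {ae mu_cara mu, forall x, E x -> W x = w x}.
Proof.
move=> p1 [e [e0 supw]]; have s0 : (0 < p - 1)%R by rewrite subr_gt0.
have [C Xd] := doubling_space_cara.
have [u [mu_ u0 wu]] := positive_version mE mw wpos.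
have u0' x : (0 <= u x)%R by exact: ltW.
have [Q Q0 hQ] := sup_balls_bounded supw.
have n1 : nnmfun (EFin \o (fun x => u x `^ (1 + e))%R) by exact: nnmfun_powR.
have n2 : nnmfun (EFin \o (fun x => u x `^ (- ((1 + e) / (p - 1))))%R) by exact: nnmfun_powR.
have uAp : Ap_pair m dist E (fun x => u x `^ (1 + e))%R
    (fun x => u x `^ (- ((1 + e) / (p - 1))))%R (p - 1) Q.
  apply: (Ap_bound_pair Xd s0 Q0 mE n1 n2) => [x|x|b b0]; [exact: powR_gt0|exact: powR_gt0|].
  have := hQ b b0; rewrite /normalized_integral.
  have mbE : measurable (pball dist b `&` (E : set T)).
    by apply: measurableI => //; exact: (mball Xd).
  have -> : \int[m]_(x in pball dist b `&` E) ((1 / w x `^ (1 + e)) `^ (1 / (p - 1)))%:E =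
      \int[m]_(x in pball dist b `&` E) (u x `^ (- ((1 + e) / (p - 1))))%:E.
    under eq_integral do rewrite dual_powR ?powR_ge0// -powRrM mulrN.
    by apply: (ae_integral_powR _ mbE _ mE mw mu_ wu) => x [].
  have -> : \int[m]_(x in pball dist b `&` E) (w x `^ (1 + e))%:E =
      \int[m]_(x in pball dist b `&` E) (u x `^ (1 + e))%:E.
    by apply: (ae_integral_powR _ mbE _ mE mw mu_ wu) => x [].
  by [].
have [W [Q' [mW W0 Wpos WE WAp]]] := Ap_extension Xd mE E_gt0 mu_ u0 s0 Q0 e0 uAp.
exists W; split; last first.
  by move: WE wu; apply: filterS2 => x h1 h2 Ex; rewrite h1// h2.
have nW : nnmfun (EFin \o W) by exact: nnmfun_EFin.
have nWs : nnmfun (EFin \o (fun x => W x `^ (- (p - 1)^-1))%R) by exact: nnmfun_powR.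
split.
  apply: weight_onT => // b b0; have [al [be [_ _ h _ _]]] := WAp b b0.
  by rewrite setIT in h; apply: le_lt_trans h _; rewrite ltry.
apply: (@balls_bounded_sup (fun B => normalized_integral mu B B W *
    normalized_integral mu B B (fun x => (1 / W x) `^ (1 / (p - 1)))%R
      `^ (p - 1)) Q') => b b0.
have := Ap_pair_bound Xd s0 nW nWs WAp b0; rewrite setIT /normalized_integral.
have -> : \int[m]_(x in pball dist b) ((1 / W x) `^ (1 / (p - 1)))%:E =
    \int[m]_(x in pball dist b) (W x `^ (- (p - 1)^-1))%:E.
  by under eq_integral do rewrite dual_powR ?W0//.
by [].
Qed.

Lemma ess_inf_on_ge (A : set X) (f : X -> R) (a : R) :
  {ae m, forall x : T, A x -> (a <= f x)%R} -> a%:E <= ess_inf_on mu A f.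
Proof.
move=> h; apply/ess_infP; move: h; apply: filterS => x h; rewrite /patch.
by case: ifPn; rewrite ?leey// inE => /h; rewrite lee_fin.
Qed.

Lemma ess_inf_on_le (A : set X) (f : X -> R) :
  {ae m, forall x : T, A x -> ess_inf_on mu A f <= (f x)%:E}.
Proof.
have := ess_inf_le m (patch (fun=> +oo) A (EFin \o f)).
by apply: filterS => x h Ax; move: h; rewrite {2}/patch mem_set.
Qed.

Lemma A1_restriction_holds :
  (exists W : X -> R, A1_class mu W /\
      {ae mu_cara mu, forall x, E x -> W x = w x}) ->
  exists e C : R, [/\ (0 < e)%R, (0 < C)%R &
      forall B, @balls R X B ->
        normalized_integral mu B (B `&` E) (fun x => w x `^ (1 + e))%R
        <= C%:E * ess_inf_on mu (B `&` E) (fun x => w x `^ (1 + e))%R].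
Proof.
move=> [W [[[W0 [mW _] Wpos] [c [c0 hc]]] WE]].
have {}WE : {ae m, forall x : T, E x -> W x = w x} := WE.
have [C Xd] := doubling_space_cara; have oreg := outer_regular_cara Xd.
have mTT : measurable [set: T] by [].
have [u [mu_ u0 Wu]] := positive_version mTT mW Wpos.
have u0' x : (0 <= u x)%R by exact: ltW.
have nu : nnmfun (EFin \o u) by exact: nnmfun_EFin.
have wu : {ae m, forall x : T, E x -> w x = u x}.
  by move: WE Wu; apply: filterS2 => x h1 h2 Ex; rewrite -h1// h2.
have uA1 : A1_weight m dist u c.
  split => // b b0; have mb := mball Xd b; have Vb := V_gt0 Xd b0.
  have bB : @balls R X (pball dist b) by exists b.1, b.2; split => //; rewrite -dball_ball.
  have Iu : \int[m]_(x in pball dist b) (W x)%:E = \int[m]_(x in pball dist b) (u x)%:E.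
    have := ae_integral_powR 1 mb (@subsetT _ _) mTT mW mu_ Wu.
    under eq_integral do rewrite powRr1 ?W0//.
    by under [X in _ = X -> _]eq_integral do rewrite powRr1//.
  pose N := (vol m dist b.1 b.2)^-1%:E * \int[m]_(x in pball dist b) (u x)%:E.
  have hN : N <= c%:E * ess_inf_on mu (pball dist b) W.
    by have := hc _ bB; rewrite /normalized_integral Iu.
  have Nae : {ae m, forall x : T, pball dist b x -> N <= (c * u x)%:E}.
    have := ess_inf_on_le (pball dist b) W; move: Wu; apply: filterS2 => x h1 h2 bx.
    apply: (le_trans hN); rewrite EFinM -h1//; apply: lee_wpmul2l; last exact: h2.
    by rewrite lee_fin ltW.
  have mub : 0 < m (pball dist b) by rewrite (mu_ball Xd b0) lte_fin.
  have [y _ hy] := ae_point mb mub Nae.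
  have N0 : 0 < N.
    rewrite mule_gt0 ?lte_fin ?invr_gt0//; apply: (nnint_gt0 mb nu mub).
    by apply: aeW => x _ /=; rewrite lte_fin.
  have NE : N = (fine N)%:E.
    by rewrite fineK// ge0_fin_numE ?(ltW N0)//; apply: le_lt_trans hy _; rewrite ltry.
  exists (fine N); split.
  - by rewrite -lte_fin -NE.
  - by rewrite EFinM -NE /N muleAC -EFinM mulVf ?gt_eqF// mul1e.
  - by move: Nae; apply: filterS => x h bx; rewrite -lee_fin -NE; exact: h.
have [e [c' [e0 c'0 h]]] := A1_self_improvement Xd oreg c0 uA1.
exists e, c'; split => // B [x [r [r0 ->]]].
pose b : T * R := (x, r); have b0 : (0 < b.2)%R by [].
have [a [Ia ha]] := h b b0; have mb := mball Xd b; have Vb := V_gt0 Xd b0.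
have mbE : measurable (pball dist b `&` (E : set T)) by exact: measurableI.
have n1 : nnmfun (EFin \o (fun x => u x `^ (1 + e))%R) by exact: nnmfun_powR.
rewrite (normalized_integralE b) -dball_ball -/(pball dist b).
have -> : \int[m]_(x in pball dist b `&` E) (w x `^ (1 + e))%:E =
    \int[m]_(x in pball dist b `&` E) (u x `^ (1 + e))%:E.
  by apply: (ae_integral_powR _ mbE _ mE mw mu_ wu) => z [].
apply: (@le_trans _ _ a%:E).
  rewrite lee_pdivrMl// -EFinM mulrC; apply: le_trans Ia.
  by apply: (@nnint_subset _ T R m) => //; exact: subIsetl.
rewrite -(divfK (_ : c' != 0%R) a) ?gt_eqF// mulrC EFinM.
apply: lee_wpmul2l; first by rewrite lee_fin ltW.
apply: ess_inf_on_ge; move: ha wu; apply: filterS2 => z h1 h2 [bz Ez].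
by rewrite h2// ler_pdivrMr// mulrC; exact: h1.
Qed.

Lemma A1_extension_exists :
  (exists e C : R, [/\ (0 < e)%R, (0 < C)%R &
      forall B, @balls R X B ->
        normalized_integral mu B (B `&` E) (fun x => w x `^ (1 + e))%R
        <= C%:E * ess_inf_on mu (B `&` E) (fun x => w x `^ (1 + e))%R]) ->
  exists W : X -> R, A1_class mu W /\
      {ae mu_cara mu, forall x, E x -> W x = w x}.
Proof.
move=> [e [K [e0 K0 hK]]]; have [C Xd] := doubling_space_cara.
have [u [mu_ u0 wu]] := positive_version mE mw wpos.
have u0' x : (0 <= u x)%R by exact: ltW.
pose g x := (u x `^ (1 + e))%:E.
have ng : nnmfun g by exact: nnmfun_powR.
have e1 : (0 < 1 + e)%R by lra.
have gA1 : {ae m, forall x, E x -> maxfun m dist E g x <= (C ^+ 2 * K)%:E * g x}.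
  apply: (maxfun_ae_le Xd mE ng (ltW K0)) => b b0.
  have mbE : measurable (pball dist b `&` (E : set T)).
    by apply: measurableI => //; exact: (mball Xd).
  have bB : @balls R X (pball dist b) by exists b.1, b.2; split => //; rewrite -dball_ball.
  have := hK _ bB; rewrite /normalized_integral.
  have -> : \int[m]_(x in pball dist b `&` E) (w x `^ (1 + e))%:E =
      \int[m]_(x in pball dist b `&` E) (u x `^ (1 + e))%:E.
    by apply: (ae_integral_powR _ mbE _ mE mw mu_ wu) => z [].
  move=> hb; have := ess_inf_on_le (pball dist b `&` E) (fun x => w x `^ (1 + e))%R.
  move: wu; apply: filterS2 => x h1 h2 bx Ex; apply: (le_trans hb).
  apply: lee_wpmul2l; first by rewrite lee_fin ltW.
  by rewrite /g -h1//; exact: h2.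
have gpos : {ae m, forall x, E x -> 0 < g x < +oo}.
  by apply: aeW => x _; rewrite /g lte_fin powR_gt0//= ltry.
have d01 : (0 < (1 + e)^-1 < 1)%R by rewrite invr_gt0 e1 /= invf_lt1//; lra.
have CK : (0 < C ^+ 2 * K)%R by rewrite mulr_gt0// exprn_gt0// (C_gt0 Xd).
have [W [c [c0 [mW W0 h] WE]]] := A1_extension Xd mE E_gt0 ng d01 CK gpos gA1.
exists W; split; last first.
  move: wu; apply: filterS => x hx Ex; rewrite WE// hx// /g /= -powRrM.
  by rewrite mulfV ?gt_eqF// powRr1.
split.
  apply: weight_onT => //.
    apply: (ae_balls Xd (x0 := point)) => n.
    have n0 : (0 < (point : T, n.+1%:R : R).2)%R by rewrite /= ltr0n.
    have [a [a0 _ ha]] := h _ n0; move: ha; apply: filterS => x hx bx.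
    by rewrite -(pmulr_rgt0 _ c0); apply: lt_le_trans a0 (hx bx).
  by move=> b b0; have [a [_ -> _]] := h b b0; rewrite ltry.
exists c; split => // B [x [r [r0 ->]]].
pose b : T * R := (x, r); have b0 : (0 < b.2)%R by [].
have [a [a0 Ia ha]] := h b b0; have Vb := V_gt0 Xd b0.
rewrite (normalized_integralE b) -dball_ball -/(pball dist b) Ia -EFinM mulrC mulfK ?gt_eqF//.
rewrite -(divfK (_ : c != 0%R) a) ?gt_eqF// mulrC EFinM.
apply: lee_wpmul2l; first by rewrite lee_fin ltW.
apply: ess_inf_on_ge; move: ha; apply: filterS => z h1 bz.
by rewrite ler_pdivrMr// mulrC; exact: h1.
Qed.

End Bridge.

Theorem theorem1p1 (R : realType) (X : completeMetricType R)
    (mu : {outer_measure set X -> \bar R})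
    (mu_regular : borel_regular mu) (mu_doubling : doubling mu)
    (E : set X) (mE : mu.-cara.-measurable E) (E_gt0 : 0 < mu E)
    (w : X -> R) (w_weight : weight_on mu E w) :
  (forall p : R, (1 < p)%R ->
    (exists W : X -> R, Ap_class mu p W /\
       {ae mu_cara mu, forall x, E x -> W x = w x})
    <->
    (exists e : R, (0 < e)%R /\
       ereal_sup [set normalized_integral mu B (B `&` E)
                        (fun x => w x `^ (1 + e))%R *
                      normalized_integral mu B (B `&` E)
                        (fun x => (1 / w x `^ (1 + e)) `^ (1 / (p - 1)))%R
                        `^ (p - 1)
                 | B in @balls R X] < +oo))
  /\
  ((exists W : X -> R, A1_class mu W /\
      {ae mu_cara mu, forall x, E x -> W x = w x})
   <->
   (exists e C : R, [/\ (0 < e)%R, (0 < C)%R &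
      forall B, @balls R X B ->
        normalized_integral mu B (B `&` E) (fun x => w x `^ (1 + e))%R
        <= C%:E * ess_inf_on mu (B `&` E) (fun x => w x `^ (1 + e))%R])).
Proof.
split=> [p p1|]; split.
- exact: Ap_restriction_holds.
- exact: Ap_extension_exists.
- exact: A1_restriction_holds.
- exact: A1_extension_exists.
Qed.
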